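(* Let $A$ be a closed symmetric linear relation with discrete spectrum in a Hilbert space $\mathfrak H$, with equal finite deficiency indices $n_+(A)=n_-(A)<\infty$, let $\Pi=\{\mathcal H,\Gamma_0,\Gamma_1\}$ be a boundary triplet for $A^*$, let $\tau\in\widetilde R(\mathcal H)$ and let $\widetilde A=\widetilde A_\tau$ (a linear relation in a Hilbert space $\widetilde{\mathfrak H}\supset\mathfrak H$) be the corresponding exit space self-adjoint extension of $A$. Then $\widetilde A$ has a discrete spectrum if and only if $\tau\in\widetilde R_{\rm mer}(\mathcal H)$.
   Context: Hilbert spaces are complex and separable; $B(\mathcal H)$ denotes bounded operators. A linear relation in $\mathcal H$ is a linear subspace $T\subset\mathcal H\oplus\mathcal H$ with elements $\{f,f'\}$; operators are identified with their graphs. $\ker T=\{f:\{f,0\}\in T\}$, $\operatorname{mul}T=\{f':\{0,f'\}\in T\}$, $T-\lambda=\{\{f,f'-\lambda f\}:\{f,f'\}\in T\}$, $-T=\{\{f,-f'\}\}$, $T^{-1}=\{\{f',f\}\}$, $T^*=\{\{g,g'\}:(f',g)=(f,g')\ \forall\{f,f'\}\in T\}$; $T$ is symmetric if $T\subset T^*$, self-adjoint if $T=T^*$. $n_\pm(A)=\dim\ker(A^*-\lambda)$, $\lambda\in\mathbb C_\pm$. A closed symmetric relation $A$ has a discrete spectrum if $\dim\ker(A-t)<\infty$ and $\operatorname{ran}(A-t)$ is closed for every $t\in\mathbb R$ (for a self-adjoint relation: $\sigma(A)=\sigma_p(A)$ has no finite limit points and all $\ker(A-t)$ are finite-dimensional).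 Boundary triplet for $A^*$: a Hilbert space $\mathcal H$ and linear maps $\Gamma_0,\Gamma_1:A^*\to\mathcal H$ such that $(\Gamma_0,\Gamma_1)^\top:A^*\to\mathcal H\oplus\mathcal H$ is surjective and $(f',g)-(f,g')=(\Gamma_1\widehat f,\Gamma_0\widehat g)-(\Gamma_0\widehat f,\Gamma_1\widehat g)$ for all $\widehat f=\{f,f'\},\widehat g=\{g,g'\}\in A^*$ (then $\dim\mathcal H=n_\pm(A)$). For a relation $\theta$ in $\mathcal H$, $A_\theta=\{\widehat f\in A^*:\{\Gamma_0\widehat f,\Gamma_1\widehat f\}\in\theta\}$. $\widetilde R(\mathcal H)$: functions $\tau$ on $\mathbb C\setminus\mathbb R$ whose values are closed linear relations in $\mathcal H$ such that $\operatorname{Im}(f',f)\ge0$ for $\{f,f'\}\in\tau(\lambda)$, $\lambda\in\mathbb C_+$; $(\tau(\lambda)+i)^{-1}\in B(\mathcal H)$ for $\lambda\in\mathbb C_+$ and is holomorphic there; $\tau^*(\lambda)=\tau(\bar\lambda)$. For $\tau\in\widetilde R(\mathcal H)$ the subspace $\mathcal K=\operatorname{mul}\tau(\lambda)$ is independent of $\lambda$, and with $\mathcal H_0=\mathcal H\ominus\mathcal K$ one has $\tau(\lambda)=\{\{h_0,\tau_0(\lambda)h_0+k\}:h_0\in\mathcal H_0,k\in\mathcal K\}$; $\tau_0$ is the operator part of $\tau$. When $\dim\mathcal H<\infty$, $\tau_0\in R[\mathcal H_0]$, the class of holomorphic $\tau_0:\mathbb C\setminus\mathbb R\to B(\mathcal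 H_0)$ with $\operatorname{Im}\lambda\cdot\operatorname{Im}\tau_0(\lambda)\ge0$, $\tau_0^*(\lambda)=\tau_0(\bar\lambda)$. $\tau\in\widetilde R_{\rm mer}(\mathcal H)$ means that $\tau_0$ admits a continuation to an entire or meromorphic function in $\mathbb C$. Exit space extension of $A$: a relation $\widetilde A=\widetilde A^*$ in $\widetilde{\mathfrak H}\supset\mathfrak H$ with $A\subset\widetilde A$ and no nontrivial subspace of $\widetilde{\mathfrak H}\ominus\mathfrak H$ reducing $\widetilde A$; extensions unitarily equivalent via a unitary that is the identity on $\mathfrak H$ are identified. For each $\tau\in\widetilde R(\mathcal H)$, $\widetilde A_\tau$ is the unique exit space extension with $P_{\mathfrak H}(\widetilde A_\tau-\lambda)^{-1}|_{\mathfrak H}=(A_{-\tau(\lambda)}-\lambda)^{-1}$, $\lambda\in\mathbb C\setminus\mathbb R$, $P_{\mathfrak H}$ being the orthoprojection in $\widetilde{\mathfrak H}$ onto $\mathfrak H$ (this is a bijection between $\widetilde R(\mathcal H)$ and all exit space extensions). *)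

(* Defs.v *)
From HB Require Import structures.
From mathcomp Require Import all_boot all_order all_algebra.
From mathcomp Require Import all_classical reals topology normedtype.
From mathcomp Require Import sesquilinear complex.

Set Implicit Arguments.
Unset Strict Implicit.
Unset Printing Implicit Defensive.

Import Order.TTheory GRing.Theory Num.Theory.
Import numFieldNormedType.Exports.

Local Open Scope classical_set_scope.
Local Open Scope ring_scope.

(* Separable complex Hilbert spaces.  The inner product is linear in its first
   argument.  The norm of a normed module over [R[i]] takes values in [R[i]]. *)
HB.mixin Record isHilbert (R : realType) V of CompleteNormedModule R[i] V := {
  hdot : {dot V for (@Num.conj R[i])};
  hdot_norm : forall x : V, hdot x x = `|x| ^+ 2;
  hilbert_separable : exists2 D : set V, countable D & dense D
}.

#[short(type="hilbertType")]
HB.structure Definition Hilbert (R : realType) :=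
  { V of isHilbert R V & CompleteNormedModule R[i] V }.

Section Subspaces.
Context (R : realType) (V : lmodType R[i]).
Implicit Types W : set V.

Definition linear_subspace W := submod_closed [in W].

Definition has_dim W (n : nat) :=
  exists e : 'I_n -> V,
    (forall c : 'I_n -> R[i], \sum_i c i *: e i = 0 -> forall i, c i = 0) /\
    W = range (fun c : 'I_n -> R[i] => \sum_i c i *: e i).

Definition finite_dim W := exists n, has_dim W n.

Definition linear_on (U : lmodType R[i]) W (f : V -> U) :=
  forall (a : R[i]) x y, W x -> W y -> f (a *: x + y) = a *: f x + f y.

End Subspaces.

(* A linear relation in [V] is a subspace of [V * V]; operators are identified
   with their graphs. *)
Section Relations.
Context (R : realType) (V : lmodType R[i]).
Implicit Types T : set (V * V).

Definition rel_ker T : set V := [set f | T (f, 0)].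
Definition rel_ran T : set V := [set p.2 | p in T].
Definition rel_mul T : set V := [set f' | T (0, f')].
Definition rel_shift T (l : R[i]) := [set (p.1, p.2 - l *: p.1) | p in T].
Definition rel_opp T := [set (p.1, - p.2) | p in T].
Definition rel_inv T := [set (p.2, p.1) | p in T].
Definition op_graph (B : V -> V) : set (V * V) := range (fun x => (x, B x)).

End Relations.

Section HilbertRelations.
Context (R : realType) (H : hilbertType R).
Implicit Types (W : set H) (T : set (H * H)).

Definition orth W : set H := [set x | forall y, W y -> hdot x y = 0].

Definition adjoint T : set (H * H) :=
  [set q | forall p, T p -> hdot p.2 q.1 = hdot p.1 q.2].

Definition symmetric_rel T := T `<=` adjoint T.
Definition selfadjoint_rel T := T = adjoint T.

Definition discrete_spectrum T := forall t : R,
  finite_dim (rel_ker (rel_shift T t%:C%C)) /\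
  closed (rel_ran (rel_shift T t%:C%C)).

(* [n_+(T) = m] and [n_-(T) = n] *)
Definition deficiency_indices T (m n : nat) :=
  (forall l : R[i], 0 < 'Im l -> has_dim (rel_ker (rel_shift (adjoint T) l)) m) /\
  (forall l : R[i], 'Im l < 0 -> has_dim (rel_ker (rel_shift (adjoint T) l)) n).

Definition reduces W T :=
  T = [set p + q | p in T `&` (W `*` W) & q in T `&` (orth W `*` orth W)].

(* [B] restricts to a bounded operator in the subspace [W]; its values outside
   of [W] are irrelevant. *)
Definition bounded_on W (B : H -> H) :=
  [/\ linear_on W B, (forall x, W x -> W (B x)) &
      exists M : R[i], forall x, W x -> `|B x| <= M * `|x|].

(* complex differentiability at [z], in the operator norm of [B(W)] *)
Definition op_derivable W (F : R[i] -> H -> H) (z : R[i]) :=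
  exists2 D : H -> H, bounded_on W D &
    forall e : R[i], 0 < e -> \forall w \near (z : R[i]^o), forall x, W x ->
      `|F w x - F z x - (w - z) *: D x| <= e * `|w - z| * `|x|.

Definition holomorphic_at W (F : R[i] -> H -> H) (z : R[i]) :=
  \forall w \near (z : R[i]^o), bounded_on W (F w) /\ op_derivable W F w.

(* [F] is meromorphic on the whole plane: near each point [z], some
   [(w - z)^m F(w)] has a holomorphic extension to [z].  The (isolated) poles
   of [F] carry irrelevant values; [m = 0] everywhere for an entire function. *)
Definition meromorphic W (F : R[i] -> H -> H) :=
  forall z : R[i], exists (m : nat) (G : R[i] -> H -> H),
    holomorphic_at W G z /\
    \forall w \near (z : R[i]^o)^',
      forall x, W x -> (w - z) ^+ m *: F w x = G w x.

End HilbertRelations.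

Section BoundaryTriplets.
Context (R : realType) (h H : hilbertType R).
Implicit Type A : set (h * h).

(* [G0] and [G1] are maps on [adjoint A]; their values elsewhere are
   irrelevant. *)
Definition boundary_triplet A (G0 G1 : h * h -> H) :=
  [/\ linear_on (adjoint A) G0, linear_on (adjoint A) G1,
      [set (G0 p, G1 p) | p in adjoint A] = setT &
      forall p q, adjoint A p -> adjoint A q ->
        hdot p.2 q.1 - hdot p.1 q.2 =
        hdot (G1 p) (G0 q) - hdot (G0 p) (G1 q)].

Definition extension_of A (G0 G1 : h * h -> H) (theta : set (H * H)) :
    set (h * h) :=
  [set p | adjoint A p /\ theta (G0 p, G1 p)].

End BoundaryTriplets.

(* Functions on the set of non-real numbers are total functions on [R[i]]
   whose values at real points are never used. *)
Section NevanlinnaFamilies.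
Context (R : realType) (H : hilbertType R).
Implicit Type tau : R[i] -> set (H * H).

Definition Rtilde tau :=
  [/\ forall l, 'Im l != 0 -> linear_subspace (tau l) /\ closed (tau l),
      forall l p, 0 < 'Im l -> tau l p -> 0 <= 'Im (hdot p.2 p.1),
      exists B : R[i] -> H -> H, forall l, 0 < 'Im l ->
        [/\ op_graph (B l) = rel_inv (rel_shift (tau l) (- 'i)),
            bounded_on setT (B l) & op_derivable setT B l] &
      forall l, 'Im l != 0 -> adjoint (tau l) = tau (l^*)].

(* [K] is the multivalued part of [tau] and [tau0] the operator part, with
   values in [B(orth K)] *)
Definition operator_part tau (K : set H) (tau0 : R[i] -> H -> H) :=
  forall l, 'Im l != 0 ->
    [/\ rel_mul (tau l) = K, bounded_on (orth K) (tau0 l) &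
        tau l = [set (x, tau0 l x + k) | x in orth K & k in K]].

Definition Rtilde_mer tau :=
  Rtilde tau /\
  exists (K : set H) (tau0 : R[i] -> H -> H),
    operator_part tau K tau0 /\
    exists2 F : R[i] -> H -> H, meromorphic (orth K) F &
      forall l, 'Im l != 0 -> forall x, orth K x -> F l x = tau0 l x.

End NevanlinnaFamilies.

(* The inclusion of [h] in a larger Hilbert space [ht] is represented by a
   linear isometry [J : h -> ht]. *)
Section ExitSpaceExtensions.
Context (R : realType) (h H ht : hilbertType R) (J : {linear h -> ht}).

Definition isometric := forall x y, hdot (J x) (J y) = hdot x y.

Definition exit_space_extension (A : set (h * h)) (At : set (ht * ht)) :=
  [/\ selfadjoint_rel At,
      [set (J p.1, J p.2) | p in A] `<=` At &
      forall N : set ht, linear_subspace N -> closed N ->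
        N `<=` orth (range J) -> reduces N At -> N = [set 0]].

(* [P T | h], [P] the orthogonal projection of [ht] onto [h]: the relation
   [f = P u] reads [u - J f _|_ range J]. *)
Definition compression (T : set (ht * ht)) : set (h * h) :=
  [set p | exists2 u, T (J p.1, u) & orth (range J) (u - J p.2)].

(* [At] is the exit space extension of [A] that corresponds to [tau]; it is
   determined up to unitary equivalence over [h]. *)
Definition extension_for (A : set (h * h)) (G0 G1 : h * h -> H)
    (tau : R[i] -> set (H * H)) (At : set (ht * ht)) :=
  exit_space_extension A At /\
  forall l, 'Im l != 0 ->
    compression (rel_inv (rel_shift At l)) =
    rel_inv (rel_shift (extension_of A G0 G1 (rel_opp (tau l))) l).

End ExitSpaceExtensions.

(* Main.v *)
Require Import Defs.
From mathcomp Require Import all_boot all_order all_algebra.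
From mathcomp Require Import all_classical reals topology normedtype derive.
From mathcomp Require Import sesquilinear complex ring lra.

(* Idea.  Write [ht = J h + W], [W = orth (range J)].  Imposing [G0 = 0] on the inner
   component of [At] gives a self-adjoint relation [T] in [W], and [tau] is its
   Weyl function: for fixed vectors [g j] of [W] the matrix of the operator part is
     - (e j, G1 (p i)) + (l + 'i) ((g j, g i) + (l - 'i) ((T - l)^-1 g j, g i)).
   Both [At] and [A + T] are finite-dimensional extensions of [A + S], where [S] is
   the part of [At] in [W]; since [S - t] is injective by minimality and closed
   ranges pass to finite-dimensional extensions and back, [At] has a discrete
   spectrum iff every [ran (T - t)] is closed.

   If [ran (T - t)] is closed, uniform boundedness makes the resolvent regular on it
   near [t], so that [t] is at most a simple pole of the Weyl function.  Conversely,
   if [tau] is meromorphic, [Im ((T - l)^-1 y, y)] tends to 0 at the real points of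
   a punctured neighborhood of [t], for [y] in a subspace which is dense by
   minimality.  Comparing this positive harmonic function, by the maximum principle
   on a rectangle, with a multiple of [Im (a - l)^-1 + Im (b - l)^-1] bounds
   [(T - l)^-1 y] by [|y|], first by [3 |y| / |l - t|], then on [ran (T - t)]
   uniformly up to [t]; hence [ran (T - t)] is closed.  This replaces the spectral
   theorem and Stieltjes inversion. *)

Set Implicit Arguments.
Unset Strict Implicit.
Unset Printing Implicit Defensive.

Import Order.TTheory GRing.Theory Num.Theory.
Import numFieldNormedType.Exports.

Local Open Scope classical_set_scope.
Local Open Scope ring_scope.

(** * Real-valued norms *)

(** The obstacle is the real axis: relations are controlled only through resolvents at non-real
    points, so a statement at a real [t] is reached as a limit along [t + 'i e] for [e] decreasing
    to 0, and closedness of [T] turns the limit into a solution of [(T - t) w = y]. On [ran (T - t)]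
    this works once resolvents are uniformly bounded there, and [(T - l)^-1 (T - t) u = u + (l - t)
    (T - l)^-1 u] is the tool for such bounds. Regularity of [tau] enters through one identity: if
    [u] is the exit component of the solution at [l] with boundary value [e j], the diagonal entry
    of the operator part has imaginary part [Im l |u|^2]. It changes sign across the real axis, so a
    continuation is real at real points that are not poles. The [g j] are these exit components at
    the base point ['i], and [u = g j + (l - 'i) (T - l)^-1 g j] carries the smallness over to the
    resolvent. All finiteness comes from the deficiency indices: they make [H] finite-dimensional,
    so that vanishing of boundary values amounts to finitely many linear conditions. *)

Notation rp := complex.Re.
Notation ip := complex.Im.

(** Norms take values in [R[i]], whose order is partial; the real part moves every estimate to the
    ordered field [R], where [lra] applies. *)
Definition rn (R : realType) (V : normedZmodType R[i]) (x : V) : R :=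
  rp `|x|.

Section RealNorm.
Context (R : realType).

Lemma complex_eq (a b : R[i]) : rp a = rp b -> ip a = ip b -> a = b.
Proof. by case: a b => [? ?] [? ?] /= -> ->. Qed.

Lemma normrnE (V : normedZmodType R[i]) (x : V) : `|x| = (rn x)%:C%C.
Proof. by rewrite /rn RRe_real// normr_real. Qed.

Section Zmod.
Context (V : normedZmodType R[i]).
Implicit Types x y : V.

Lemma rn_ge0 x : 0 <= rn x.
Proof. by rewrite -ler0c -normrnE. Qed.

Lemma rn0 : rn (0 : V) = 0.
Proof. by rewrite /rn normr0. Qed.

Lemma rnN x : rn (- x) = rn x.
Proof. by rewrite /rn normrN. Qed.

Lemma rnB x y : rn (x - y) = rn (y - x).
Proof. by rewrite /rn distrC. Qed.

Lemma rnD x y : rn (x + y) <= rn x + rn y.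
Proof. by rewrite -lecR rmorphD/= -!normrnE ler_normD. Qed.

Lemma rn_eq0 x : rn x = 0 -> x = 0.
Proof. by move=> x0; apply/eqP; rewrite -normr_eq0 normrnE x0. Qed.

Lemma rn_gt0 x : x != 0 -> 0 < rn x.
Proof.
by move=> x0; rewrite lt0r rn_ge0 andbT; apply: contraNN x0 => /eqP/rn_eq0 ->.
Qed.

Lemma rn_triangle z x y : rn (x - y) <= rn (x - z) + rn (z - y).
Proof. by rewrite (le_trans _ (rnD _ _))// addrA subrK. Qed.

Lemma rn_le_sub x y : rn x - rn y <= rn (x - y).
Proof. by rewrite lerBlDr (le_trans _ (rnD _ _))// subrK. Qed.

Lemma rn_sum (I : Type) (r : seq I) (P : pred I) (F : I -> V) :
  rn (\sum_(i <- r | P i) F i) <= \sum_(i <- r | P i) rn (F i).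
Proof.
elim/big_rec2: _ => [|i y1 y2 _ h]; first by rewrite rn0.
by rewrite (le_trans (rnD _ _))// lerD2l.
Qed.

End Zmod.

Lemma rnM (a b : R[i]) : rn (a * b) = rn a * rn b.
Proof. by apply: complexI; rewrite rmorphM/= -!normrnE normrM. Qed.

Lemma rnV (a : R[i]) : rn a^-1 = (rn a)^-1.
Proof. by apply: complexI; rewrite fmorphV/= -!normrnE normfV. Qed.

Lemma rnX (a : R[i]) n : rn (a ^+ n) = rn a ^+ n.
Proof. by apply: complexI; rewrite rmorphXn/= -!normrnE normrX. Qed.

Lemma rn_real (x : R) : rn (x%:C%C) = `|x|.
Proof. by rewrite /rn normc_def /= expr0n /= addr0 sqrtr_sqr. Qed.

Lemma rn1 : rn (1 : R[i]) = 1.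
Proof. by rewrite /rn normr1. Qed.


Lemma rnC_sqr (a : R[i]) : rn a ^+ 2 = rp a ^+ 2 + ip a ^+ 2.
Proof. by apply: complexI; rewrite rmorphXn/= -normrnE -add_Re2_Im2. Qed.

Lemma rn_i : rn ('i : R[i]) = 1.
Proof.
apply/eqP; rewrite -(@eqrXn2 _ 2)// ?rn_ge0// rnC_sqr -complexiE /=.
by rewrite expr0n expr1n add0r.
Qed.

Lemma rn_ge_rp (a : R[i]) : `|rp a| <= rn a.
Proof.
by rewrite -(@ler_pXn2r _ 2)// ?nnegrE ?rn_ge0// rnC_sqr real_normK ?num_real// lerDl sqr_ge0.
Qed.

Lemma rn_ge_ip (a : R[i]) : `|ip a| <= rn a.
Proof.
by rewrite -(@ler_pXn2r _ 2)// ?nnegrE ?rn_ge0// rnC_sqr real_normK ?num_real// lerDr sqr_ge0.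
Qed.

Lemma conjE (a : R[i]) : a^* = Complex (rp a) (- ip a).
Proof. by case: a. Qed.

Lemma rp_conj (a : R[i]) : rp a^* = rp a. Proof. by rewrite conjE. Qed.
Lemma ip_conj (a : R[i]) : ip a^* = - ip a. Proof. by rewrite conjE. Qed.

Lemma conj_real (x : R) : (x%:C%C : R[i])^* = x%:C%C.
Proof. by rewrite conjE /= oppr0. Qed.

Lemma imE (a : R[i]) : 'Im a = (ip a)%:C%C.
Proof. by rewrite -complexIm. Qed.

Lemma im_neq0 (a : R[i]) : ('Im a != 0) = (ip a != 0).
Proof. by rewrite imE eq_complex /= eqxx andbT. Qed.

Lemma im_gt0 (a : R[i]) : (0 < 'Im a) = (0 < ip a).
Proof. by rewrite imE ltcR. Qed.

Lemma im_lt0 (a : R[i]) : ('Im a < 0) = (ip a < 0).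
Proof. by rewrite imE ltcR. Qed.

Lemma rpD (a b : R[i]) : rp (a + b) = rp a + rp b.
Proof. by case: a b => [? ?] []. Qed.
Lemma ipD (a b : R[i]) : ip (a + b) = ip a + ip b.
Proof. by case: a b => [? ?] []. Qed.
Lemma rpN (a : R[i]) : rp (- a) = - rp a. Proof. by case: a. Qed.
Lemma ipN (a : R[i]) : ip (- a) = - ip a. Proof. by case: a. Qed.
Lemma rpM (a b : R[i]) : rp (a * b) = rp a * rp b - ip a * ip b.
Proof. by case: a b => [? ?] []. Qed.
Lemma ipM (a b : R[i]) : ip (a * b) = rp a * ip b + ip a * rp b.
Proof. by case: a b => [? ?] []. Qed.
Lemma rp_i : rp ('i : R[i]) = 0. Proof. by rewrite -complexiE. Qed.
Lemma ip_i : ip ('i : R[i]) = 1. Proof. by rewrite -complexiE. Qed.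

Section Nmod.
Context (V : normedModType R[i]).

Lemma rnZ (a : R[i]) (x : V) : rn (a *: x) = rn a * rn x.
Proof. by apply: complexI; rewrite rmorphM/= -!normrnE normrZ. Qed.

Lemma nearrnP (z : V) (P : V -> Prop) :
  (\forall w \near z, P w) <->
  exists2 d : R, 0 < d & forall w, rn (w - z) < d -> P w.
Proof.
split.
  move=> /nbhs_normP[e/= e0 H].
  have er : e = (rp e)%:C%C by rewrite RRe_real// gtr0_real.
  exists (rp e); first by rewrite -ltcR -er.
  by move=> w wz; apply: H => /=; rewrite distrC er normrnE ltcR.
move=> [d d0 H]; apply/nbhs_normP; exists d%:C%C; first by rewrite /= ltcR.
by move=> w /=; rewrite distrC normrnE ltcR => /H.
Qed.

Lemma closedrnP (W : set V) : closed W <->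
  (forall x, (forall e : R, 0 < e -> exists2 w, W w & rn (w - x) < e) -> W x).
Proof.
split=> [cW x H|H].
  apply: cW => B /nearrnP[d d0 dB].
  by have [w Ww wx] := H d d0; exists w; split => //; exact: dB.
move=> x cx; apply: H => e e0.
have [|w [Ww wx]] := cx [set w | rn (w - x) < e]; last by exists w.
by apply/nearrnP; exists e.
Qed.

End Nmod.

Section Complete.
Context (V : completeNormedModType R[i]).

Lemma cauchy_seqP (u : nat -> V) :
  (forall e : R, 0 < e -> exists N, forall m n, (N <= m)%N -> (N <= n)%N ->
     rn (u m - u n) < e) ->
  exists l, forall e : R, 0 < e -> exists N, forall n, (N <= n)%N ->
    rn (u n - l) < e.
Proof.
move=> cu.
have : cvg (u @ \oo).
  apply/cauchy_cvgP/cauchy_exP => e e0.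
  have er : e = (rp e)%:C%C by rewrite RRe_real// gtr0_real.
  have [|N HN] := cu (rp e); first by rewrite -ltcR -er.
  exists (u N); exists N => // n /= Nn.
  by rewrite /fmapE -ball_normE /= er normrnE ltcR; apply: HN.
rewrite cvg_ex => -[l ul]; exists l => e e0.
have : nbhs l [set w | rn (w - l) < e] by apply/nearrnP; exists e.
by move=> /ul[N _ HN]; exists N => n Nn; exact: HN.
Qed.

(** Completeness for a parameter decreasing to 0, the form needed for resolvents on a vertical
    segment above a real point. The limit is found along [1 / (n + 1)]. *)
Lemma cauchy0P (u : R -> V) :
  (forall e : R, 0 < e -> exists2 d : R, 0 < d & forall s t,
     0 < s -> s < d -> 0 < t -> t < d -> rn (u s - u t) < e) ->
  exists l, forall e : R, 0 < e -> exists2 d : R, 0 < d & forall s,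
    0 < s -> s < d -> rn (u s - l) < e.
Proof.
move=> cu; pose v n := u (n.+1%:R^-1).
have harm d : 0 < d -> exists N, forall n, (N <= n)%N -> n.+1%:R^-1 < d :> R.
  move=> d0; exists (Num.truncn d^-1) => n Nn.
  rewrite -ltf_pV2 ?posrE ?invr_gt0// invrK.
  apply: lt_le_trans (truncnS_gt _) _; by rewrite ler_nat ltnS.
have [|l vl] := @cauchy_seqP v.
  move=> e /cu[d d0 H]; have [N HN] := harm d d0.
  by exists N => m n Nm Nn; apply: H; rewrite ?invr_gt0// HN.
exists l => e e0; have [|d d0 H] := cu (e / 2); first by rewrite divr_gt0.
exists d => // s s0 sd; have [|N HN] := vl (e / 2); first by rewrite divr_gt0.
have [M HM] := harm d d0.
rewrite (le_lt_trans (rn_triangle (v (maxn M N)) _ _))// [ltRHS]splitr ltrD//.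
  by apply: H => //; [rewrite invr_gt0|apply: HM; rewrite leq_maxl].
by apply: HN; rewrite leq_maxr.
Qed.

End Complete.

End RealNorm.

(** * Inner products and orthogonal projections *)

Section Subspace.
Context (R : realType) (V : lmodType R[i]).
Implicit Types W : set V.

Lemma subspP W : linear_subspace W <->
  W 0 /\ forall (a : R[i]) x y, W x -> W y -> W (a *: x + y).
Proof.
split=> [[W0 WL]|[W0 WL]].
  split=> [|a x y Wx Wy]; first by rewrite inE in W0.
  by have := WL a x y; rewrite !inE; exact.
by split=> [|a x y]; rewrite !inE// => Wx Wy; apply: WL.
Qed.

Context (W : set V).
Hypothesis sW : linear_subspace W.

Lemma subsp0 : W 0. Proof. by have [] := (subspP W).1 sW. Qed.

Lemma subspZD a x y : W x -> W y -> W (a *: x + y).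
Proof. by have [_] := (subspP W).1 sW; exact. Qed.

Lemma subspZ a x : W x -> W (a *: x).
Proof. by move=> Wx; rewrite -[_ *: _]addr0; apply: subspZD => //; exact: subsp0. Qed.

Lemma subspD x y : W x -> W y -> W (x + y).
Proof. by move=> Wx Wy; rewrite -[x]scale1r; apply: subspZD. Qed.

Lemma subspN x : W x -> W (- x).
Proof. by move=> Wx; rewrite -scaleN1r; apply: subspZ. Qed.

Lemma subspB x y : W x -> W y -> W (x - y).
Proof. by move=> Wx Wy; apply: subspD => //; exact: subspN. Qed.

Lemma subsp_sum (I : Type) (r : seq I) (F : I -> V) :
  (forall i, W (F i)) -> W (\sum_(i <- r) F i).
Proof. by move=> WF; elim/big_ind: _ => //; [exact: subsp0|exact: subspD]. Qed.

End Subspace.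

Section HilbertBasics.
Context (R : realType) (V : hilbertType R).
Implicit Types (x y z : V) (W : set V).

Lemma hdotDl x y z : hdot (x + y) z = hdot x z + hdot y z.
Proof. exact: linearDl. Qed.
Lemma hdotDr x y z : hdot x (y + z) = hdot x y + hdot x z.
Proof. exact: linearDr. Qed.
Lemma hdotNl x z : hdot (- x) z = - hdot x z.
Proof. exact: linearNl. Qed.
Lemma hdotNr x z : hdot x (- z) = - hdot x z.
Proof. exact: linearNr. Qed.
Lemma hdotBl x y z : hdot (x - y) z = hdot x z - hdot y z.
Proof. exact: linearBl. Qed.
Lemma hdotBr x y z : hdot x (y - z) = hdot x y - hdot x z.
Proof. exact: linearBr. Qed.
Lemma hdotZl (a : R[i]) x z : hdot (a *: x) z = a * hdot x z.
Proof. exact: linearZl_LR. Qed.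
Lemma hdotZr (a : R[i]) x z : hdot x (a *: z) = a^* * hdot x z.
Proof. exact: linearZr_LR. Qed.
Lemma hdot0l x : hdot 0 x = 0 :> R[i].
Proof. exact: linear0l. Qed.
Lemma hdot0r x : hdot x 0 = 0 :> R[i].
Proof. exact: linear0r. Qed.
Lemma hdot_suml (I : Type) (r : seq I) (F : I -> V) x :
  hdot (\sum_(i <- r) F i) x = \sum_(i <- r) hdot (F i) x.
Proof. by apply: (big_morph (fun y => hdot y x)) => [y z|]; rewrite ?hdotDl ?hdot0l. Qed.
Lemma hdot_sumr (I : Type) (r : seq I) (F : I -> V) x :
  hdot x (\sum_(i <- r) F i) = \sum_(i <- r) hdot x (F i).
Proof. by apply: (big_morph (hdot x)) => [y z|]; rewrite ?hdotDr ?hdot0r. Qed.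

Lemma hdotC x y : hdot x y = (hdot y x)^* :> R[i].
Proof. by rewrite hermC expr0 mul1r. Qed.

Lemma hdotxx x : hdot x x = (rn x ^+ 2)%:C%C.
Proof. by rewrite hdot_norm normrnE -rmorphXn. Qed.

Lemma hdotxx_eq0 x : hdot x x = 0 -> x = 0.
Proof.
rewrite hdotxx => -[] /eqP; rewrite sqrf_eq0 => /eqP; exact: rn_eq0.
Qed.

Lemma rn_sqrE x : rn x ^+ 2 = rp (hdot x x).
Proof. by rewrite hdotxx. Qed.

Lemma rnD_sqr x y : rn (x + y) ^+ 2 = rn x ^+ 2 + rn y ^+ 2 + 2 * rp (hdot x y).
Proof.
rewrite !rn_sqrE hdotDl !hdotDr !rpD (hdotC y x) rp_conj; ring.
Qed.

Lemma rnB_sqr x y : rn (x - y) ^+ 2 = rn x ^+ 2 + rn y ^+ 2 - 2 * rp (hdot x y).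
Proof. by rewrite rnD_sqr rnN hdotNr rpN mulrN. Qed.

Lemma rn_pyth x y : hdot x y = 0 -> rn (x + y) ^+ 2 = rn x ^+ 2 + rn y ^+ 2.
Proof. by move=> xy; rewrite rnD_sqr xy mulr0 addr0. Qed.

Lemma cauchy_schwarz x y : rn (hdot x y) <= rn x * rn y.
Proof.
have [->|y0] := eqVneq y 0; first by rewrite hdot0r !rn0 mulr0.
have yy := rn_gt0 y0.
pose c := hdot x y / hdot y y.
have h : hdot (x - c *: y) (c *: y) = 0.
  rewrite hdotZr hdotBl hdotZl /c divfK ?subrr ?mulr0//.
  by apply: contraNN y0 => /eqP/hdotxx_eq0 ->.
have := rn_pyth h; rewrite subrK => H.
have : rn (c *: y) <= rn x.
  by rewrite -(@ler_pXn2r _ 2)// ?nnegrE ?rn_ge0// H lerDr sqr_ge0.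
rewrite rnZ /c rnM rnV hdotxx rn_real ger0_norm ?sqr_ge0// expr2.
by rewrite invfM !mulrA divfK ?gt_eqF// ler_pdivrMr.
Qed.

Lemma orth_subspace W : linear_subspace (orth W).
Proof.
apply/subspP; split=> [y _|a x y ox oy z Wz]; first by rewrite hdot0l.
by rewrite hdotDl hdotZl ox// oy// mulr0 addr0.
Qed.

Lemma hdot_closed x y : (forall e : R, 0 < e -> exists2 w, hdot w y = 0 & rn (w - x) < e) ->
  hdot x y = 0.
Proof.
move=> H; apply: rn_eq0; apply/eqP; rewrite eq_le rn_ge0 andbT.
apply/ler_addgt0Pr => e e0; rewrite add0r.
have [|w wy wx] := H (e / (rn y + 1)).
  by rewrite divr_gt0// ltr_wpDl// rn_ge0.
have -> : hdot x y = hdot (x - w) y by rewrite hdotBl wy subr0.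
rewrite (le_trans (cauchy_schwarz _ _))//.
have wx' : rn (x - w) <= e / (rn y + 1) by rewrite rnB ltW.
rewrite (le_trans (ler_wpM2r (rn_ge0 _) wx'))//.
rewrite mulrAC ler_pdivrMr ?ltr_wpDl ?rn_ge0//.
by rewrite ler_pM2l// lerDl.
Qed.

Lemma orth_closed W : closed (orth W).
Proof.
apply/closedrnP => x H y Wy; apply: hdot_closed => e /H[w ow wx].
by exists w => //; exact: ow.
Qed.

Lemma orth_sym W x y : orth W x -> W y -> hdot y x = 0.
Proof. by move=> ox Wy; rewrite hdotC ox// conjC0. Qed.

Lemma orthorth_sub W : W `<=` orth (orth W).
Proof. by move=> x Wx y oy; rewrite (orth_sym oy). Qed.

Lemma orthS W1 W2 : W1 `<=` W2 -> orth W2 `<=` orth W1.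
Proof. by move=> s x ox y /s; exact: ox. Qed.

Lemma orthK W : orth (orth (orth W)) = orth W.
Proof.
by apply/seteqP; split; [apply: orthS; exact: orthorth_sub|exact: orthorth_sub].
Qed.

Lemma projection W : linear_subspace W -> closed W ->
  forall x, exists2 p, W p & orth W (x - p).
Proof.
move=> sW cW x.
pose S := [set rn (x - w) ^+ 2 | w in W].
have infS : has_inf S.
  split; first by exists (rn (x - 0) ^+ 2), 0 => //; exact: subsp0.
  by exists 0 => _ [w _ <-]; exact: sqr_ge0.
pose d := inf S.
have dle w : W w -> d <= rn (x - w) ^+ 2.
  by move=> Ww; apply: ge_inf; [exact: infS.2|exists w].
have d0 : 0 <= d.
  apply: lb_le_inf; first exact: infS.1.
  by move=> _ [w _ <-]; exact: sqr_ge0.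
(* The condition [0 < s] stands inside the existential so that the choice [u] is total in [s]. *)
have exw (s : R) : exists w, 0 < s -> W w /\ rn (x - w) ^+ 2 < d + s.
  have [s0|s0] := ltP 0 s; last by exists 0.
  by have [_ [w Ww <-] wd] := inf_adherent s0 infS; exists w.
pose u s := sval (cid (exw s)).
have uP s : 0 < s -> W (u s) /\ rn (x - u s) ^+ 2 < d + s.
  exact: (svalP (cid (exw s))).
(* Parallelogram law: the midpoint of [a] and [b] lies in [W], at squared distance at least [d] from
   [x], so near-minimizers are close to each other. *)
have par a b : W a -> W b -> rn (a - b) ^+ 2 <=
    2 * rn (x - a) ^+ 2 + 2 * rn (x - b) ^+ 2 - 4 * d.
  move=> Wa Wb.
  pose h : R[i] := 2^-1.
  have h0 := dle (h *: (a + b)) (subspZ sW h (subspD sW Wa Wb)).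
  have e1 : a - b = (x - b) - (x - a) by rewrite opprB [RHS]addrC addrA subrK.
  have e2 : x - h *: (a + b) = h *: ((x - a) + (x - b)).
    rewrite addrACA -opprD -mulr2n scalerBr; congr (_ - _).
    by rewrite -[x *+ 2]scaler_nat scalerA mulVf ?scale1r// pnatr_eq0.
  have rnh : rn h = 2^-1.
    have -> : h = (2^-1 : R)%:C%C by rewrite fmorphV rmorph_nat.
    by rewrite rn_real ger0_norm ?invr_ge0.
  move: h0; rewrite e2 e1 rnB_sqr (hdotC (x - b)) rp_conj rnZ rnh exprMn (rnD_sqr (x - a)).
  lra.
have [|l ul] := @cauchy0P _ V u.
  move=> e e0; exists (e ^+ 2 / 4); first by rewrite divr_gt0 ?exprn_gt0.
  move=> s t s0 sd t0 td; rewrite -(@ltr_pXn2r _ 2)// ?nnegrE ?rn_ge0 ?ltW//.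
  have [Ws us] := uP s s0; have [Wt ut] := uP t t0.
  rewrite (le_lt_trans (par _ _ Ws Wt))//; lra.
have Wl : W l.
  apply: (closedrnP W).1 => // e /ul[d' d'0 H].
  exists (u (d' / 2)); first by have [] := uP (d' / 2); rewrite ?divr_gt0.
  by apply: H; rewrite ?divr_gt0// ltr_pdivrMr// ltr_pMr// ltr1n.
have xl : rn (x - l) ^+ 2 <= d.
  apply/ler_addgt0Pr => e e0.
  pose k := rn (x - l).
  have k0 : 0 <= k := rn_ge0 _.
  pose e1 := Num.min 1 (e / (4 * (k + 1))).
  have e10 : 0 < e1 by rewrite lt_min ltr01 divr_gt0// mulr_gt0// ltr_wpDl.
  have [d' d'0 H] := ul e1 e10.
  pose s := Num.min (d' / 2) (e / 4).
  have s0 : 0 < s by rewrite lt_min !divr_gt0.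
  have [Ws us] := uP s s0.
  have sd2 : s <= d' / 2 by rewrite ge_min lexx.
  have sd' : s < d' by lra.
  have h := H s s0 sd'.
  have h1 : k <= rn (x - u s) + e1.
    by rewrite (le_trans (rn_triangle (u s) _ _))// lerD2l ltW.
  have se : s <= e / 4 by rewrite ge_min lexx orbT.
  have e11 : e1 <= 1 by rewrite ge_min lexx.
  have : e1 * (4 * (k + 1)) <= e.
    by rewrite -ler_pdivlMr ?mulr_gt0 ?ltr_wpDl// ge_min lexx orbT.
  move: us h1; rewrite -/k; set r := rn _ => us h1 e1e.
  have r0 : 0 <= r := rn_ge0 _.
  have [ke|ke] := lerP k e1.
    have := ler_wpM2l k0 ke; rewrite -expr2; lra.
  have : (k - e1) ^+ 2 <= r ^+ 2 by rewrite ler_pXn2r ?nnegrE//; lra.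
  have := sqr_ge0 e1; rewrite sqrrB; lra.
exists l => // y Wy.
(* Minimality of [l] against [l + a *: y]. The choice [a = (x - l, y) / |y|^2] leaves
   [- |(x - l, y)|^2 / |y|^2 >= 0]. *)
have key (a : R[i]) : 0 <= rn a ^+ 2 * rn y ^+ 2 - 2 * rp (a^* * hdot (x - l) y).
  have := dle (l + a *: y) (subspD sW Wl (subspZ sW a Wy)).
  rewrite opprD addrA rnB_sqr hdotZr rnZ exprMn; lra.
have [->|y0] := eqVneq y 0; first by rewrite hdot0r.
have yy := rn_gt0 y0.
have := key (hdot (x - l) y * ((rn y ^+ 2)^-1)%:C%C).
set c := hdot _ _.
rewrite rnM rn_real ger0_norm ?invr_ge0 ?sqr_ge0// exprMn.
rewrite rmorphM/= mulrAC -mulrA rpM.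
rewrite !rpM !ipM !rp_conj !ip_conj /= rnC_sqr.
set q := rn y ^+ 2; have q0 : 0 < q by rewrite exprn_gt0.
have -> : q * q^-1 ^+ 2 = q^-1 by rewrite expr2 mulrA divff ?mul1r ?gt_eqF.
have q1 : 0 < q^-1 by rewrite invr_gt0.
set m := rp c; set n := ip c => h.
have {h} h : (m ^+ 2 + n ^+ 2) * q^-1 <= 0 by lra.
rewrite pmulr_lle0// in h.
have m0 := sqr_ge0 m; have n0 := sqr_ge0 n.
apply: rn_eq0; apply/eqP; rewrite -sqrf_eq0 rnC_sqr -/m -/n; apply/eqP; lra.
Qed.

Lemma orthorth W : linear_subspace W -> closed W -> orth (orth W) = W.
Proof.
move=> sW cW; apply/seteqP; split; last exact: orthorth_sub.
move=> x ox; have [p Wp op] := projection sW cW x.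
suff -> : x = p by [].
apply/eqP; rewrite -subr_eq0; apply/eqP/hdotxx_eq0.
by rewrite hdotBl (ox _ op) (orth_sym op Wp) subrr.
Qed.

End HilbertBasics.

(** * Self-adjoint relations and their resolvents *)

(** Closedness for a real gauge [N], so that one argument about finite-dimensional extensions serves
    vectors, with [rn], as well as relations, with the graph norm [rn2]. *)
Definition nclosed (R : realType) (V : lmodType R[i]) (N : V -> R)
    (W : set V) :=
  forall x, (forall e : R, 0 < e -> exists2 w, W w & N (w - x) < e) -> W x.

Definition rn2 (R : realType) (V : normedModType R[i]) (p : V * V) : R :=
  rn p.1 + rn p.2.

Section Relations.
Context (R : realType).

Lemma closed_nclosed2 (V : normedModType R[i]) (T : set (V * V)) :
  closed T -> nclosed (@rn2 R V) T.
Proof.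
move=> cT [x y] H; apply: cT => B [[Q1 Q2] [/= /nearrnP[d1 d10 D1] /nearrnP[d2 d20 D2]] QB].
have [|[w w'] Tw wd] := H (Num.min d1 d2); first by rewrite lt_min d10.
move: wd; rewrite /rn2 /= lt_min => /andP[h1 h2].
have a1 := rn_ge0 (w - x); have a2 := rn_ge0 (w' - y).
exists (w, w'); split => //; apply: QB; split => /=.
  by apply: D1; apply: le_lt_trans h1; rewrite lerDl.
by apply: D2; apply: le_lt_trans h2; rewrite lerDr.
Qed.

Context (V : hilbertType R).
Implicit Types (T : set (V * V)) (W : set V).

Lemma adjoint_subspace T : linear_subspace (adjoint T).
Proof.
apply/subspP; split=> [p _ /=|a [x x'] [y y'] /= Tx Ty [u u'] Tu /=].
  by rewrite !hdot0r.
by rewrite !hdotDr !hdotZr (Tx _ Tu) (Ty _ Tu).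
Qed.

Lemma nclosed_hdot (x y u u' : V) :
  (forall e : R, 0 < e -> exists w w',
    [/\ hdot u' w = hdot u w', rn (w - x) < e & rn (w' - y) < e]) ->
  hdot u' x = hdot u y.
Proof.
move=> H; apply/eqP; rewrite -subr_eq0; apply/eqP; apply: rn_eq0.
apply/eqP; rewrite eq_le rn_ge0 andbT.
apply/ler_addgt0Pr => e e0; rewrite add0r.
pose k := rn u + rn u' + 1.
have k0 : 0 < k by rewrite ltr_wpDl// addr_ge0// rn_ge0.
have [|w [w' [h h1 h2]]] := H (e / k); first by rewrite divr_gt0.
have -> : hdot u' x - hdot u y = hdot u (w' - y) - hdot u' (w - x).
  by rewrite !hdotBr h; ring.
rewrite (le_trans (rnD _ _))// rnN.
have b1 := cauchy_schwarz u (w' - y); have b2 := cauchy_schwarz u' (w - x).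
have c1 := ler_wpM2l (rn_ge0 u) (ltW h2).
have c2 := ler_wpM2l (rn_ge0 u') (ltW h1).
have ek : (rn u + rn u' + 1) * (e / k) = e by rewrite mulrC divfK// gt_eqF.
have ek0 : 0 < e / k by rewrite divr_gt0.
move: ek; rewrite !mulrDl mul1r; lra.
Qed.

Lemma adjoint_nclosed T : nclosed (@rn2 R V) (adjoint T).
Proof.
move=> [x y] H [u u'] Tu /=; apply: nclosed_hdot => e /H[[w w'] Tw /=].
rewrite /rn2 /= => h; exists w, w'.
have a1 := rn_ge0 (w - x); have a2 := rn_ge0 (w' - y).
by split; [exact: (Tw _ Tu)|apply: le_lt_trans h; rewrite lerDl|
  apply: le_lt_trans h; rewrite lerDr].
Qed.

Lemma symmetric_real T u u' : symmetric_rel T -> T (u, u') -> ip (hdot u' u) = 0.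
Proof.
move=> sT Tu; have /= := sT _ Tu _ Tu; rewrite (hdotC u u') => h.
by have := congr1 (@complex.Im R) h; rewrite ip_conj => e; lra.
Qed.

(** By symmetry [(l *: u + v, u)] is real, so [Im (v, u)] cancels [Im l |u|^2]. This is the sign
    property of resolvents on which the later estimates rest. *)
Lemma symmetric_im T (l : R[i]) u v : symmetric_rel T -> T (u, l *: u + v) ->
  ip (hdot u v) = ip l * rn u ^+ 2.
Proof.
move=> sT Tu; have := symmetric_real sT Tu.
rewrite hdotDl hdotZl hdotxx ipD ipM /= (hdotC v) ip_conj; lra.
Qed.

Lemma symmetric_bound T (l : R[i]) u v : symmetric_rel T -> T (u, l *: u + v) ->
  `|ip l| * rn u <= rn v.
Proof.
move=> sT Tu; have [->|u0] := eqVneq u 0; first by rewrite rn0 mulr0 rn_ge0.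
have := symmetric_im sT Tu; move/(congr1 Num.norm).
rewrite normrM [`|_ ^+ 2|]ger0_norm ?sqr_ge0// => h.
rewrite -(ler_pM2r (rn_gt0 u0)) -mulrA -expr2 -h mulrC.
exact: le_trans (rn_ge_ip _) (cauchy_schwarz _ _).
Qed.

Definition ran_shift T (l : R[i]) : set V := [set v | exists u, T (u, l *: u + v)].

Lemma ran_shiftE T l : rel_ran (rel_shift T l) = ran_shift T l.
Proof.
apply/seteqP; split=> [_ [_ [[u u'] Tu <-] <-]/=|v [u Tu]].
  by exists u; rewrite addrC subrK.
exists (u, v) => //; exists (u, l *: u + v) => //=.
by congr pair; rewrite addrAC subrr add0r.
Qed.

Lemma ker_shiftE T l : rel_ker (rel_shift T l) = [set u | T (u, l *: u)].
Proof.
apply/seteqP; split=> [u [[x x'] Tx [<- /eqP]]|u Tu].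
  by rewrite /= subr_eq0 => /eqP <-.
by exists (u, l *: u) => //=; rewrite subrr.
Qed.

Lemma ran_shift_subspace T l : linear_subspace T -> linear_subspace (ran_shift T l).
Proof.
move=> sT; apply/subspP; split=> [|a x y [u Tu] [v Tv]].
  by exists 0; rewrite scaler0 addr0; exact: (subsp0 sT).
exists (a *: u + v).
have := subspZD sT a Tu Tv; congr T; congr pair => /=.
by rewrite !scalerDr !scalerA (mulrC a) addrACA.
Qed.

(** For non-real [l], [symmetric_bound] makes the preimages of a Cauchy family Cauchy, and
    closedness of [T] gives a preimage of the limit. *)
Lemma ran_shift_closed T (l : R[i]) : linear_subspace T -> symmetric_rel T ->
  nclosed (@rn2 R V) T -> ip l != 0 -> closed (ran_shift T l).
Proof.
move=> sT symT cT l0; apply/closedrnP => v H.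
have l1 : 0 < `|ip l| by rewrite normr_gt0.
have ex s : exists u w, 0 < s -> T (u, l *: u + w) /\ rn (w - v) < s.
  have [/H[w [u Tu] wv]|s0] := ltP 0 s; first by exists u, w.
  by exists 0, 0.
pose u s := sval (cid (ex s)).
pose w s := sval (cid (svalP (cid (ex s)))).
have P s : 0 < s -> T (u s, l *: u s + w s) /\ rn (w s - v) < s.
  exact: (svalP (cid (svalP (cid (ex s))))).
have [|x ux] := @cauchy0P _ V u.
  move=> e e0; exists (e * `|ip l| / 2); first by rewrite divr_gt0 ?mulr_gt0.
  move=> s t s0 sd t0 td; have [Ts ws] := P s s0; have [Tt wt] := P t t0.
  have : T (u s - u t, l *: (u s - u t) + (w s - w t)).
    have := subspB sT Ts Tt; congr T; congr pair => /=.
    by rewrite scalerBr opprD addrACA.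
  move=> /(symmetric_bound symT); rewrite -(ltr_pM2l l1) => /le_lt_trans; apply.
  rewrite (le_lt_trans (rn_triangle v _ _))// (rnB v).
  rewrite mulrC; lra.
exists x; apply: cT => e e0.
pose k := 2 + rn l.
have k0 : 0 < k by rewrite ltr_wpDr// rn_ge0.
have [|d d0 D] := ux (e / (2 * k)); first by rewrite divr_gt0// mulr_gt0.
pose s := Num.min (d / 2) (e / 4).
have s0 : 0 < s by rewrite lt_min !divr_gt0.
have sd : s < d.
  have : s <= d / 2 by rewrite ge_min lexx.
  lra.
have se : s <= e / 4 by rewrite ge_min lexx orbT.
have [Ts ws] := P s s0; have us := D s s0 sd.
exists (u s, l *: u s + w s) => //; rewrite /rn2 /=.
have -> : l *: u s + w s - (l *: x + v) = l *: (u s - x) + (w s - v).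
  by rewrite scalerBr opprD addrACA.
have b := rnD (l *: (u s - x)) (w s - v); rewrite rnZ in b.
have : rn (u s - x) * (2 * k) < e by rewrite -ltr_pdivlMr// mulr_gt0.
rewrite /k; have r0 := rn_ge0 (u s - x); lra.
Qed.

End Relations.

(** Self-adjointness inside a closed subspace [W] which is a mere set, not a Hilbert space of its
    own: symmetry together with surjectivity of [T - l] onto [W] at all non-real [l]. Maximality is
    recovered in [sa_adjoint]. *)
Record sarel (R : realType) (V : hilbertType R) (W : set V) (T : set (V * V)) : Prop := Sarel {
  sa_dom : linear_subspace W;
  sa_closed : closed W;
  sa_lin : linear_subspace T;
  sa_sub : forall u u', T (u, u') -> W u /\ W u';
  sa_sym : symmetric_rel T;
  sa_ran : forall l : R[i], ip l != 0 -> W `<=` ran_shift T l }.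

Section SelfAdjoint.
Context (R : realType) (V : hilbertType R).

(** The range of [T - l] is closed, and a vector orthogonal to it is an eigenvector of [T] at the
    conjugate of [l], hence zero. *)
Lemma selfadjoint_sarel (T : set (V * V)) : selfadjoint_rel T -> sarel setT T.
Proof.
move=> saT.
have sT : linear_subspace T by rewrite saT; exact: adjoint_subspace.
have cT : nclosed (@rn2 R V) T by rewrite saT; exact: adjoint_nclosed.
have symT : symmetric_rel T by rewrite /symmetric_rel -saT.
split => //.
- by apply/subspP.
move=> l l0; have cR := ran_shift_closed sT symT cT l0.
have sR : linear_subspace (ran_shift T l) by exact: ran_shift_subspace.
rewrite -(orthorth sR cR) => x _ y oy.
suff -> : y = 0 by rewrite hdot0r.
have Ty : T (y, l^* *: y).
  rewrite saT => -[u u'] Tu /=.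
  have := orth_sym oy (W := ran_shift T l) (y := u' - l *: u).
  rewrite hdotBl hdotZl hdotZr conjCK => h; apply/eqP; rewrite -subr_eq0; apply/eqP/h.
  by exists u; rewrite addrC subrK.
have := @symmetric_bound _ _ T l^* y 0 symT; rewrite addr0 => /(_ Ty).
rewrite rn0 ip_conj normrN pmulr_rle0 ?normr_gt0// => y0.
by apply: rn_eq0; apply/eqP; rewrite eq_le y0 rn_ge0.
Qed.

Context (W : set V) (T : set (V * V)) (sa : sarel W T).

(* Also used at real [l]: there the value is meaningless (possibly the default 0)
   unless [T - l] is injective and [v] belongs to its range. *)
Definition res (l : R[i]) (v : V) : V := xget 0 [set u | T (u, l *: u + v)].

Lemma resP l v : ip l != 0 -> W v -> T (res l v, l *: res l v + v).
Proof.
move=> l0 Wv; rewrite /res; case: xgetP => [u -> //|].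
by have [u Tu] := sa_ran sa l0 Wv => /(_ u).
Qed.

Lemma sa_uniq l v x y : ip l != 0 -> T (x, l *: x + v) -> T (y, l *: y + v) -> x = y.
Proof.
move=> l0 Tx Ty.
have : T (x - y, l *: (x - y) + 0).
  have := subspB (sa_lin sa) Tx Ty; congr T; congr pair => /=.
  by rewrite scalerBr opprD addrACA subrr.
move/(symmetric_bound (sa_sym sa)); rewrite rn0 pmulr_rle0 ?normr_gt0// => h.
apply/eqP; rewrite -subr_eq0; apply/eqP; apply: rn_eq0.
by apply/eqP; rewrite eq_le h rn_ge0.
Qed.

Lemma res_uniq l v u : ip l != 0 -> T (u, l *: u + v) -> res l v = u.
Proof.
move=> l0 Tu; rewrite /res; case: xgetP => [u' -> Tu'|/(_ u)//].
exact: sa_uniq l0 Tu' Tu.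
Qed.

Lemma res_in l v : ip l != 0 -> W v -> W (res l v).
Proof. by move=> l0 Wv; have [] := sa_sub sa (resP l0 Wv). Qed.

Lemma res_lin l a v w : ip l != 0 -> W v -> W w ->
  res l (a *: v + w) = a *: res l v + res l w.
Proof.
move=> l0 Wv Ww; apply: res_uniq => //.
have := subspZD (sa_lin sa) a (resP l0 Wv) (resP l0 Ww); congr T; congr pair => /=.
by rewrite !scalerDr !scalerA (mulrC a) addrACA.
Qed.

Lemma resZ l a v : ip l != 0 -> W v -> res l (a *: v) = a *: res l v.
Proof.
move=> l0 Wv; apply: res_uniq => //.
have := subspZ (sa_lin sa) a (resP l0 Wv); congr T; congr pair => /=.
by rewrite !scalerDr !scalerA (mulrC a).
Qed.

Lemma resD l v w : ip l != 0 -> W v -> W w -> res l (v + w) = res l v + res l w.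
Proof. by move=> *; rewrite -[v in LHS]scale1r res_lin// scale1r. Qed.

Lemma resB l v w : ip l != 0 -> W v -> W w -> res l (v - w) = res l v - res l w.
Proof.
move=> l0 Wv Ww; rewrite resD//; last by exact: subspN (sa_dom sa) _ Ww.
by rewrite -scaleN1r resZ// scaleN1r.
Qed.

Lemma res_bound l v : ip l != 0 -> W v -> `|ip l| * rn (res l v) <= rn v.
Proof. by move=> l0 Wv; exact: (symmetric_bound (sa_sym sa) (resP l0 Wv)). Qed.

Lemma res_im l v : ip l != 0 -> W v ->
  ip (hdot (res l v) v) = ip l * rn (res l v) ^+ 2.
Proof. by move=> l0 Wv; exact: (symmetric_im (sa_sym sa) (resP l0 Wv)). Qed.

(** Resolvent identity in which [t] may be real, the resolvent at [t] being replaced by a given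
    solution [u]. For real [t] it controls [res l] on the range of [T - t] as [l] approaches [t]. *)
Lemma res_shift l t u v : ip l != 0 -> W u -> T (u, t *: u + v) ->
  res l v = u + (l - t) *: res l u.
Proof.
move=> l0 Wu Tu; apply: res_uniq => //.
have := subspZD (sa_lin sa) (l - t) (resP l0 Wu) Tu; congr T; congr pair => /=.
  by rewrite addrC.
rewrite !scalerDr !scalerA (mulrC l) addrA; congr (_ + v).
by rewrite -addrA -scalerDl subrK addrC.
Qed.

Lemma res_id l m v : ip l != 0 -> ip m != 0 -> W v ->
  res l v = res m v + (l - m) *: res l (res m v).
Proof. by move=> l0 m0 Wv; apply: res_shift => //; [exact: res_in|exact: resP]. Qed.

Lemma res_adj l v w : ip l != 0 -> W v -> W w ->
  hdot (res l v) w = hdot v (res l^* w).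
Proof.
move=> l0 Wv Ww; have l0' : ip l^* != 0 by rewrite ip_conj oppr_eq0.
have /= := sa_sym sa (resP l0' Ww) (resP l0 Wv).
rewrite hdotDl hdotDr hdotZl hdotZr conjCK => h; symmetry.
exact: (addrI _ h).
Qed.

Lemma res_comm l m v : ip l != 0 -> ip m != 0 -> W v ->
  res l (res m v) = res m (res l v).
Proof.
move=> l0 m0 Wv; have [->//|lm] := eqVneq l m.
have h1 := res_id l0 m0 Wv; have h2 := res_id m0 l0 Wv.
have : (l - m) *: res l (res m v) = (l - m) *: res m (res l v).
  have -> : (l - m) *: res l (res m v) = res l v - res m v.
    by rewrite h1 addrAC subrr add0r.
  rewrite -[l - m]opprB scaleNr; apply/eqP; rewrite -addr_eq0; apply/eqP.
  by rewrite {1}h2 opprD addrA subrr add0r addNr.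
by apply: scalerI; rewrite subr_eq0.
Qed.

(** Compare [k] with [u = (T - 'i)^-1 (k' - 'i k)]: the difference is [(T + 'i) w] for some [w], and
    testing with [w] shows that it is orthogonal to itself. *)
Lemma sa_adjoint k k' : W k -> W k' ->
  (forall u u', T (u, u') -> hdot u' k = hdot u k') -> T (k, k').
Proof.
move=> Wk Wk' H.
have i0 : ip ('i : R[i]) != 0 by rewrite ip_i oner_eq0.
have j0 : ip (- 'i : R[i]) != 0 by rewrite ipN ip_i oppr_eq0 oner_eq0.
have sW := sa_dom sa.
have Wg : W (k' - 'i *: k) by apply: subspB => //; exact: subspZ.
set g := k' - 'i *: k in Wg.
have Tu := resP i0 Wg; set u := res 'i g in Tu.
have Wu : W u by exact: res_in.
suff E : k - u = 0.
  move/eqP: E; rewrite subr_eq0 => /eqP E.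
  by rewrite -{1}E /g -E addrC subrK in Tu.
apply: hdotxx_eq0.
have Wd : W (k - u) by apply: subspB.
have [w Tw] := sa_ran sa j0 Wd.
have h1 := H _ _ Tw.
have /= h2 := sa_sym sa Tu Tw; rewrite -/u in h2.
have : hdot (- 'i *: w + (k - u)) (k - u) = hdot w ('i *: (k - u)).
  rewrite hdotBr h1 h2 -hdotBr /g; congr (hdot w _).
  by rewrite scalerBr opprD opprB; rewrite addrA addrAC addrA [_ - k']addrC addrA addNr add0r addrC.
rewrite (hdotDl (- 'i *: w)) hdotZl hdotZr conjCi => h.
exact: (addrI _ (etrans h (esym (addr0 _)))).
Qed.

Lemma sa_nclosed : nclosed (@rn2 R V) T.
Proof.
move=> [x y] H.
have H' : forall e : R, 0 < e -> exists w w', [/\ T (w, w'), rn (w - x) < e & rn (w' - y) < e].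
  move=> e /H[[w w'] Tw]; rewrite /rn2/= => h; exists w, w'.
  have a1 := rn_ge0 (w - x); have a2 := rn_ge0 (w' - y).
  by split => //; apply: le_lt_trans h; rewrite ?lerDl ?lerDr.
have cW := (closedrnP W).1 (sa_closed sa).
apply: sa_adjoint.
- by apply: cW => e /H'[w [w' [/(sa_sub sa)[Ww _] h _]]]; exists w.
- by apply: cW => e /H'[w [w' [/(sa_sub sa)[_ Ww] _ h]]]; exists w'.
move=> u u' Tu; apply: nclosed_hdot => e /H'[w [w' [Tw h h']]].
by exists w, w'; split => //; exact: (sa_sym sa Tw Tu).
Qed.

End SelfAdjoint.

(** * The maximum principle *)

Section MaximumPrinciple.
Context (R : realType).
Implicit Types (f : R[i] -> R[i]) (z w : R[i]).

(** A second-order expansion with cubic remainder takes the place of holomorphy. It is easy to check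
    for resolvents and is all that the four-point argument for the maximum principle uses. *)
Definition jet2 f z := exists f1 f2 : R[i], exists M d : R, 0 < d /\
  forall w, rn w < d -> rn (f (z + w) - f z - f1 * w - f2 * w ^+ 2) <= M * rn w ^+ 3.

Lemma jet2D f g z : jet2 f z -> jet2 g z -> jet2 (fun z => f z + g z) z.
Proof.
move=> [f1 [f2 [M [d [d0 H]]]]] [g1 [g2 [M' [d' [d'0 H']]]]].
exists (f1 + g1), (f2 + g2), (M + M'), (Num.min d d'); split.
  by rewrite lt_min d0.
move=> w; rewrite lt_min => /andP[/H h /H' h'].
have := le_trans (rnD _ _) (lerD h h'); rewrite -mulrDl.
by congr (rn _ <= _); ring.
Qed.

Lemma jet2Z f (a : R[i]) z : jet2 f z -> jet2 (fun z => a * f z) z.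
Proof.
move=> [f1 [f2 [M [d [d0 H]]]]]; exists (a * f1), (a * f2), (rn a * M), d.
split=> // w /H h; rewrite -mulrA.
have := ler_wpM2l (rn_ge0 a) h; rewrite -rnM.
by congr (rn _ <= _); ring.
Qed.

Lemma jet2_inv (a z : R[i]) : a != z -> jet2 (fun z => (a - z)^-1) z.
Proof.
move=> az; have c0 : a - z != 0 by rewrite subr_eq0.
have r0 := rn_gt0 c0; set r := rn _ in r0.
(* The remainder is exactly [w^3 (a - z)^-3 (a - z - w)^-1], and for [|w| < r / 2] its last factor
   is at most [2 / r]. *)
exists ((a - z) ^- 2), ((a - z) ^- 3), (2 * (r^-1) ^+ 4), (r / 2).
split; first by rewrite divr_gt0.
move=> w wr.
have hr : r / 2 <= rn (a - (z + w)).
  have := rn_le_sub (a - z) w; rewrite -/r opprD addrA; lra.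
have c1 : a - (z + w) != 0.
  by apply: contraTneq hr => ->; rewrite rn0 -ltNge divr_gt0.
have -> : (a - (z + w))^-1 - (a - z)^-1 - (a - z) ^- 2 * w - (a - z) ^- 3 * w ^+ 2
    = w ^+ 3 * (a - z) ^- 3 * (a - (z + w))^-1.
  by field; rewrite c0 c1.
rewrite !rnM !rnV !rnX -/r -mulrA mulrC ler_wpM2r ?mulr_ge0 ?rn_ge0//.
rewrite [leLHS]mulrC.
have -> : 2 * r^-1 ^+ 4 = (r / 2)^-1 * (r ^+ 3)^-1.
  by field; rewrite gt_eqF.
have q0 : 0 <= r ^- 3 by rewrite invr_ge0 exprn_ge0// ltW.
by rewrite ler_wpM2r// lef_pV2 ?posrE ?divr_gt0 ?rn_gt0.
Qed.

Lemma jet2_continuous f z : jet2 f z -> forall e : R, 0 < e ->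
  exists2 d : R, 0 < d & forall w, rn w < d -> rn (f (z + w) - f z) < e.
Proof.
move=> [f1 [f2 [M [d [d0 H]]]]] e e0.
pose k := rn f1 + rn f2 + `|M| + 1.
have k0 : 0 < k by rewrite ltr_wpDl// !addr_ge0// rn_ge0.
exists (Num.min d (Num.min 1 (e / k))).
  by rewrite !lt_min d0 ltr01 divr_gt0.
move=> w; rewrite !lt_min => /and3P[wd w1 we].
have := H w wd; set u := (X in rn X <= _) => h.
have -> : f (z + w) - f z = u + (f1 * w + f2 * w ^+ 2) by rewrite /u; ring.
have w0 := rn_ge0 w.
have w2 : rn w ^+ 2 <= rn w by rewrite expr2 -[leRHS]mulr1 ler_wpM2l// ltW.
have w3 : rn w ^+ 3 <= rn w.
  by rewrite exprS -[leRHS]mulr1 ler_wpM2l// (le_trans w2)// ltW.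
have h1 := rnD u (f1 * w + f2 * w ^+ 2).
have h2 := rnD (f1 * w) (f2 * w ^+ 2).
rewrite !rnM -expr2 in h2.
have h3 : rn f2 * rn w ^+ 2 <= rn f2 * rn w by rewrite ler_wpM2l// rn_ge0.
have h4 : M * rn w ^+ 3 <= `|M| * rn w.
  by rewrite (le_trans (ler_wpM2r _ (ler_norm M)))// ?exprn_ge0// ler_wpM2l.
have h5 : rn w * k < e by rewrite -ltr_pdivlMr.
rewrite /k in h5.
lra.
Qed.

Definition rect (a b c d : R) : set R[i] :=
  [set z | (a <= rp z <= b) && (c <= ip z <= d)].

Lemma complex_near (p : R * R) (d : R) : 0 < d ->
  \forall q \near p, rn (Complex q.1 q.2 - Complex p.1 p.2) < d.
Proof.
move=> d0.
have : nbhs p [set q | `|p.1 - q.1| < d / 2 /\ `|p.2 - q.2| < d / 2].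
  exists ([set x | `|p.1 - x| < d / 2], [set x | `|p.2 - x| < d / 2]) => /=.
    by split; apply: nbhsx_ballx; rewrite divr_gt0.
  by case=> [x y].
apply: filterS => -[x y] /= [h1 h2]; case: p h1 h2 => s t /= h1 h2.
have -> : Complex x y - Complex s t = (x - s)%:C%C + 'i * (y - t)%:C%C.
  by rewrite -complexiE; apply: complex_eq; rewrite ?(rpD, ipD, rpM, ipM)/=; ring.
apply: le_lt_trans (rnD _ _) _; rewrite rnM rn_i mul1r !rn_real.
rewrite distrC (distrC y); lra.
Qed.

Lemma rect_max (g : R[i] -> R) a b c d z0 : rect a b c d z0 ->
  (forall z, rect a b c d z -> forall e : R, 0 < e -> exists2 r : R, 0 < r &
     forall w, rn w < r -> `|g (z + w) - g z| < e) ->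
  exists2 z, rect a b c d z & forall w, rect a b c d w -> g w <= g z.
Proof.
move=> z0K gC.
pose K : set (R * R) := `[a, b]%classic `*` `[c, d]%classic.
pose G (p : R * R) := g (Complex p.1 p.2).
have KE x y : K (x, y) <-> rect a b c d (Complex x y).
  rewrite /K /rect /= !in_itv /=; split; first by move=> [-> ->].
  by move=> /andP[].
have K0 : K !=set0 by exists (rp z0, ip z0); apply/KE; case: z0 z0K.
have cK : compact K by apply: compact_setX; exact: segment_compact.
have cG : {within K, continuous G}.
  apply: continuous_in_subspaceT => -[x y]; rewrite inE => /KE /gC H.
  apply/cvgrPdist_lt => e /H[r r0 {}H].
  have := complex_near (x, y) r0; apply: filterS => q qr.
  rewrite distrC /G /=.
  have -> : Complex q.1 q.2 = Complex x y + (Complex q.1 q.2 - Complex x y).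
    by rewrite addrC subrK.
  exact: H.
have [[x y] cK' H] := compact_EVT_max K0 cK cG.
rewrite inE in cK'; exists (Complex x y); first exact/KE.
move=> [s t] st; apply: (H (s, t)); rewrite inE; exact/KE.
Qed.

(* At an interior maximum [z] of [Im f + rho |. - z0|^2], the values at the four
   points [z + 'i^k * delta] sum to at least [4 * rho * delta^2 - O(delta^3)] more
   than four times the value at [z], as the jet terms cancel in the sum. *)
Theorem maximum_principle f (a b c d m : R) :
  (forall z, rect a b c d z -> jet2 f z) ->
  (forall z, rect a b c d z ->
     [\/ rp z = a, rp z = b, ip z = c | ip z = d] -> ip (f z) <= m) ->
  forall z, rect a b c d z -> ip (f z) <= m.
Proof.
move=> jf bd z0 z0K; rewrite leNgt; apply/negP => gap.
pose D := (b - a) ^+ 2 + (d - c) ^+ 2 + 1.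
have D0 : 0 < D by rewrite ltr_wpDl// addr_ge0// sqr_ge0.
have DK z : rect a b c d z -> rn (z - z0) ^+ 2 < D.
  move: z0K; rewrite /rect /= => /andP[/andP[h1 h2] /andP[h3 h4]].
  move=> /andP[/andP[h5 h6] /andP[h7 h8]].
  rewrite rnC_sqr rpD ipD rpN ipN /D.
  have e1 : (rp z - rp z0) ^+ 2 <= (b - a) ^+ 2.
    by rewrite -real_normK ?num_real// ler_pXn2r ?nnegrE// ?ler_norml; lra.
  have e2 : (ip z - ip z0) ^+ 2 <= (d - c) ^+ 2.
    by rewrite -real_normK ?num_real// ler_pXn2r ?nnegrE// ?ler_norml; lra.
  lra.
(* [rho * D] is the supposed excess over [m] at [z0]. On the boundary the added term is below
   [rho * D], so the perturbed function stays below its value at [z0] and its maximum is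
   interior. *)
pose rho := (ip (f z0) - m) / D.
have rho0 : 0 < rho by rewrite divr_gt0// subr_gt0.
pose g z := ip (f z) + rho * rn (z - z0) ^+ 2.
have gC z : rect a b c d z -> forall e : R, 0 < e -> exists2 r : R, 0 < r &
     forall w, rn w < r -> `|g (z + w) - g z| < e.
  move=> /jf jz e e0.
  have [|d1 d10 H] := jet2_continuous jz (e := e / 2); first by rewrite divr_gt0.
  pose q := rho * (2 * rn (z - z0) + 1) + 1.
  have q0 : 0 < q by rewrite ltr_wpDl// mulr_ge0 ?ltW// ltr_wpDl// mulr_ge0// rn_ge0.
  exists (Num.min d1 (Num.min 1 (e / 2 / q))).
    by rewrite !lt_min d10 ltr01 !divr_gt0.
  move=> w; rewrite !lt_min => /and3P[/H wd w1 we].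
  rewrite /g.
  have h1 : `|ip (f (z + w)) - ip (f z)| < e / 2.
    by apply: le_lt_trans wd; rewrite -ipN -ipD rn_ge_ip.
  have h2 : rn w * q < e / 2 by rewrite -ltr_pdivlMr.
  have w0 := rn_ge0 w.
  have h3 := rnD (z - z0) w.
  have h4 : rn (z - z0) - rn w <= rn (z + w - z0).
    have := rn_le_sub (z - z0) (- w); by rewrite rnN opprK addrAC.
  rewrite addrAC in h3.
  set s := rn (z - z0) in h3 h4 q q0 we h2 *; set t := rn (z + w - z0) in h3 h4 *.
  have s0 : 0 <= s := rn_ge0 _. have t0 : 0 <= t := rn_ge0 _.
  have h5 : `|t ^+ 2 - s ^+ 2| <= rn w * (2 * s + 1).
    rewrite subr_sqr normrM; apply: ler_pM; rewrite ?normr_ge0//.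
      by rewrite ler_norml; lra.
    by rewrite ger0_norm; lra.
  have h6 : rho * `|t ^+ 2 - s ^+ 2| <= rho * (rn w * (2 * s + 1)).
    by rewrite ler_pM2l.
  have -> : ip (f (z + w)) + rho * t ^+ 2 - (ip (f z) + rho * s ^+ 2) =
    (ip (f (z + w)) - ip (f z)) + rho * (t ^+ 2 - s ^+ 2) by ring.
  apply: le_lt_trans (ler_normD _ _) _.
  rewrite normrM (gtr0_norm rho0); rewrite /q in h2; lra.
have [z zK zmax] := rect_max z0K gC.
have gz : m + rho * D <= g z.
  apply: (le_trans _ (zmax _ z0K)); rewrite /g subrr rn0 expr0n /= mulr0 addr0.
  by rewrite /rho divfK ?gt_eqF// addrC subrK.
have int : ~ [\/ rp z = a, rp z = b, ip z = c | ip z = d].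
  move=> /(bd z zK) h; have : rho * rn (z - z0) ^+ 2 < rho * D by rewrite ltr_pM2l// DK.
  move: gz; rewrite /g; lra.
have [/andP[h1 h2] /andP[h3 h4]] := andP zK.
have {}h1 : a < rp z by rewrite lt_neqAle h1 andbT; apply: contra_notN int => /eqP ->; constructor 1.
have {}h2 : rp z < b by rewrite lt_neqAle h2 andbT; apply: contra_notN int => /eqP ->; constructor 2.
have {}h3 : c < ip z by rewrite lt_neqAle h3 andbT; apply: contra_notN int => /eqP ->; constructor 3.
have {}h4 : ip z < d by rewrite lt_neqAle h4 andbT; apply: contra_notN int => /eqP ->; constructor 4.
have [f1 [f2 [M [r [r0 H]]]]] := jf z zK.
(* For [t <= k] each of the four remainders is at most [rho / 2 * t^2]; together they cannot offset
   the gain [4 * rho * t^2]. *)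
pose k := rho / (2 * (`|M| + 1)).
have M1 : 0 < `|M| + 1 by rewrite ltr_wpDl.
have k0 : 0 < k by rewrite divr_gt0// mulr_gt0.
pose t := Num.min (r / 2) (Num.min k (Num.min (Num.min (rp z - a) (b - rp z))
  (Num.min (ip z - c) (d - ip z)))).
have t0 : 0 < t by rewrite !lt_min divr_gt0 ?k0 ?subr_gt0 ?h1 ?h2 ?h3 ?h4.
have : t <= t by []; rewrite {2}/t !le_min => /and3P[tr tk /andP[/andP[t1 t2] /andP[t3 t4]]].
have tr' : t < r by lra.
pose T : R[i] := t%:C%C.
have rT : rn T = t by rewrite rn_real gtr0_norm.
have inK w : w = T \/ w = - T \/ w = 'i * T \/ w = - ('i * T) ->
    rect a b c d (z + w).
  by rewrite /rect /T /= rpD ipD => -[->|[->|[->|->]]];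
    rewrite ?(rpN, ipN, rpM, ipM, rp_i, ip_i) /= ?(mul0r, mulr0, mul1r, subr0, addr0, add0r, oppr0); lra.
have m1 := zmax _ (inK T (or_introl erefl)).
have m2 := zmax _ (inK (- T) (or_intror (or_introl erefl))).
have m3 := zmax _ (inK ('i * T) (or_intror (or_intror (or_introl erefl)))).
have m4 := zmax _ (inK (- ('i * T)) (or_intror (or_intror (or_intror erefl)))).
have rw w : rn w = t -> - (M * t ^+ 3) <= ip (f (z + w) - f z - f1 * w - f2 * w ^+ 2).
  move=> wt; have := H w; rewrite wt => /(_ tr') h.
  by have := le_trans (rn_ge_ip _) h; rewrite ler_norml => /andP[].
have r1 := rw T rT; have r2 := rw (- T); rewrite rnN in r2; have {}r2 := r2 rT.
have riT : rn ('i * T) = t by rewrite rnM rn_i mul1r.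
have r3 := rw ('i * T) riT; have r4 := rw (- ('i * T)); rewrite rnN in r4; have {}r4 := r4 riT.
have E : (f (z + T) - f z - f1 * T - f2 * T ^+ 2) + (f (z - T) - f z - f1 * (- T) - f2 * (- T) ^+ 2)
  + (f (z + 'i * T) - f z - f1 * ('i * T) - f2 * ('i * T) ^+ 2)
  + (f (z - 'i * T) - f z - f1 * (- ('i * T)) - f2 * (- ('i * T)) ^+ 2) =
  f (z + T) + f (z - T) + f (z + 'i * T) + f (z - 'i * T) - f z *+ 4.
  have i2 : ('i * T) ^+ 2 = - T ^+ 2 by rewrite exprMn sqrCi mulN1r.
  by rewrite !sqrrN i2; ring.
have {}E := congr1 (@complex.Im R) E.
rewrite !(ipD, ipN) in E.
have E2 : rn (z + T - z0) ^+ 2 + rn (z - T - z0) ^+ 2 + rn (z + 'i * T - z0) ^+ 2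
    + rn (z - 'i * T - z0) ^+ 2 = 4 * rn (z - z0) ^+ 2 + 4 * t ^+ 2.
  rewrite !rnC_sqr !(rpD, ipD, rpN, ipN, rpM, ipM, rp_i, ip_i) /=; ring.
have Mt : M * t ^+ 3 <= rho / 2 * t ^+ 2.
  have : t * (`|M| + 1) <= rho / 2.
    move: tk; rewrite /k invfM mulrA ler_pdivlMr//.
  have := ler_norm M => hM h.
  have -> : M * t ^+ 3 = (t * M) * t ^+ 2 by ring.
  rewrite ler_pM2r ?exprn_gt0//.
  by apply: (le_trans _ h); rewrite ler_pM2l//; lra.
have tt : 0 < rho * t ^+ 2 by rewrite mulr_gt0 ?exprn_gt0.
have E3 := congr1 (fun x => rho * x) E2.
rewrite /= !mulrDr in E3.
rewrite /g in m1 m2 m3 m4.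
move: r1 r2 r3 r4; rewrite !(ipD, ipN) => r1 r2 r3 r4.
lra.
Qed.

End MaximumPrinciple.

(** * Resolvents near a real interval on which a vector is spectrally absent *)

Section Gap.
Context (R : realType) (V : hilbertType R) (W : set V) (T : set (V * V)).
Hypothesis sa : sarel W T.
Local Notation res := (res T).

Lemma res_jet2 y z : W y -> ip z != 0 -> jet2 (fun z => hdot (res z y) y) z.
Proof.
move=> Wy z0; pose r := res z.
have Wr v : W v -> W (r v) by move=> Wv; exact: (res_in sa).
have z1 : 0 < `|ip z| by rewrite normr_gt0.
exists (hdot (r (r y)) y), (hdot (r (r (r y))) y),
  (2 / `|ip z| * (rn (r (r (r y))) * rn y)), (`|ip z| / 2); split.
  by rewrite divr_gt0.
move=> w wz.
have hz : `|ip z| / 2 <= `|ip (z + w)|.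
  have := rn_ge_ip w; have := lerB_normD (ip z) (ip w); rewrite ipD; lra.
have zw0 : ip (z + w) != 0 by rewrite -normr_gt0; apply: lt_le_trans hz; rewrite divr_gt0.
have step v : W v -> res (z + w) v = r v + w *: res (z + w) (r v).
  by move=> Wv; rewrite {1}(res_id sa zw0 z0 Wv) addrAC subrr add0r.
have -> : hdot (res (z + w) y) y - hdot (res z y) y - hdot (r (r y)) y * w -
    hdot (r (r (r y))) y * w ^+ 2 = w ^+ 3 * hdot (res (z + w) (r (r (r y)))) y.
  rewrite (step y)// (step (r y)); last exact: Wr.
  rewrite (step (r (r y))); last exact: Wr (Wr _ Wy).
  rewrite !(hdotDl, hdotZl) -/r; ring.
rewrite rnM rnX mulrC ler_wpM2r ?exprn_ge0 ?rn_ge0//.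
apply: le_trans (cauchy_schwarz _ _) _; rewrite mulrA ler_wpM2r ?rn_ge0//.
have h := res_bound sa zw0 (Wr _ (Wr _ (Wr _ Wy))).
have -> : 2 / `|ip z| = (`|ip z| / 2)^-1 by rewrite invfM invrK mulrC.
rewrite ler_pdivlMl ?divr_gt0//; apply: (le_trans _ h).
by rewrite ler_wpM2r ?rn_ge0.
Qed.

(** By [res_im] the bounded quantity is [Im ((T - z)^-1 y, y)] at [z = s + 'i e]. In the language of
    the spectral theorem, its uniform decay says that the spectral measure of [y] has no mass on
    [[a, b]]. *)
Definition small_on (a b : R) (y : V) := forall k : R, 0 < k ->
  exists2 d : R, 0 < d & forall e s : R, 0 < e -> e < d -> a <= s <= b ->
    e * rn (res (Complex s e) y) ^+ 2 <= k.

Lemma ip_inv_real (a : R) (z : R[i]) : ip z != 0 ->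
  ip ((a%:C%C - z)^-1) = ip z / ((rp z - a) ^+ 2 + ip z ^+ 2).
Proof.
case: z => x y /= y0; rewrite sub0r mulNr opprK sqrrN.
by rewrite -(sqrrN (x - a)) opprB.
Qed.

(* Compare [Im (U(z) y, y)] with the positive harmonic function
   [|y|^2 (Im (a - z)^-1 + Im (b - z)^-1)], which dominates the a priori bound
   [|y|^2 / Im z] on the vertical sides and on the top of the rectangle. *)
Lemma gap_bound (a b : R) y z : W y -> small_on a b y ->
  a <= rp z <= b -> 0 < ip z <= b - a ->
  rn (res z y) ^+ 2 <= rn y ^+ 2 * (((rp z - a) ^+ 2 + ip z ^+ 2)^-1 +
    ((rp z - b) ^+ 2 + ip z ^+ 2)^-1).
Proof.
move=> Wy sy zab /andP[z0 zh].
set h := b - a in zh; have h0 : 0 < h by apply: lt_le_trans zh.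
rewrite -(ler_pM2l z0) mulrCA mulrDr.
set N := rn y ^+ 2; have N0 : 0 <= N := sqr_ge0 _.
apply/ler_addgt0Pr => k k0.
have [d d0 sd] := sy k k0.
(* Height of the bottom side: low enough for [small_on] to give the bound [k] there, and not above
   [z]. *)
pose e := Num.min (d / 2) (ip z).
have e0 : 0 < e by rewrite lt_min divr_gt0.
have ed : e < d by have : e <= d / 2 by [rewrite ge_min lexx]; lra.
have ez : e <= ip z by rewrite ge_min lexx orbT.
pose f (z : R[i]) := hdot (res z y) y + (- N)%:C%C * ((a%:C%C - z)^-1 + (b%:C%C - z)^-1).
have ipf x : 0 < ip x -> ip (f x) = ip x * rn (res x y) ^+ 2 -
    N * (ip x / ((rp x - a) ^+ 2 + ip x ^+ 2) + ip x / ((rp x - b) ^+ 2 + ip x ^+ 2)).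
  move=> x0; have x1 : ip x != 0 by rewrite gt_eqF.
  rewrite /f ipD (res_im sa)// ipM /= mul0r addr0 ipD !ip_inv_real//.
  by rewrite mulNr.
suff : ip (f z) <= k by rewrite ipf//; lra.
have apr x : 0 < ip x -> ip x * rn (res x y) ^+ 2 <= N / ip x.
  move=> x0; have x1 : ip x != 0 by rewrite gt_eqF.
  have := res_bound sa x1 Wy; rewrite gtr0_norm// => hx.
  rewrite ler_pdivlMr//.
  have -> : ip x * rn (res x y) ^+ 2 * ip x = (ip x * rn (res x y)) ^+ 2 by ring.
  rewrite ler_pXn2r ?nnegrE ?rn_ge0//.
  by rewrite mulr_ge0 ?rn_ge0 ?ltW.
apply: (@maximum_principle _ f a b e h) => [x|x|].
- move=> /andP[_ /andP[ex xh]].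
  have x0 : 0 < ip x by apply: lt_le_trans ex.
  have x1 : ip x != 0 by rewrite gt_eqF.
  have nr (c : R) : c%:C%C != x by apply: contraNneq x1 => <-.
  by apply: jet2D; [exact: res_jet2|apply: jet2Z; apply: jet2D; exact: jet2_inv].
- move=> /andP[/andP[ax xb] /andP[ex xh]] bdx.
  have x0 : 0 < ip x by apply: lt_le_trans ex.
  have x1 : ip x != 0 by rewrite gt_eqF.
  have pos c : 0 <= ip x / ((rp x - c) ^+ 2 + ip x ^+ 2).
    by apply: divr_ge0; [exact: ltW|rewrite addr_ge0 ?sqr_ge0].
  have side c : rp x = c -> ip x / ((rp x - c) ^+ 2 + ip x ^+ 2) = (ip x)^-1.
    by move=> ->; rewrite subrr expr0n add0r /= expr2 invfM mulrA divff// mul1r.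
  have apx := apr x x0.
  rewrite ipf//.
  have dom : (ip x)^-1 <= ip x / ((rp x - a) ^+ 2 + ip x ^+ 2) + ip x / ((rp x - b) ^+ 2 + ip x ^+ 2) ->
    ip x * rn (res x y) ^+ 2 -
     N * (ip x / ((rp x - a) ^+ 2 + ip x ^+ 2) + ip x / ((rp x - b) ^+ 2 + ip x ^+ 2)) <= k.
    move=> /(ler_wpM2l N0) hN; lra.
  case: bdx => E.
  + by apply: dom; rewrite (side _ E) lerDl.
  + by apply: dom; rewrite (side _ E) lerDr.
  + have := sd e (rp x) e0 ed; rewrite ax xb => /(_ isT).
    have -> : Complex (rp x) e = x by rewrite -E; case: (x).
    have := mulr_ge0 N0 (addr_ge0 (pos a) (pos b)); rewrite E; lra.
  apply: dom; rewrite E.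
  (* The top is as high as the interval is long, so that each of the two kernels is at least
     [1 / (2 h)] there and their sum reaches [1 / h]. *)
  have half c : `|rp x - c| <= h -> h^-1 / 2 <= h / ((rp x - c) ^+ 2 + h ^+ 2).
    move=> hc; have hc2 : (rp x - c) ^+ 2 <= h ^+ 2.
      rewrite -real_normK ?num_real// ler_pXn2r ?nnegrE//.
      exact: ltW.
    have q0 : 0 < (rp x - c) ^+ 2 + h ^+ 2 by rewrite ltr_wpDl ?sqr_ge0 ?exprn_gt0.
    have -> : h^-1 / 2 = h / (2 * h ^+ 2) by field; rewrite gt_eqF.
    have p0 : 0 < 2 * h ^+ 2 by rewrite mulr_gt0 ?exprn_gt0.
    rewrite ler_pM2l// lef_pV2 ?posrE//; lra.
  have := half a; have := half b; rewrite !ler_norml /h => hb ha.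
  have {}ha := ha ltac:(lra); have {}hb := hb ltac:(lra); lra.
by rewrite /rect /= zab ez zh.
Qed.

End Gap.

(** * Closed ranges and resolvent growth *)

Section Range.
Context (R : realType) (V : hilbertType R).

(** The constant [K], which may blow up near the real axis, serves only for the continuity of [F];
    the good constant [C] then passes from [D] to its closure. *)
Lemma bound_closure (V' : normedModType R[i]) (W D : set V) (F : V -> V') (K C : R) :
  (forall x y, W x -> W y -> W (x - y) /\ F (x - y) = F x - F y) ->
  D `<=` W -> 0 <= C ->
  (forall x, W x -> rn (F x) <= K * rn x) ->
  (forall x, D x -> rn (F x) <= C * rn x) ->
  forall x, W x -> (forall e : R, 0 < e -> exists2 y, D y & rn (y - x) < e) ->
  rn (F x) <= C * rn x.
Proof.
move=> FB DW C0 FK FC x Wx xD; apply/ler_addgt0Pr => e e0.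
pose k := `|K| + C + 1.
have k0 : 0 < k by rewrite ltr_wpDl// addr_ge0.
have [|y Dy yx] := xD (e / k); first by rewrite divr_gt0.
have [Wxy Fxy] := FB _ _ Wx (DW _ Dy).
have h1 := FK _ Wxy; have h2 := FC _ Dy.
have h3 : rn (F x) <= rn (F (x - y)) + rn (F y) by rewrite Fxy (le_trans _ (rnD _ _))// subrK.
have h4 : C * rn y <= C * (rn (x - y) + rn x).
  by rewrite ler_wpM2l// (rnB x) (le_trans _ (rnD _ _))// subrK.
have h5 : rn (x - y) * k < e by rewrite -ltr_pdivlMr// rnB.
have h6 : K * rn (x - y) <= `|K| * rn (x - y) by rewrite ler_wpM2r ?rn_ge0 ?ler_norm.
have := rn_ge0 (x - y); rewrite /k in h5; lra.
Qed.

Context (W : set V) (T : set (V * V)).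
Hypothesis sa : sarel W T.
Local Notation res := (res T).

Lemma sqr_le (u v : R) : (- v <= u <= v) \/ (v <= u <= - v) -> u ^+ 2 <= v ^+ 2.
Proof.
have -> : (u ^+ 2 <= v ^+ 2) = (0 <= (v - u) * (v + u)).
  by rewrite -subr_ge0 subr_sqr.
by case=> h; [apply: mulr_ge0|apply: mulr_le0]; lra.
Qed.

Lemma rn_ver (s e : R) : rn (Complex s e - s%:C%C) = `|e|.
Proof.
apply/eqP; rewrite -(@eqrXn2 _ 2)// ?rn_ge0// rnC_sqr !(rpD, ipD, rpN, ipN) /=.
by rewrite subrr expr0n add0r subr0 real_normK ?num_real.
Qed.

Lemma ran_shift_sub l : ran_shift T l `<=` W.
Proof.
move=> y [u /(sa_sub sa)[Wu Wy]]; have := subspB (sa_dom sa) Wy (subspZ (sa_dom sa) l Wu).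
by rewrite addrAC subrr add0r.
Qed.

Lemma res_ran l m y : ip l != 0 -> ran_shift T m y -> ran_shift T m (res l y).
Proof.
move=> l0 ry; have Wy := ran_shift_sub ry; case: ry => u Tu.
have Wu := (sa_sub sa Tu).1.
exists (res l u); have := resP sa l0 Wu; congr T; congr pair.
rewrite (res_shift sa l0 Wu Tu) addrCA addrC; congr (_ + _).
by rewrite -scalerDl addrC subrK.
Qed.

Lemma res_res_bound l m y : ip l != 0 -> ip m != 0 -> W y ->
  rn (res l (res m y)) <= (`|ip l| * `|ip m|)^-1 * rn y.
Proof.
move=> l0 m0 Wy; rewrite ler_pdivlMl ?mulr_gt0 ?normr_gt0//.
apply: (le_trans _ (res_bound sa m0 Wy)).
rewrite mulrAC mulrC ler_pM2l ?normr_gt0//.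
exact: (res_bound sa l0 (res_in sa m0 Wy)).
Qed.

(** By the resolvent identity, the values at two heights [e] and [e'] differ by ['i (e - e')] times
    a double resolvent of [y]. A bound on the latter makes the family Cauchy, and since [T] is
    closed the limit solves the equation at the real point [s]. *)
Lemma lim_solution (s B d : R) y : W y -> 0 < d ->
  (forall e e' : R, 0 < e -> e < d -> 0 < e' -> e' < d ->
    rn (res (Complex s e) (res (Complex s e') y)) <= B) ->
  exists2 w, T (w, s%:C%C *: w + y) &
   forall k : R, 0 < k -> exists2 d : R, 0 < d &
     forall e, 0 < e -> e < d -> rn (res (Complex s e) y - w) < k.
Proof.
move=> Wy d0 HB.
have B0 : 0 <= B.
  have d2 : d / 2 < d by lra.
  have d20 : 0 < d / 2 by lra.
  exact: le_trans (rn_ge0 _) (HB _ _ d20 d2 d20 d2).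
have n0 (e : R) : 0 < e -> ip (Complex s e) != 0 by move=> e0; rewrite gt_eqF.
have [|w Hw] := @cauchy0P _ V (fun e => res (Complex s e) y).
  move=> k k0; exists (Num.min d (k / (B + 1))).
    by rewrite lt_min d0 divr_gt0// ltr_wpDl.
  move=> e e'; rewrite !lt_min => e0 /andP[ed ek] e'0 /andP[e'd e'k].
  rewrite (res_id sa (n0 _ e0) (n0 _ e'0) Wy) addrAC subrr add0r rnZ.
  have -> : rn (Complex s e - Complex s e') = `|e - e'|.
    have -> : Complex s e - Complex s e' = Complex s (e - e') - s%:C%C.
      by apply: complex_eq; rewrite !(rpD, ipD, rpN, ipN) /=; ring.
    exact: rn_ver.
  have h := HB _ _ e0 ed e'0 e'd.
  have : `|e - e'| < k / (B + 1) by rewrite ltr_norml; lra.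
  rewrite ltr_pdivlMr ?ltr_wpDl// => h1.
  apply: le_lt_trans h1; rewrite ler_wpM2l//; lra.
exists w => //; apply: (sa_nclosed sa) => k k0.
pose q := `|s| + 2 + rn w.
have q0 : 0 < q by rewrite ltr_wpDr ?rn_ge0// ltr_wpDl.
have [|d1 d10 H1] := Hw (Num.min 1 (k / (2 * q))).
  by rewrite lt_min ltr01 divr_gt0// mulr_gt0.
pose e := Num.min (d1 / 2) (k / (4 * q)).
have e0 : 0 < e by rewrite lt_min !divr_gt0// mulr_gt0.
have e1 : e <= d1 / 2 by rewrite ge_min lexx.
have e2 : e <= k / (4 * q) by rewrite ge_min lexx orbT.
have ed1 : e < d1 by lra.
have := H1 e e0 ed1; rewrite lt_min => /andP[h1 h2].
exists (res (Complex s e) y, Complex s e *: res (Complex s e) y + y).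
  exact: (resP sa (n0 _ e0) Wy).
rewrite /rn2 /=; set x := res _ y in h1 h2 *.
have -> : Complex s e *: x + y - (s%:C%C *: w + y) =
   s%:C%C *: (x - w) + (Complex s e - s%:C%C) *: x.
  by rewrite opprD addrACA subrr addr0 scalerBr scalerBl [RHS]addrC addrA subrK.
have h3 := rnD (s%:C%C *: (x - w)) ((Complex s e - s%:C%C) *: x).
rewrite !rnZ rn_real rn_ver (gtr0_norm e0) in h3.
have h4 : rn x <= 1 + rn w.
  by have := rnD (x - w) w; rewrite subrK; lra.
have h5 : rn (x - w) * (2 * q) < k by rewrite -ltr_pdivlMr// mulr_gt0.
have h6 : e * (4 * q) <= k by rewrite -ler_pdivlMr// mulr_gt0.
have h7 : e * rn x <= e * (1 + rn w) by rewrite ler_pM2l.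
have := rn_ge0 (x - w); have := normr_ge0 s; have := rn_ge0 w => w0 s0 xw0.
have p1 := mulr_ge0 (ltW e0) s0; have p2 := mulr_ge0 xw0 w0.
rewrite /q in h5 h6; lra.
Qed.

(** The range is invariant under resolvents, so double resolvents are bounded by [C ^+ 2] on it. The
    bound extends to a limit [y] of the range, and [lim_solution] yields a preimage of [y]. *)
Lemma closed_range_of_bound (t C d : R) : 0 < d -> 0 <= C ->
  (forall y e, ran_shift T t%:C%C y -> 0 < e -> e < d ->
    rn (res (Complex t e) y) <= C * rn y) ->
  closed (ran_shift T t%:C%C).
Proof.
move=> d0 C0 HC; apply/closedrnP => y yc.
have cW := (closedrnP W).1 (sa_closed sa).
have Wy : W y by apply: cW => e /yc[w /ran_shift_sub Ww wy]; exists w.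
have n0 (e : R) : 0 < e -> ip (Complex t e) != 0 by move=> e0; rewrite gt_eqF.
have sW := sa_dom sa.
have [|w Tw _] := @lim_solution t (C ^+ 2 * rn y) d y Wy d0; last by exists w.
move=> e e' e0 ed e'0 e'd.
apply: (@bound_closure V W (ran_shift T t%:C%C) (fun y => res (Complex t e) (res (Complex t e') y))
   (`|e| * `|e'|)^-1 (C ^+ 2)) => //.
- move=> a b Wa Wb; split; first exact: subspB.
  rewrite (resB sa) ?n0// (resB sa) ?n0//; apply: (res_in sa); rewrite ?n0//.
- exact: ran_shift_sub.
- exact: sqr_ge0.
- by move=> a Wa; apply: res_res_bound; rewrite ?n0.
move=> a ra; rewrite expr2 -mulrA.
have h1 := HC _ _ (res_ran (n0 _ e'0) ra) e0 ed.
apply: (le_trans h1); rewrite ler_wpM2l//; exact: HC.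
Qed.

(* The a priori estimate on a punctured neighborhood of [t] makes [t] at worst a simple
   pole of the resolvent, which is then removed on the range of [T - t]. *)
Lemma range_bound_of_small (Y : set V) (t r : R) :
  0 < r -> Y `<=` W ->
  (forall w, W w -> forall e : R, 0 < e -> exists2 y, Y y & rn (y - w) < e) ->
  (forall y (d : R), Y y -> 0 < d -> d < r ->
    small_on T (t + d) (t + r) y /\ small_on T (t - r) (t - d) y) ->
  forall y e, ran_shift T t%:C%C y -> 0 < e -> e < r / 4 ->
    rn (res (Complex t e) y) <= 3 / r * rn y.
Proof.
move=> r0 YW Yd Ys.
have sW := sa_dom sa.
(* First stage. Off the vertical line above [t], the interval used runs from the midpoint of [t] and
   [rp z] to [t + r] or [t - r], where the vectors of [Y] are small. On the line itself the a priori
   bound suffices. *)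
have S1 y z : W y -> `|rp z - t| <= r / 2 -> 0 < ip z -> ip z < r / 4 ->
    rn (z - t%:C%C) * rn (res z y) <= 3 * rn y.
  move=> Wy zt z0 zr; have z1 : ip z != 0 by rewrite gt_eqF.
  have rz : rn (z - t%:C%C) ^+ 2 = (rp z - t) ^+ 2 + ip z ^+ 2.
    by rewrite rnC_sqr !(rpD, ipD, rpN, ipN) /= subr0.
  set q := rn (z - t%:C%C) in rz *.
  have q0 : 0 < q.
    rewrite rn_gt0// subr_eq0; apply: contraNneq z1 => ->; exact: eqxx.
  rewrite -ler_pdivlMl// mulrA.
  apply: (@bound_closure V W Y (res z) (ip z)^-1 (q^-1 * 3)) => //.
  - by move=> a b Wa Wb; split; [exact: subspB|exact: (resB sa)].
  - by rewrite mulr_ge0// invr_ge0 ltW.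
  - by move=> a Wa; rewrite ler_pdivlMl//; have := res_bound sa z1 Wa; rewrite gtr0_norm.
  - move=> a Ya; have Wa := YW _ Ya; rewrite -mulrA ler_pdivlMl//.
    rewrite -(@ler_pXn2r _ 2)// ?nnegrE ?mulr_ge0 ?rn_ge0 ?(ltW q0)// !exprMn rz.
    set x := rp z - t in zt rz *; have n0 := rn_ge0 (res z a).
    (* [X1] and [X2] stand for the squared distances from [rp z] to the ends of the interval, both
       at least [(x / 2)^2]. This gives [|z - t|^2 |res z a|^2 <= 8 |a|^2], and 8 is rounded up to
       [3^2]. *)
    have key (X1 X2 : R) : (x / 2) ^+ 2 <= X1 -> (x / 2) ^+ 2 <= X2 ->
      rn (res z a) ^+ 2 <= rn a ^+ 2 * ((X1 + ip z ^+ 2)^-1 + (X2 + ip z ^+ 2)^-1) ->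
      (x ^+ 2 + ip z ^+ 2) * rn (res z a) ^+ 2 <= 3 ^+ 2 * rn a ^+ 2.
      move=> x1 x2 h; set D := (x / 2) ^+ 2 + ip z ^+ 2.
      have zz : 0 < ip z ^+ 2 by rewrite exprn_gt0.
      have D0 : 0 < D by rewrite ltr_wpDl ?sqr_ge0.
      have i1 : (X1 + ip z ^+ 2)^-1 <= D^-1.
        by rewrite lef_pV2 ?posrE//; rewrite /D; have := sqr_ge0 (x / 2); lra.
      have i2 : (X2 + ip z ^+ 2)^-1 <= D^-1.
        by rewrite lef_pV2 ?posrE//; rewrite /D; have := sqr_ge0 (x / 2); lra.
      have i3 : rn a ^+ 2 * ((X1 + ip z ^+ 2)^-1 + (X2 + ip z ^+ 2)^-1) <= rn a ^+ 2 * (2 / D).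
        by rewrite ler_wpM2l ?sqr_ge0//; lra.
      have i4 := le_trans h i3.
      have i5 : x ^+ 2 + ip z ^+ 2 <= 4 * D.
        by rewrite /D exprMn exprVn; lra.
      have i6 : (x ^+ 2 + ip z ^+ 2) * rn (res z a) ^+ 2 <= 4 * D * rn (res z a) ^+ 2.
        by rewrite ler_wpM2r ?sqr_ge0.
      have i7 : D * rn (res z a) ^+ 2 <= 2 * rn a ^+ 2.
        rewrite mulrC -ler_pdivlMr//.
          by have -> : 2 * rn a ^+ 2 / D = rn a ^+ 2 * (2 / D) by ring.
      have := sqr_ge0 (rn a); lra.
    have zt' : - (r / 2) <= x <= r / 2 by rewrite -ler_norml.
    have [x0|] := ltP x 0.
      have [||_ sm] := Ys a (- x / 2) Ya; try lra.
        have := gap_bound sa Wa sm (z := z); rewrite /x in x0 zt *.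
        move: zt; rewrite ler_norml => zt.
        move=> /(_ ltac:(lra) ltac:(lra)); apply: key.
          by apply: sqr_le; rewrite /x; left; lra.
        by apply: sqr_le; rewrite /x; right; lra.
    rewrite le_eqVlt => /orP[/eqP x0|x0]; last first.
      have [||sm _] := Ys a (x / 2) Ya; try lra.
        have := gap_bound sa Wa sm (z := z); rewrite /x in x0 zt *.
        move: zt; rewrite ler_norml => zt.
        move=> /(_ ltac:(lra) ltac:(lra)); apply: key.
          by apply: sqr_le; rewrite /x; left; lra.
        by apply: sqr_le; rewrite /x; right; lra.
    rewrite -x0 expr0n add0r -!exprMn ler_pXn2r ?nnegrE ?mulr_ge0 ?rn_ge0 ?(ltW z0)//.
    by have := res_bound sa z1 Wa; rewrite gtr0_norm//; have := rn_ge0 a; lra.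
  exact: Yd.
move=> y e ry e0 er; have Wy := ran_shift_sub ry; case: (ry) => u Tu.
have Wu := (sa_sub sa Tu).1.
(* Second stage. For [y = (T - t) u] the resolvent is [u + (z - t) res z u], of norm at most
   [|u| + 3 |u|] by the first stage. So [y] is small on a whole interval centred at [t], and
   [gap_bound] applies across [t]. *)
have sm : small_on T (t - r / 2) (t + r / 2) y.
  move=> k k0; pose N := (4 * rn u) ^+ 2 + 1.
  have N0 : 0 < N by rewrite ltr_wpDl ?sqr_ge0.
  exists (Num.min (r / 4) (k / N)); first by rewrite lt_min !divr_gt0.
  move=> e' s e'0; rewrite lt_min => /andP[e'r]; rewrite ltr_pdivlMr// => e'k st.
  have e'1 : ip (Complex s e') != 0 by rewrite /= gt_eqF.
  have h : rn (res (Complex s e') y) <= 4 * rn u.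
    rewrite (res_shift sa e'1 Wu Tu); apply: (le_trans (rnD _ _)); rewrite rnZ.
    have := S1 u (Complex s e') Wu; rewrite /= ler_norml => /(_ ltac:(lra) e'0 e'r).
    lra.
  have {}h : rn (res (Complex s e') y) ^+ 2 <= (4 * rn u) ^+ 2.
    by rewrite ler_pXn2r ?nnegrE ?mulr_ge0 ?rn_ge0.
  have := ler_wpM2l (ltW e'0) h; rewrite /N in e'k; lra.
have e1 : ip (Complex t e) != 0 by rewrite /= gt_eqF.
have := gap_bound sa Wy sm (z := Complex t e) => /= /(_ ltac:(lra) ltac:(lra)) h.
have r1 : 0 <= 3 / r by rewrite divr_ge0// ltW.
rewrite -(@ler_pXn2r _ 2)// ?nnegrE ?(mulr_ge0 r1) ?rn_ge0//.
apply: (le_trans h); rewrite exprMn mulrC ler_wpM2r ?sqr_ge0//.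
have ee : 0 < e ^+ 2 by rewrite exprn_gt0.
have rr : 0 < r ^+ 2 by rewrite exprn_gt0.
have i (X : R) : X = (r / 2) ^+ 2 -> (X + e ^+ 2)^-1 <= 4 / r ^+ 2.
  move=> ->; have -> : 4 / r ^+ 2 = ((r / 2) ^+ 2)^-1 by field; rewrite gt_eqF.
  have p : 0 < (r / 2) ^+ 2 by rewrite exprn_gt0 ?divr_gt0.
  by rewrite lef_pV2 ?posrE//; lra.
(* Both ends are at distance [r / 2] from [t], so the two kernels add up to at most [8 / r^2], below
   [(3 / r)^2]. *)
have i1 := i ((t - (t - r / 2)) ^+ 2) ltac:(by ring).
have i2 := i ((t - (t + r / 2)) ^+ 2) ltac:(by ring).
have -> : (3 / r) ^+ 2 = 9 / r ^+ 2 by field; rewrite gt_eqF.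
have : 0 < (r ^+ 2)^-1 by rewrite invr_gt0.
lra.
Qed.

End Range.

(** * Uniform boundedness *)

Section UniformBoundedness.
Context (R : realType) (V : completeNormedModType R[i]) (V' : normedModType R[i]).
Context (X : set V) (I : Type) (D : set I) (F : I -> V -> V').
Hypotheses (sX : linear_subspace X) (cX : closed X).
Hypothesis FB : forall i x y, D i -> X x -> X y -> F i (x - y) = F i x - F i y.
Hypothesis FZ : forall i a x, D i -> X x -> F i (a *: x) = a *: F i x.
Hypothesis Fbd : forall i, D i -> exists K : R, forall x, X x -> rn (F i x) <= K * rn x.
Hypothesis Fpt : forall x, X x -> exists M : R, forall i, D i -> rn (F i x) <= M.

(** Nested balls instead of category. Scaling gives a [w] of norm [r / 2] with
    [|F i w| > 2 (n + 1)]; then [F i] exceeds [n + 1] at [x0] or at [x0 + w], and by its own bound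
    [K] it exceeds [n] on a small ball around that point. *)
Let unbounded_step : (forall C : R, 0 <= C -> exists i x, [/\ D i, X x & C * rn x < rn (F i x)]) ->
  forall (n : nat) (x0 : V) (r : R), X x0 -> 0 < r ->
  exists x1 (r1 : R), [/\ X x1, 0 < r1, r1 <= r / 2,
    rn (x1 - x0) <= r / 2 &
    exists2 i, D i & forall x, X x -> rn (x - x1) <= r1 -> n%:R < rn (F i x)].
Proof.
move=> H n x0 r Xx0 r0.
have N0 : 0 < (n.+1%:R : R) by rewrite ltr0n.
have r2 : 0 < r / 2 by rewrite divr_gt0.
have [|i [v [Di Xv vC]]] := H (2 * n.+1%:R / (r / 2)).
  by apply: divr_ge0; [rewrite mulr_ge0 ?ler0n|exact: ltW].
have v0 : 0 < rn v.
  rewrite lt0r rn_ge0 andbT; apply/eqP => /rn_eq0 v0.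
  have F0 : F i 0 = 0 by rewrite -[X in F i X](scale0r (0 : V)) FZ ?scale0r//; exact: subsp0.
  by move: vC; rewrite v0 F0 !rn0 mulr0 ltxx.
pose w := (r / 2 / rn v)%:C%C *: v.
have c0 : 0 < r / 2 / rn v by rewrite !divr_gt0.
have Xw : X w by exact: subspZ.
have rw : rn w = r / 2 by rewrite rnZ rn_real gtr0_norm// divfK// gt_eqF.
have Fw : 2 * n.+1%:R < rn (F i w).
  rewrite FZ// rnZ rn_real gtr0_norm// mulrAC ltr_pdivlMr// [ltRHS]mulrC.
  by move: vC; rewrite mulrAC ltr_pdivrMr.
have [K HK] := Fbd Di.
have [x1 [Xx1 x1x0 Fx1]] : exists x1, [/\ X x1, rn (x1 - x0) <= r / 2 & n.+1%:R < rn (F i x1)].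
  have [h|h] := ltP n.+1%:R (rn (F i x0)).
    by exists x0; rewrite subrr rn0 ltW// divr_gt0.
  exists (x0 + w); have Xs := subspD sX Xx0 Xw; split => //.
    by rewrite addrAC subrr add0r rw.
  have : rn (F i w) <= rn (F i (x0 + w)) + rn (F i x0).
    have -> : F i w = F i (x0 + w) - F i x0 by rewrite -FB// addrAC subrr add0r.
    by rewrite (le_trans (rnD _ _))// rnN.
  lra.
have K1 : 0 < `|K| + 1 by rewrite ltr_wpDl.
pose r1 := Num.min (r / 2) (`|K| + 1)^-1.
have r10 : 0 < r1 by rewrite lt_min divr_gt0// invr_gt0.
exists x1, r1; split => //; first by rewrite ge_min lexx.
exists i => // x Xx xx1.
have h1 : rn (F i x1) <= rn (F i (x1 - x)) + rn (F i x).
  by rewrite FB// (le_trans _ (rnD _ _))// subrK.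
have h2 : rn (F i (x1 - x)) <= (`|K| + 1) * r1.
  apply: (le_trans (HK _ (subspB sX Xx1 Xx))).
  apply: (@le_trans _ _ ((`|K| + 1) * rn (x1 - x))).
    by rewrite ler_wpM2r ?rn_ge0//; have := ler_norm K; lra.
  by rewrite ler_pM2l// rnB.
have h3 : (`|K| + 1) * r1 <= 1.
  by rewrite -ler_pdivlMl// mulr1 ge_min lexx orbT.
move: Fx1; rewrite -natr1; lra.
Qed.

Theorem uniform_boundedness :
  exists2 C : R, 0 <= C & forall i x, D i -> X x -> rn (F i x) <= C * rn x.
Proof.
apply: contrapT => nb.
have H : forall C : R, 0 <= C -> exists i x, [/\ D i, X x & C * rn x < rn (F i x)].
  move=> C C0; apply: contrapT => nH; apply: nb; exists C => // i x Di Xx.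
  by rewrite leNgt; apply/negP => h; apply: nH; exists i, x.
(* Centres and radii carry their invariants, so that the choice of the next ball is a plain
   function. The common point of all the balls violates the pointwise bound. *)
pose S := {p : V * R | X p.1 /\ 0 < p.2}.
pose P (np : nat * S) (q : S) := [/\ (sval q).2 <= (sval np.2).2 / 2,
  rn ((sval q).1 - (sval np.2).1) <= (sval np.2).2 / 2 &
  exists2 i, D i & forall x, X x -> rn (x - (sval q).1) <= (sval q).2 -> np.1%:R < rn (F i x)].
have [f fP] : {f : nat * S -> S & forall np, P np (f np)}.
  apply: choice => -[n [[x r] /= [Xx r0]]].
  have [x1 [r1 [Xx1 r10 h1 h2 h3]]] := unbounded_step H n Xx r0.
  by exists (exist _ (x1, r1) (conj Xx1 r10)); split.
have p0 : X (0 : V) /\ (0 : R) < 1 by split; [exact: subsp0|exact: ltr01].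
pose u := fix u n : S := if n is m.+1 then f (m, u m) else exist _ (0, 1) p0.
pose x n := (sval (u n)).1; pose r n := (sval (u n)).2.
have Xx n : X (x n) by exact: (svalP (u n)).1.
have r0 n : 0 < r n by exact: (svalP (u n)).2.
have uS n : P (n, u n) (u n.+1) by exact: fP.
have rS n : r n.+1 <= r n / 2 by have [] := uS n.
have xS n : rn (x n.+1 - x n) <= r n / 2 by have [] := uS n.
have nest n k : rn (x (k + n)%N - x n) + r (k + n)%N <= r n.
  elim: k => [|k IH]; first by rewrite subrr rn0 add0r.
  have := rn_triangle (x (k + n)%N) (x (k + n).+1) (x n).
  have := xS (k + n)%N; have := rS (k + n)%N; rewrite addSn.
  lra.
have rsmall n : r n <= (2 ^+ n)^-1.
  elim: n => [|n IH]; first by rewrite expr0 invr1.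
  by rewrite exprS invfM; have := rS n; lra.
have small (e : R) : 0 < e -> exists n, r n < e.
  move=> e0; exists (Num.truncn e^-1).+1; apply: le_lt_trans (rsmall _) _.
  rewrite invf_plt ?posrE ?exprn_gt0//.
  apply: lt_le_trans (truncnS_gt _) _.
  by rewrite -natrX ler_nat ltnW// ltn_expl.
have [|l xl] := @cauchy_seqP _ V x.
  move=> e e0; have [|N HN] := small (e / 2); first by rewrite divr_gt0.
  exists N => m n Nm Nn.
  have hm := nest N (m - N)%N; have hn := nest N (n - N)%N.
  rewrite !subnK// in hm hn.
  have := rn_triangle (x N) (x m) (x n); rewrite (rnB (x N)).
  by have := r0 m; have := r0 n; lra.
have Xl : X l.
  by apply: ((closedrnP X).1 cX) => e /xl[N HN]; exists (x N) => //; exact: HN.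
have lx n : rn (l - x n) <= r n.
  apply/ler_addgt0Pr => e e0; have [N HN] := xl e e0.
  have h := nest n (N)%N; have := HN (N + n)%N (leq_addr _ _).
  have := rn_triangle (x (N + n)%N) l (x n); rewrite (rnB l (x (N + n)%N)).
  by have := r0 (N + n)%N; lra.
have [M HM] := Fpt Xl.
have [_ _ [i Di Hi]] := uS (Num.truncn M).+1.
have := Hi l Xl (lx _); rewrite /= => h.
have := HM i Di; have := truncnS_gt M; lra.
Qed.

End UniformBoundedness.

(** * Bounded invertibility near a point of the plane *)

Section Regular.
Context (R : realType) (V : hilbertType R).

(** Uniformly bounded invertibility of [T - l] within [W] on a disc. It is stated through solutions,
    not [res], since the disc may contain real points. *)
Definition regular_on (T : set (V * V)) (W : set V) (z : R[i]) (r C : R) :=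
  (forall l y, rn (l - z) < r -> W y -> exists2 u, W u & T (u, l *: u + y)) /\
  (forall l u y, rn (l - z) < r -> W u -> W y -> T (u, l *: u + y) -> rn u <= C * rn y).

Context (W : set V) (T : set (V * V)).
Hypothesis sa : sarel W T.
Local Notation res := (res T).

Lemma regular_nonreal z : ip z != 0 -> regular_on T W z (`|ip z| / 2) (2 / `|ip z|).
Proof.
move=> z0; have z1 : 0 < `|ip z| by rewrite normr_gt0.
have near l : rn (l - z) < `|ip z| / 2 -> `|ip z| / 2 < `|ip l|.
  move=> lz; have := rn_ge_ip (l - z); rewrite ipD ipN.
  have := ler_distD (ip l) (ip z) 0; rewrite !subr0 distrC; lra.
have near0 l : rn (l - z) < `|ip z| / 2 -> ip l != 0.
  by move=> /near h; rewrite -normr_gt0; apply: lt_trans h; rewrite divr_gt0.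
split=> [l y /near0 l0 Wy|l u y lz Wu Wy Tu].
  by exists (res l y); [exact: res_in|exact: (resP sa)].
have h := symmetric_bound (sa_sym sa) Tu; have h1 := near _ lz.
have -> : 2 / `|ip z| = (`|ip z| / 2)^-1 by rewrite invfM invrK mulrC.
rewrite ler_pdivlMl ?divr_gt0//.
by apply: (le_trans _ h); rewrite ler_wpM2r ?rn_ge0// ltW.
Qed.

Lemma regular_real t : closed (ran_shift T t%:C%C) ->
  exists r C : R, [/\ 0 < r, 0 <= C & regular_on T (ran_shift T t%:C%C) t%:C%C r C].
Proof.
move=> cR; set Y := ran_shift T t%:C%C in cR *.
have sY : linear_subspace Y by apply: ran_shift_subspace; exact: (sa_lin sa).
have YW : Y `<=` W := @ran_shift_sub _ _ _ _ sa _.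
have n0 (e : R) : 0 < e -> ip (Complex t e) != 0 by move=> e0; rewrite gt_eqF.
have [||||C C0 HC] := @uniform_boundedness _ _ _ Y R [set e | 0 < e]
   (fun e y => res (Complex t e) y) sY cR.
- by move=> e x y /= /n0 e0 /YW Wx /YW Wy; exact: (resB sa).
- by move=> e a x /= /n0 e0 /YW Wx; exact: (resZ sa).
- move=> e /= e0; exists e^-1 => x /YW Wx.
  by rewrite ler_pdivlMl//; have := res_bound sa (n0 _ e0) Wx; rewrite /= gtr0_norm.
(* Pointwise bound on the range: the resolvent is [u + 'i e res u], and [e |res u| <= |u|]. *)
- move=> y [u Tu]; have Wu := (sa_sub sa Tu).1.
  exists (2 * rn u) => e /= e0; rewrite (res_shift sa (n0 _ e0) Wu Tu).
  apply: le_trans (rnD _ _) _; rewrite rnZ rn_ver.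
  by have := res_bound sa (n0 _ e0) Wu; rewrite /=; lra.
(* Let [e] tend to 0 in [res y = u + 'i e res u], the resolvents being taken at [t + 'i e]: as [u]
   too lies in the range, [C] bounds the last resolvent. *)
have bd0 u y : Y u -> Y y -> T (u, t%:C%C *: u + y) -> rn u <= C * rn y.
  move=> Yu Yy Tu; apply/ler_addgt0Pr => k k0.
  pose q := C * rn u + 1; have q0 : 0 < q by rewrite ltr_wpDl ?mulr_ge0 ?rn_ge0.
  pose e := k / q; have e0 : 0 < e by rewrite divr_gt0.
  have h1 := HC e y e0 Yy; have h2 := HC e u e0 Yu.
  have h3 := res_shift sa (n0 _ e0) (YW _ Yu) Tu.
  have h4 : rn u <= rn (res (Complex t e) y) + e * rn (res (Complex t e) u).
    rewrite h3; set c := Complex t e - _; set w := res _ u.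
    by have := rnD (u + c *: w) (- (c *: w)); rewrite addrK rnN rnZ rn_ver gtr0_norm.
  have h5 : e * rn (res (Complex t e) u) <= e * (C * rn u) by rewrite ler_pM2l.
  have h6 : e * q = k by rewrite /e divfK// gt_eqF.
  rewrite /q in h6; lra.
(* Radius of a perturbation argument: [C * r <= 1 / 2], so that the term [(l - t) u] is absorbed at
   the cost of doubling the constant. *)
pose r := (2 * (C + 1))^-1; have r0 : 0 < r by rewrite invr_gt0 mulr_gt0// ltr_wpDl.
have bd l u y : rn (l - t%:C%C) < r -> Y u -> Y y -> T (u, l *: u + y) -> rn u <= 2 * C * rn y.
  move=> lt Yu Yy Tu.
  have Yv : Y (y + (l - t%:C%C) *: u) by apply: subspD => //; exact: subspZ.
  have := bd0 u _ Yu Yv; rewrite addrCA -scalerDl [t%:C%C + _]addrC subrK addrC => /(_ Tu) h.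
  have h1 := rnD y ((l - t%:C%C) *: u); rewrite rnZ in h1.
  have h2 : C * rn (y + (l - t%:C%C) *: u) <= C * (rn y + rn (l - t%:C%C) * rn u).
    by rewrite ler_wpM2l.
  have rC : r * (2 * (C + 1)) = 1 by rewrite mulVf// gt_eqF// mulr_gt0// ltr_wpDl.
  have h3 : C * (rn (l - t%:C%C) * rn u) <= C * (r * rn u).
    by rewrite ler_wpM2l// ler_wpM2r ?rn_ge0// ltW.
  have h4 : C * (r * rn u) <= rn u / 2.
    have := mulr_ge0 (ltW r0) (rn_ge0 u); have : (r * (2 * (C + 1))) * rn u = rn u by rewrite rC mul1r.
    lra.
  have := rn_ge0 u; lra.
exists r, (2 * C); split => //; first by rewrite mulr_ge0 ?ler0n.
split => // l y lt Yy; have Wy := YW _ Yy.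
have [l0|l0] := eqVneq (ip l) 0; last first.
  by exists (res l y); [exact: (res_ran sa l0 Yy)|exact: (resP sa l0 Wy)].
(* At a real [l] the solution is obtained as a limit of resolvents from above. *)
have lr : l = (rp l)%:C%C by apply: complex_eq.
pose d := r - rn (l - t%:C%C); have d0 : 0 < d by rewrite subr_gt0.
have bdl e x : 0 < e -> e < d -> Y x -> rn (res (Complex (rp l) e) x) <= 2 * C * rn x.
  move=> e0 ed Yx; have ne : ip (Complex (rp l) e) != 0 by rewrite /= gt_eqF.
  apply: (bd (Complex (rp l) e)) => //; [|exact: (res_ran sa ne Yx)|exact: (resP sa ne (YW _ Yx))].
  apply: le_lt_trans (rn_triangle l _ _) _; rewrite {2}lr rn_ver gtr0_norm//.
  by rewrite /d in ed; lra.
have C20 : 0 <= 2 * C by rewrite mulr_ge0 ?ler0n.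
have [|w Tw Hw] := @lim_solution _ _ _ _ sa (rp l) (2 * C * (2 * C * rn y)) d y Wy d0.
  move=> e e' e0 ed e'0 e'd.
  have ne : ip (Complex (rp l) e') != 0 by rewrite /= gt_eqF.
  apply: le_trans (bdl _ _ e0 ed (res_ran sa ne Yy)) _.
  by rewrite ler_wpM2l// bdl.
rewrite -lr in Tw; exists w => //.
apply: ((closedrnP Y).1 cR) => k /Hw[d1 d10 H1].
pose e := Num.min (d1 / 2) 1.
have e0 : 0 < e by rewrite lt_min divr_gt0//=.
exists (res (Complex (rp l) e) y); last first.
  apply: H1 => //; have : e <= d1 / 2 by rewrite ge_min lexx.
  lra.
by apply: (res_ran sa _ Yy); rewrite /= gt_eqF.
Qed.

End Regular.

(** * Differentiability of resolvents *)

Section Jet1.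
Context (R : realType).
Implicit Types (f g : R[i] -> R[i]) (z w : R[i]).

(** Stronger than differentiability, but stable under sums and products and immediate from the
    resolvent identity. *)
Definition jet1 f z := exists f1 : R[i], exists M d : R, 0 < d /\
  forall w, rn w < d -> rn (f (z + w) - f z - f1 * w) <= M * rn w ^+ 2.

Lemma jet1_cst (c z : R[i]) : jet1 (fun=> c) z.
Proof.
exists 0, 0, 1; split => // w _.
by rewrite subrr mul0r subr0 rn0 mul0r.
Qed.

Lemma jet1_id z : jet1 id z.
Proof.
exists 1, 0, 1; split => // w _.
by rewrite /= mul1r (addrAC z) subrr add0r subrr rn0 mul0r.
Qed.

Lemma jet1D f g z : jet1 f z -> jet1 g z -> jet1 (fun z => f z + g z) z.
Proof.
move=> [f1 [M [d [d0 H]]]] [g1 [M' [d' [d'0 H']]]].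
exists (f1 + g1), (M + M'), (Num.min d d'); split; first by rewrite lt_min d0.
move=> w; rewrite lt_min => /andP[/H h /H' h'].
have := le_trans (rnD _ _) (lerD h h'); rewrite -mulrDl.
by congr (rn _ <= _); ring.
Qed.

Lemma jet1M f g z : jet1 f z -> jet1 g z -> jet1 (fun z => f z * g z) z.
Proof.
move=> [f1 [M [d [d0 H]]]] [g1 [M' [d' [d'0 H']]]].
exists (f1 * g z + f z * g1), (`|M| * (rn (g z) + rn g1 + `|M'|) +
   `|M'| * rn (f z) + rn f1 * (rn g1 + `|M'|)), (Num.min 1 (Num.min d d')).
split; first by rewrite !lt_min ltr01 d0.
move=> w; rewrite !lt_min => /and3P[w1 /H h /H' h'].
set Ef := f (z + w) - f z - f1 * w in h; set Eg := g (z + w) - g z - g1 * w in h'.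
have -> : f (z + w) * g (z + w) - f z * g z - (f1 * g z + f z * g1) * w =
   Ef * (g z + g1 * w + Eg) + (f z * Eg + f1 * w * (g1 * w + Eg)).
  by rewrite /Ef /Eg; ring.
have w0 := rn_ge0 w; have w2 : 0 <= rn w ^+ 2 by exact: sqr_ge0.
have w3 : rn w ^+ 2 <= rn w by rewrite expr2 -[leRHS]mulr1 ler_wpM2l// ltW.
have {}h : rn Ef <= `|M| * rn w ^+ 2.
  by apply: (le_trans h); rewrite ler_wpM2r// ler_norm.
have {}h' : rn Eg <= `|M'| * rn w ^+ 2.
  by apply: (le_trans h'); rewrite ler_wpM2r// ler_norm.
have b1 : rn (g z + g1 * w + Eg) <= rn (g z) + rn g1 + `|M'|.
  have t1 := rnD (g z + g1 * w) Eg; have t2 := rnD (g z) (g1 * w).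
  rewrite rnM in t2.
  have t3 : rn g1 * rn w <= rn g1 by rewrite -[leRHS]mulr1 ler_wpM2l ?rn_ge0 ?ltW.
  have t4 : `|M'| * rn w ^+ 2 <= `|M'|.
    by rewrite -[leRHS]mulr1 ler_wpM2l// (le_trans w3)// ltW.
  lra.
have b2 : rn (g1 * w + Eg) <= (rn g1 + `|M'|) * rn w.
  have t1 := rnD (g1 * w) Eg; rewrite rnM in t1.
  have t4 : `|M'| * rn w ^+ 2 <= `|M'| * rn w by rewrite ler_wpM2l.
  lra.
have c1 := ler_pM (rn_ge0 _) (rn_ge0 _) h b1; rewrite -rnM in c1.
have c2 := ler_wpM2l (rn_ge0 (f z)) h'; rewrite -rnM in c2.
have c3 := ler_wpM2l (rn_ge0 (f1 * w)) b2; rewrite -rnM rnM [rn (f1 * w)]rnM -rnM in c3.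
have t1 := rnD (Ef * (g z + g1 * w + Eg)) (f z * Eg + f1 * w * (g1 * w + Eg)).
have t2 := rnD (f z * Eg) (f1 * w * (g1 * w + Eg)).
rewrite [rn (f1 * w * _)]rnM [rn (f1 * w)]rnM in t2.
rewrite rnM in c3.
lra.
Qed.

Lemma near_RiP z (P : R[i] -> Prop) :
  (\forall w \near (z : R[i]^o), P w) <->
  exists2 d : R, 0 < d & forall w, rn (w - z) < d -> P w.
Proof. exact: (@nearrnP R R[i]^o z P). Qed.

Lemma dnear_RiP z (P : R[i] -> Prop) :
  (\forall w \near (z : R[i]^o)^', P w) <->
  exists2 d : R, 0 < d & forall w, rn (w - z) < d -> w != z -> P w.
Proof. exact: (@near_RiP z (fun w => w != z -> P w)). Qed.

End Jet1.

Section MatrixOperators.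
Context (R : realType) (H : hilbertType R) (d : nat) (e : 'I_d -> H).
Implicit Types a b : 'I_d -> 'I_d -> R[i].

Definition mxop a (x : H) : H := \sum_i (\sum_j hdot x (e j) * a i j) *: e i.

Lemma mxop_linear a (c : R[i]) x y : mxop a (c *: x + y) = c *: mxop a x + mxop a y.
Proof.
rewrite /mxop scaler_sumr -big_split /=; apply: eq_bigr => i _.
rewrite scalerA -scalerDl mulr_sumr -big_split /=; congr (_ *: _).
by apply: eq_bigr => j _; rewrite hdotDl hdotZl mulrDl mulrA.
Qed.

Lemma mxop_lincomb a b (c : R[i]) x :
  mxop (fun i j => c * a i j + b i j) x = c *: mxop a x + mxop b x.
Proof.
rewrite /mxop scaler_sumr -big_split /=; apply: eq_bigr => i _.
rewrite scalerA -scalerDl mulr_sumr -big_split /=; congr (_ *: _).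
by apply: eq_bigr => j _; rewrite mulrDr mulrCA.
Qed.

Lemma rn_mxop a x :
  rn (mxop a x) <= (\sum_i \sum_j rn (e j) * rn (a i j) * rn (e i)) * rn x.
Proof.
rewrite mulr_suml; apply: le_trans (rn_sum _ _ _) _; apply: ler_sum => i _.
rewrite rnZ mulr_suml.
have h := rn_sum (index_enum 'I_d) xpredT (fun j => hdot x (e j) * a i j).
apply: le_trans (ler_wpM2r (rn_ge0 _) h) _; rewrite mulr_suml.
apply: ler_sum => j _; rewrite rnM.
have := ler_wpM2r (mulr_ge0 (rn_ge0 (a i j)) (rn_ge0 (e i))) (cauchy_schwarz x (e j)).
lra.
Qed.

Lemma mxop_bounded (W : set H) a : linear_subspace W -> (forall i, W (e i)) ->
  bounded_on W (mxop a).
Proof.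
move=> sW We; split.
- by move=> c x y _ _; exact: mxop_linear.
- by move=> x _; apply: subsp_sum => // i; exact: subspZ.
exists (\sum_i \sum_j rn (e j) * rn (a i j) * rn (e i))%:C%C => x _.
by rewrite !normrnE -rmorphM lecR rn_mxop.
Qed.

Lemma mxop_derivable (W : set H) (a : R[i] -> 'I_d -> 'I_d -> R[i]) z :
  linear_subspace W -> (forall i, W (e i)) ->
  (forall i j, jet1 (fun l => a l i j) z) -> op_derivable W (fun l => mxop (a l)) z.
Proof.
move=> sW We Hj.
have [D HD] := choice (fun ij => Hj ij.1 ij.2).
have [M HM] := choice HD; have [r Hr] := choice HM.
exists (mxop (fun i j => D (i, j))); first exact: mxop_bounded.
move=> eps eps0; have er : eps = (rp eps)%:C%C by rewrite RRe_real// gtr0_real.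
set eps' := rp eps in er; have eps'0 : 0 < eps' by rewrite -ltcR -er.
pose S := \sum_i \sum_j rn (e j) * `|M (i, j)| * rn (e i).
have S0 : 0 <= S by do 2!apply: sumr_ge0 => ? _; rewrite !mulr_ge0 ?rn_ge0.
pose r0 := \big[Num.min/1]_ij r ij.
have r00 : 0 < r0.
  by apply: (big_ind (fun x : R => 0 < x)) => // [x y x0 y0|ij _]; [rewrite lt_min x0|have [] := Hr ij].
have rle ij : r0 <= r ij by exact: bigmin_le_cond.
apply/near_RiP; exists (Num.min r0 (eps' / (S + 1))).
  by rewrite lt_min r00 divr_gt0// ltr_wpDl.
move=> w; rewrite lt_min => /andP[wr0 weps] x _.
rewrite er !normrnE -!rmorphM lecR.
pose b i j := a w i j - a z i j - D (i, j) * (w - z).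
have -> : mxop (a w) x - mxop (a z) x - (w - z) *: mxop (fun i j => D (i, j)) x = mxop b x.
  rewrite -!scaleNr -[mxop (a w) x]scale1r -[- mxop (a z) x]scaleN1r -addrA.
  rewrite -[_ *: mxop _ x in X in _ + (_ + X)]addr0.
  have m0 : mxop (fun _ _ => 0) x = 0.
    by rewrite /mxop big1// => i _; rewrite big1 ?scale0r// => j _; rewrite mulr0.
  rewrite -m0 -!mxop_lincomb; congr (mxop _ x).
  by apply/funext => i; apply/funext => j; rewrite /b; ring.
apply: le_trans (rn_mxop _ _) _; apply: ler_wpM2r; first exact: rn_ge0.
have h : \sum_i \sum_j rn (e j) * rn (b i j) * rn (e i) <= S * rn (w - z) ^+ 2.
  rewrite /S mulr_suml; apply: ler_sum => i _; rewrite mulr_suml; apply: ler_sum => j _.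
  have [_ /(_ (w - z))] := Hr (i, j); rewrite (addrC z) subrK => /(_ (lt_le_trans wr0 (rle _))) hb.
  have {}hb : rn (b i j) <= `|M (i, j)| * rn (w - z) ^+ 2.
    by apply: (le_trans hb); rewrite ler_wpM2r ?sqr_ge0// ler_norm.
  have := ler_wpM2l (mulr_ge0 (rn_ge0 (e j)) (rn_ge0 (e i))) hb; lra.
apply: (le_trans h); rewrite expr2 mulrA; apply: ler_wpM2r; first exact: rn_ge0.
move: weps; rewrite ltr_pdivlMr ?ltr_wpDl//; have := rn_ge0 (w - z); lra.
Qed.

End MatrixOperators.

Section ResolventLocal.
Context (R : realType) (V : hilbertType R) (W : set V) (T : set (V * V)).
Hypothesis sa : sarel W T.

Lemma regular_jet1 (Y : set V) z0 r C y x z : linear_subspace Y -> regular_on T Y z0 r C ->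
  Y y -> rn (z - z0) < r ->
  jet1 (fun l => hdot (xget 0 [set u | Y u /\ T (u, l *: u + y)]) x) z.
Proof.
move=> sY [ex bd] Yy zr.
pose S l v := xget 0 [set u | Y u /\ T (u, l *: u + v)].
have SP l v : rn (l - z0) < r -> Y v -> Y (S l v) /\ T (S l v, l *: S l v + v).
  move=> lr Yv; rewrite /S; case: xgetP => [u -> //|].
  by have [u Yu Tu] := ex _ _ lr Yv => /(_ u); case; split.
have Sb l v : rn (l - z0) < r -> Y v -> rn (S l v) <= C * rn v.
  by move=> lr Yv; have [Ys Ts] := SP l v lr Yv; exact: (bd l).
have Su l v u : rn (l - z0) < r -> Y v -> Y u -> T (u, l *: u + v) -> u = S l v.
  move=> lr Yv Yu Tu; have [Ys Ts] := SP l v lr Yv.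
  apply/eqP; rewrite -subr_eq0; apply/eqP/rn_eq0; apply/eqP; rewrite eq_le rn_ge0 andbT.
  have := bd l (u - S l v) 0 lr (subspB sY Yu Ys) (subsp0 sY).
  rewrite rn0 mulr0; apply.
  have := subspB (sa_lin sa) Tu Ts; congr T; congr pair => /=.
  by rewrite addr0 scalerBr opprD addrACA subrr addr0.
have Sid l m v : rn (l - z0) < r -> rn (m - z0) < r -> Y v ->
    S l v = S m v + (l - m) *: S l (S m v).
  move=> lr mr Yv; symmetry; have [Y1 T1] := SP m v mr Yv; have [Y2 T2] := SP l _ lr Y1.
  apply: Su => //; first by apply: subspD => //; exact: subspZ.
  have := subspZD (sa_lin sa) (l - m) T2 T1; congr T; congr pair => /=.
    by rewrite addrC.
  rewrite !scalerDr !scalerA (mulrC l) addrA; congr (_ + v).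
  by rewrite -addrA -scalerDl subrK addrC.
exists (hdot (S z (S z y)) x), (C * (C * (C * rn y)) * rn x), (r - rn (z - z0)).
split; first by rewrite subr_gt0.
move=> w wr; rewrite -!/(S _ _).
have zwr : rn (z + w - z0) < r.
  by rewrite addrAC (le_lt_trans (rnD _ _))//; lra.
have [Y1 _] := SP z y zr Yy; have [Y2 _] := SP z _ zr Y1.
have e1 : z + w - z = w by rewrite addrAC subrr add0r.
rewrite (Sid _ _ _ zwr zr Yy) e1 (Sid _ _ _ zwr zr Y1) e1.
rewrite !(hdotDl, hdotZl).
set X := hdot (S (z + w) (S z (S z y))) x.
have -> : hdot (S z y) x + w * (hdot (S z (S z y)) x + w * X) - hdot (S z y) x -
  hdot (S z (S z y)) x * w = w ^+ 2 * X by ring.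
rewrite rnM rnX mulrC; apply: ler_wpM2r; first exact: sqr_ge0.
apply: le_trans (cauchy_schwarz _ _) _; apply: ler_wpM2r; first exact: rn_ge0.
have b1 := Sb _ _ zr Yy; have b2 := Sb _ _ zr Y1; have b3 := Sb _ _ zwr Y2.
(* The sign of [C] is unknown: either this vector vanishes, or [b3] forces [C >= 0]. *)
have [y0|y0] := ltP 0 (rn (S z (S z y))); last first.
  have z2 : rn (S z (S z y)) = 0 by apply/eqP; rewrite eq_le y0 rn_ge0.
  rewrite z2 mulr0 in b3; apply: (le_trans b3).
  have [c0|c0] := leP 0 C; first by rewrite !mulr_ge0 ?rn_ge0.
  have : rn y = 0.
    apply/eqP; rewrite eq_le rn_ge0 andbT.
    have h : 0 <= C * rn y := le_trans (rn_ge0 _) b1.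
    by rewrite nmulr_rge0 in h.
  by move=> ->; rewrite !mulr0.
have C0 : 0 <= C.
  rewrite leNgt; apply/negP => c0.
  by have := le_trans (rn_ge0 _) b3; rewrite nmulr_rge0// leNgt y0.
apply: (le_trans b3); rewrite ler_wpM2l//; apply: (le_trans b2); rewrite ler_wpM2l//.
Qed.

(** At a real point [t] split [v = k + p] with [p] in [ran (T - t)] and [k] orthogonal to it: [k] is
    an eigenvector, contributing the simple pole [(t - l)^-1 k], and the resolvent on [p] is
    regular. At non-real points [k = 0]. *)
Lemma resolvent_local : (forall t : R, closed (ran_shift T t%:C%C)) ->
  forall z v, W v -> exists r : R, exists k : V, exists g : R[i] -> V, 0 < r /\
    forall l, rn (l - z) < r -> (forall x, jet1 (fun l => hdot (g l) x) l) /\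
      (l != z -> res T l v = (z - l)^-1 *: k + g l).
Proof.
move=> cR z v Wv.
have [z0|z0] := eqVneq (ip z) 0; last first.
  have reg := regular_nonreal sa z0.
  have r0 : 0 < `|ip z| / 2 by rewrite divr_gt0// normr_gt0.
  exists (`|ip z| / 2), 0, (fun l => xget 0 [set u | W u /\ T (u, l *: u + v)]).
  split=> // l lr; split=> [x|_].
    exact: (regular_jet1 x (sa_dom sa) reg Wv lr).
  rewrite scaler0 add0r /res; congr (xget 0 _); apply/seteqP; split=> u /=; last by case.
  by move=> Tu; split => //; exact: (sa_sub sa Tu).1.
have zr : z = (rp z)%:C%C by apply: complex_eq.
set t := rp z in zr.
have [r [C [r0 C0 reg]]] := regular_real sa (cR t).
set Y := ran_shift T t%:C%C in reg.
have sY : linear_subspace Y by exact: ran_shift_subspace (sa_lin sa).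
have YW : Y `<=` W by exact: (ran_shift_sub sa).
have [p Yp op] := projection sY (cR t) v.
set k := v - p in op.
have Wk : W k by apply: subspB => //; [exact: (sa_dom sa)|exact: YW].
have vE : v = k + p by rewrite subrK.
clearbody k.
have Tk : T (k, t%:C%C *: k).
  apply: (sa_adjoint sa) => //; first exact: (subspZ (sa_dom sa) _ Wk).
  move=> u u' Tu; apply/eqP; rewrite -subr_eq0; apply/eqP.
  have -> : hdot u' k - hdot u (t%:C%C *: k) = hdot (u' - t%:C%C *: u) k.
    by rewrite hdotBl hdotZl hdotZr conj_real.
  apply: (orth_sym op); exists u; by rewrite addrC subrK.
pose g l := xget 0 [set u | Y u /\ T (u, l *: u + p)].
exists r, k, g; split => // l; rewrite {1}zr => lr; split=> [x|lz].
  exact: (regular_jet1 x sY reg Yp lr).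
have tl : t%:C%C - l != 0 by rewrite subr_eq0 eq_sym -zr.
have [u Yu Tu] := reg.1 _ _ lr Yp.
have gP : Y (g l) /\ T (g l, l *: g l + p).
  by rewrite /g; case: xgetP => [u' -> //|/(_ u)]; case; split.
have Tg : T ((t%:C%C - l)^-1 *: k + g l, l *: ((t%:C%C - l)^-1 *: k + g l) + v).
  have := subspZD (sa_lin sa) (t%:C%C - l)^-1 Tk gP.2; congr T; congr pair => /=.
  rewrite vE scalerDr !scalerA [l * _]mulrC [RHS]addrACA; congr (_ + _).
  rewrite -[X in _ = _ + X]scale1r -scalerDl; congr (_ *: k).
  by field.
(* Here [l] may be real, so uniqueness has to be argued: two solutions differ by some [e] in
   [ker (T - l)], which lies in [ran (T - t)] because [(T - t) e = (l - t) e], and the bound in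
   [reg] makes it zero. *)
rewrite zr /res; case: xgetP => [u' -> /= Tu'|/(_ _ Tg)//].
apply/eqP; rewrite -subr_eq0; set e := (X in X == 0).
have Te : T (e, l *: e).
  have := subspB (sa_lin sa) Tu' Tg; congr T; congr pair => /=.
  by rewrite opprD addrACA subrr addr0 -scalerBr.
have Ye : Y e.
  have /(subspZ sY (l - t%:C%C)^-1) : Y ((l - t%:C%C) *: e).
    by exists e; rewrite -scalerDl addrC subrK.
  by rewrite scalerA mulVf ?scale1r// subr_eq0 -zr.
have := reg.2 l e 0 lr Ye (subsp0 sY); rewrite addr0 rn0 mulr0 => /(_ Te) e0.
by apply/eqP/rn_eq0/eqP; rewrite eq_le e0 rn_ge0.
Qed.

End ResolventLocal.

(** * Finite-dimensional extensions *)

Section FiniteSpans.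
Context (R : realType).

Lemma complex_cauchy (u : nat -> R[i]) :
  (forall e : R, 0 < e -> exists N, forall m n, (N <= m)%N -> (N <= n)%N ->
     rn (u m - u n) < e) ->
  exists l, forall e : R, 0 < e -> exists N, forall n, (N <= n)%N ->
    rn (u n - l) < e.
Proof.
move=> cu.
have real (f : R[i] -> R) : (forall a b, `|f a - f b| <= rn (a - b)) ->
    exists l, forall e : R, 0 < e -> exists N, forall n, (N <= n)%N -> `|f (u n) - l| < e.
  move=> fl; have : cvg ((f \o u) @ \oo).
    apply/cauchy_cvgP/cauchy_exP => e e0; have [N HN] := cu e e0.
    exists (f (u N)); exists N => // n /= Nn.
    by apply: le_lt_trans (fl _ _) _; exact: HN.
  rewrite cvg_ex => -[l ul]; exists l => e e0.
  have : nbhs l [set w | `|w - l| < e].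
    by apply/nbhs_ballP; exists e => //= w; rewrite /ball /= distrC.
  by move=> /ul[N _ HN]; exists N => n Nn; exact: HN.
have [|a Ha] := real (@complex.Re R).
  by move=> x y; rewrite -rpN -rpD rn_ge_rp.
have [|b Hb] := real (@complex.Im R).
  by move=> x y; rewrite -ipN -ipD rn_ge_ip.
exists (Complex a b) => e e0.
have [|N HN] := Ha (e / 2); first by rewrite divr_gt0.
have [|M HM] := Hb (e / 2); first by rewrite divr_gt0.
exists (maxn N M) => n; rewrite geq_max => /andP[/HN h1 /HM h2].
have -> : u n - Complex a b = (rp (u n) - a)%:C%C + 'i * (ip (u n) - b)%:C%C.
  by rewrite -complexiE; apply: complex_eq; rewrite ?(rpD, ipD, rpN, ipN, rpM, ipM)/=; ring.
apply: le_lt_trans (rnD _ _) _; rewrite rnM rn_i mul1r !rn_real; lra.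
Qed.

Section AddLine.
Context (V : lmodType R[i]).
Implicit Types (W : set V) (s : seq V).

Definition addline W (v : V) : set V := [set x | exists w c, W w /\ x = w + c *: v].

(** [W] plus the span of [s], built by iteration so that facts about finite-dimensional extensions
    follow by adding one line at a time. *)
Definition addspan W s : set V := foldr (fun v W => addline W v) W s.

Lemma addline_subspace W v : linear_subspace W -> linear_subspace (addline W v).
Proof.
move=> sW; apply/subspP; split=> [|a _ _ [w [c [Ww ->]]] [w' [c' [Ww' ->]]]].
  by exists 0, 0; split; [exact: subsp0|rewrite scale0r addr0].
exists (a *: w + w'), (a * c + c'); split; first exact: subspZD.
by rewrite scalerDr addrACA scalerA -scalerDl.
Qed.

Lemma addspan_subspace W s : linear_subspace W -> linear_subspace (addspan W s).
Proof. by move=> sW; elim: s => //= v s; exact: addline_subspace. Qed.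

Lemma addspanS W W' s : W `<=` W' -> addspan W s `<=` addspan W' s.
Proof. by move=> WW'; elim: s => //= v s IH x [w [c [/IH Ww ->]]]; exists w, c. Qed.

Lemma addspan_sub W X s : linear_subspace X -> W `<=` X -> (forall v, v \in s -> X v) ->
  addspan W s `<=` X.
Proof.
move=> sX WX; elim: s => //= v s IH sub x [w [c [/IH Ww ->]]]; apply: subspD => //.
  by apply: Ww => u us; apply: sub; rewrite inE us orbT.
by apply: subspZ => //; apply: sub; rewrite inE eqxx.
Qed.

Lemma sub_addspan W s : W `<=` addspan W s.
Proof.
elim: s => //= v s IH x /IH Wx; exists x, 0; split => //.
by rewrite scale0r addr0.
Qed.

Lemma mem_addspan W s v : linear_subspace W -> v \in s -> addspan W s v.
Proof.
move=> sW; elim: s => //= u s IH; rewrite inE => /predU1P[->|/IH sv].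
  by exists 0, 1; rewrite scale1r add0r; split => //; exact: (subsp0 (addspan_subspace s sW)).
  by exists v, 0; split; rewrite ?scale0r ?addr0.
Qed.

(** If [v] is outside [W], its distance [d0] to [W] is positive and [|c| d0 <= N (w + c v)]. Hence
    the coefficients of a convergent family converge, and so do the components in [W]. *)
Lemma addline_nclosed (N : V -> R) W v :
  (forall x y, N (x + y) <= N x + N y) -> (forall (a : R[i]) x, N (a *: x) = rn a * N x) ->
  linear_subspace W -> nclosed N W -> nclosed N (addline W v).
Proof.
move=> ND NZ sW cW.
have N0 x : 0 <= N x.
  have N00 : N 0 = 0 by rewrite -(scale0r (0 : V)) NZ rn0 mul0r.
  have NN : N (- x) = N x by rewrite -scaleN1r NZ rnN rn1 mul1r.
  by have := ND x (- x); rewrite subrr N00 NN; lra.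
have [Wv|nWv] := pselect (W v).
  have -> // : addline W v = W.
  apply/seteqP; split=> [_ [w [c [Ww ->]]]|w Ww];
  last by exists w, 0; split; rewrite ?scale0r ?addr0.
  by apply: subspD => //; exact: subspZ.
have [d0 d00 Hd0] : exists2 d : R, 0 < d & forall w, W w -> d <= N (w - v).
  apply: contrapT => nd; apply: nWv; apply: cW => e e0; apply: contrapT => nw.
  apply: nd; exists e => // w Ww; rewrite leNgt; apply/negP => h.
  by apply: nw; exists w.
have low w c : W w -> rn c * d0 <= N (w + c *: v).
  move=> Ww; have [->|c0] := eqVneq c 0; first by rewrite rn0 mul0r N0.
  have -> : w + c *: v = - c *: (- c^-1 *: w - v).
    by rewrite scalerBr scalerA mulrNN divff// scale1r scaleNr opprK.
  by rewrite NZ rnN ler_wpM2l ?rn_ge0// Hd0//; exact: subspZ.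
move=> x H.
have ex n : exists wc : V * R[i], W wc.1 /\ N (wc.1 + wc.2 *: v - x) < n.+1%:R^-1.
  have [|_ [w [c [Ww ->]]] h] := H n.+1%:R^-1; first by rewrite invr_gt0 ltr0n.
  by exists (w, c).
have [wc Hwc] := choice ex.
have harm d : 0 < d -> exists N, forall n, (N <= n)%N -> n.+1%:R^-1 < d :> R.
  move=> d1; exists (Num.truncn d^-1) => n Nn.
  rewrite -ltf_pV2 ?posrE ?invr_gt0// invrK.
  apply: lt_le_trans (truncnS_gt _) _; by rewrite ler_nat ltnS.
have NN y : N (- y) = N y by rewrite -scaleN1r NZ rnN rn1 mul1r.
have [|c Hc] := @complex_cauchy (fun n => (wc n).2).
  move=> e e0; have [|M HM] := harm (e * d0 / 2); first by rewrite divr_gt0// mulr_gt0.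
  exists M => m n /HM hm /HM hn; rewrite -(ltr_pM2r d00).
  have [Wm dm] := Hwc m; have [Wn dn] := Hwc n.
  apply: le_lt_trans (low _ _ (subspB sW Wm Wn)) _.
  have -> : (wc m).1 - (wc n).1 + ((wc m).2 - (wc n).2) *: v =
    ((wc m).1 + (wc m).2 *: v - x) + - ((wc n).1 + (wc n).2 *: v - x).
    by rewrite opprB [RHS]addrA subrK scalerBl opprD [RHS]addrACA.
  apply: le_lt_trans (ND _ _) _; rewrite NN [ltRHS]splitr; apply: ltrD.
    exact: lt_trans dm hm.
  exact: lt_trans dn hn.
exists (x - c *: v), c; split; last by rewrite subrK.
apply: cW => e e0.
have q0 : 0 < 2 * (N v + 1) by rewrite mulr_gt0// ltr_wpDl.
have [|M HM] := Hc (e / (2 * (N v + 1))); first by rewrite divr_gt0.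
have [|M' HM'] := harm (e / 2); first by rewrite divr_gt0.
pose n := maxn M M'; exists (wc n).1; first exact: (Hwc n).1.
have h1 := HM n (leq_maxl _ _); have h2 := HM' n (leq_maxr _ _).
have -> : (wc n).1 - (x - c *: v) = ((wc n).1 + (wc n).2 *: v - x) + (c - (wc n).2) *: v.
  rewrite scalerBl opprB [_ + _ *: v - x]addrAC -[RHS]addrA.
  by rewrite [X in _ = _ + X]addrC subrK addrA addrAC.
apply: le_lt_trans (ND _ _) _; rewrite NZ rnB.
have [_ h3] := Hwc n.
have h4 : rn ((wc n).2 - c) * (2 * (N v + 1)) < e by rewrite -ltr_pdivlMr.
have {h2 h3} h5 := lt_trans h3 h2; have := rn_ge0 ((wc n).2 - c); lra.
Qed.

Lemma addspan_nclosed (N : V -> R) W s :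
  (forall x y, N (x + y) <= N x + N y) -> (forall (a : R[i]) x, N (a *: x) = rn a * N x) ->
  linear_subspace W -> nclosed N W -> nclosed N (addspan W s).
Proof.
move=> ND NZ sW cW; elim: s => //= v s IH; apply: addline_nclosed => //.
exact: addspan_subspace.
Qed.

(** Each linear condition costs at most one dimension. Applied to coordinates of boundary values,
    this is the source of the finite-dimensional extensions in the transfer of closed ranges. *)
Lemma kernel_addspan n (X : set V) (f : 'I_n -> V -> R[i]) : linear_subspace X ->
  (forall i (a : R[i]) x y, X x -> X y -> f i (a *: x + y) = a * f i x + f i y) ->
  exists2 s : seq V, (forall v, v \in s -> X v) &
    X `<=` addspan [set x | X x /\ forall i, f i x = 0] s.
Proof.
elim: n X f => [|n IH] X f sX fl.
  by exists [::] => // x Xx; split => // -[].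
pose X' := [set x | X x /\ f ord0 x = 0].
have f0 : f ord0 0 = 0.
  have := fl ord0 (-1) 0 0 (subsp0 sX) (subsp0 sX).
  by rewrite scaler0 addr0 mulN1r addNr.
have sX' : linear_subspace X'.
  apply/subspP; split=> [|a x y [Xx x0] [Xy y0]]; first by split => //; exact: subsp0.
  by split; [exact: subspZD|rewrite fl// x0 y0 mulr0 addr0].
have [|s sX's H] := IH X' (fun i => f (lift ord0 i)) sX'.
  by move=> i a x y [Xx _] [Xy _]; exact: fl.
have sub : addspan [set x | X' x /\ forall i, f (lift ord0 i) x = 0] s `<=`
    addspan [set x | X x /\ forall i, f i x = 0] s.
  apply: addspanS => x [[Xx x0] xi]; split => // i.
  by have [j ->|->//] := unliftP ord0 i.
have [[v [Xv v0]]|nv] := pselect (exists v, X v /\ f ord0 v != 0).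
  exists (v :: s) => [u|x Xx].
    by rewrite inE => /predU1P[->//|/sX's[]].
  exists (x - (f ord0 x / f ord0 v) *: v), (f ord0 x / f ord0 v); rewrite subrK.
  split => //; apply: sub; apply: H; split.
    by apply: subspB => //; exact: subspZ.
  by rewrite addrC -scaleNr fl// mulNr divfK// addNr.
exists s => [u /sX's[]//|x Xx]; apply: sub; apply: H; split => //.
by apply/eqP; apply: contrapT => /negP fx; apply: nv; exists x.
Qed.

Lemma has_dim_addline W n v : has_dim W n -> ~ W v -> has_dim (addline W v) n.+1.
Proof.
move=> [e [free ->]] nv.
exists (fun i => oapp e v (unlift ord0 i)); split.
  move=> c; rewrite big_ord_recl unlift_none /=.
  under eq_bigr do rewrite liftK /=.
  move=> h; have c0 : c ord0 = 0.
    apply: contrapT => /eqP c0; apply: nv; exists (fun i => - (c ord0)^-1 * c (lift ord0 i)) => //.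
    under eq_bigr do rewrite -scalerA.
    rewrite -scaler_sumr; apply: (scalerI c0).
    rewrite scalerA mulrN divff// scaleN1r; apply/eqP.
    by rewrite eq_sym -addr_eq0 h.
  move: h; rewrite c0 scale0r add0r => /free fc i.
  by have [j ->|->//] := unliftP ord0 i; exact: (fc j).
apply/seteqP; split=> [_ [_ [c [[a _ <-] ->]]]|_ [c _ <-]].
  exists (fun i => oapp a c (unlift ord0 i)) => //.
  rewrite big_ord_recl unlift_none /= addrC; congr (_ + _).
  by apply: eq_bigr => i _; rewrite liftK.
rewrite big_ord_recl unlift_none /= addrC.
exists (\sum_(i < n) c (lift ord0 i) *: e i), (c ord0); split.
  by exists (fun i => c (lift ord0 i)).
by congr (_ + _); apply: eq_bigr => i _; rewrite liftK.
Qed.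

Lemma finite_dim_addspan W s : linear_subspace W -> finite_dim W ->
  finite_dim (addspan W s).
Proof.
move=> sW fW; elim: s => //= v s [n IH].
have [Wv|nWv] := pselect (addspan W s v); last by exists n.+1; exact: has_dim_addline.
exists n; suff -> : addline (addspan W s) v = addspan W s by [].
have sA : linear_subspace (addspan W s) by exact: addspan_subspace.
apply/seteqP; split=> [_ [w [c [Ww ->]]]|w Ww];
  last by exists w, 0; split; rewrite ?scale0r ?addr0.
by apply: subspD => //; exact: subspZ.
Qed.

Lemma has_dim_addspan W n : has_dim W n ->
  exists2 s, (forall v, v \in s -> W v) & W = addspan [set 0] s.
Proof.
move=> [e [_ WE]]; exists (codom e).
  move=> v /codomP[i ->]; rewrite WE; exists (fun j => (j == i)%:R) => //.
  rewrite (bigD1 i)//= eqxx scale1r big1 ?addr0// => j /negbTE ->.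
  by rewrite scale0r.
have s0 : linear_subspace [set (0 : V)].
  by apply/subspP; split=> // a x y -> ->; rewrite scaler0 addr0.
have sA := addspan_subspace (codom e) s0.
apply/seteqP; split=> [|x].
  rewrite WE => _ [c _ <-]; apply: subsp_sum => // i; apply: subspZ => //.
  by apply: mem_addspan => //; exact: codom_f.
suff : addspan [set 0] (codom e) `<=` W by exact.
have sW : linear_subspace W.
  apply/subspP; rewrite WE; split=> [|a _ _ [c _ <-] [c' _ <-]].
    by exists (fun=> 0) => //; rewrite big1// => i _; rewrite scale0r.
  exists (fun i => a * c i + c' i) => //; rewrite scaler_sumr -big_split /=.
  by apply: eq_bigr => i _; rewrite scalerDl scalerA.
apply: addspan_sub => //; first by move=> _ ->; exact: subsp0.
move=> v /codomP[i ->]; rewrite WE; exists (fun j => (j == i)%:R) => //.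
rewrite (bigD1 i)//= eqxx scale1r big1 ?addr0// => j /negbTE ->.
by rewrite scale0r.
Qed.

Lemma finite_dim_subspace W : finite_dim W -> linear_subspace W.
Proof.
move=> [n [e [_ WE]]]; apply/subspP; rewrite WE; split=> [|a _ _ [c _ <-] [c' _ <-]].
  by exists (fun=> 0) => //; rewrite big1// => i _; rewrite scale0r.
exists (fun i => a * c i + c' i) => //; rewrite scaler_sumr -big_split /=.
by apply: eq_bigr => i _; rewrite scalerDl scalerA.
Qed.

Lemma finite_dim0 : finite_dim [set (0 : V)].
Proof.
exists 0%N, (fun=> 0); split; first by move=> c _ [].
apply/seteqP; split=> [_ ->|_ [c _ <-]]; last by rewrite big_ord0.
by exists (fun=> 0) => //; rewrite big_ord0.
Qed.

Lemma set0_subspace : linear_subspace [set (0 : V)].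
Proof. by apply/subspP; split=> // a x y -> ->; rewrite scaler0 addr0. Qed.

End AddLine.

Lemma addspan_image (U V : lmodType R[i]) (f : U -> V) W s :
  (forall (a : R[i]) x y, f (a *: x + y) = a *: f x + f y) ->
  f @` addspan W s = addspan (f @` W) (map f s).
Proof.
move=> fl; elim: s => //= v s IH; rewrite -IH; apply/seteqP; split.
  move=> _ [_ [w [c [Ww ->]]] <-]; exists (f w), c; split; first by exists w.
  by rewrite addrC fl addrC.
move=> _ [_ [c [[w Ww <-] ->]]]; exists (w + c *: v); first by exists w, c.
by rewrite addrC fl addrC.
Qed.

Lemma finite_dim_image (U V : lmodType R[i]) (f : U -> V) W :
  (forall (a : R[i]) x y, f (a *: x + y) = a *: f x + f y) ->
  finite_dim W -> finite_dim (f @` W).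
Proof.
move=> fl [n /has_dim_addspan[s _ ->]]; rewrite addspan_image//.
have f0 : f 0 = 0.
  have := fl 1 0 0; rewrite scaler0 addr0 scale1r => h.
  by apply: (addrI (f 0)); rewrite -h addr0.
rewrite image_set1 f0; apply: finite_dim_addspan; [exact: set0_subspace|exact: finite_dim0].
Qed.

Section Orthonormal.
Context (H : hilbertType R).

Definition orthonormal_family (d : nat) (e : 'I_d -> H) :=
  forall i j, hdot (e i) (e j) = (i == j)%:R :> R[i].

Lemma gram_schmidt (s : seq H) : exists d (e : 'I_d -> H), orthonormal_family e /\
  (forall x, addspan [set 0] s x <-> x = \sum_i hdot x (e i) *: e i).
Proof.
elim: s => [|v s [d [e [oe He]]]].
  exists 0%N, (fun=> 0); split; first by case.
  by move=> x; rewrite big_ord0.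
pose p := \sum_i hdot v (e i) *: e i; pose w := v - p.
have we j : hdot w (e j) = 0.
  rewrite hdotBl /p hdot_suml (bigD1 j)//= big1 ?addr0 => [|i ij].
    by rewrite hdotZl oe eqxx mulr1 subrr.
  by rewrite hdotZl oe (negbTE ij) mulr0.
have ew j : hdot (e j) w = 0 by rewrite hdotC we conjC0.
have pS : addspan [set 0] s p.
  apply/He; apply: eq_bigr => j _; congr (_ *: _).
  by apply/eqP; rewrite -subr_eq0 -hdotBl; apply/eqP; exact: we.
have sA : linear_subspace (addspan [set 0] s) by apply: addspan_subspace; exact: set0_subspace.
have [w0|w0] := eqVneq w 0.
  exists d, e; split => // x; rewrite -He /=; split; last by exists x, 0; split; rewrite ?scale0r ?addr0.
  move=> [y [c [yS ->]]]; apply: subspD => //; apply: subspZ => //.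
  by have -> : v = p by apply/eqP; rewrite -subr_eq0 -/w w0.
have rw := rn_gt0 w0.
pose u := ((rn w)^-1)%:C%C *: w.
have uu : hdot u u = 1 :> R[i].
  rewrite hdotZl hdotZr hdotxx conj_real -!rmorphM /=.
  by rewrite (_ : _ * _ = 1 :> R)//; field; rewrite gt_eqF.
exists d.+1, (fun i => oapp e u (unlift ord0 i)); split.
  move=> i j; have [i' ->|->] := unliftP ord0 i; have [j' ->|->] := unliftP ord0 j.
  - by rewrite /= oe (inj_eq lift_inj).
  - by rewrite /= hdotZr ew mulr0.
  - by rewrite /= hdotZl we mulr0.
  by rewrite /= uu.
move=> x; rewrite big_ord_recl unlift_none /=.
under eq_bigr do rewrite liftK /=.
have wu : w = (rn w)%:C%C *: u.
  by rewrite /u scalerA -rmorphM /= divff ?scale1r// gt_eqF.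
have sB : linear_subspace (addspan [set 0] (v :: s)).
  by apply: addspan_subspace; exact: set0_subspace.
have inS : addspan [set 0] s `<=` addspan [set 0] (v :: s).
  by move=> y yS; exists y, 0; split; rewrite ?scale0r ?addr0.
have eS j : addspan [set 0] s (e j).
  apply/He; rewrite (bigD1 j)//= oe eqxx scale1r big1 ?addr0// => i ij.
  by rewrite oe eq_sym (negbTE ij) scale0r.
split=> [[y [c [yS ->]]]|->]; last first.
  apply: subspD => //; last by apply: subsp_sum => // i; apply: subspZ => //; apply: inS.
  apply: subspZ => //; rewrite /u; apply: subspZ => //; rewrite /w.
  apply: subspB => //; last exact: inS.
  exists 0, 1; rewrite scale1r add0r; split => //; exact: (subsp0 sA).
have vE : v = p + (rn w)%:C%C *: u by rewrite -wu /w addrC subrK.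
have qS : addspan [set 0] s (y + c *: p) by apply: subspD => //; exact: subspZ.
set q := y + c *: p in qS.
have -> : y + c *: v = q + (c * (rn w)%:C%C) *: u.
  by rewrite /q {1}vE scalerDr addrA scalerA.
have qu : hdot q u = 0 :> R[i].
  rewrite ((He q).1 qS) hdot_suml big1// => i _.
  by rewrite hdotZl /u hdotZr ew !mulr0.
have ue j : hdot u (e j) = 0 :> R[i] by rewrite /u hdotZl we mulr0.
clearbody u q.
rewrite hdotDl qu hdotZl uu mulr1 add0r addrC; congr (_ + _).
rewrite {1}((He q).1 qS); apply: eq_bigr => i _.
by rewrite hdotDl hdotZl ue mulr0 add0r.
Qed.

End Orthonormal.

End FiniteSpans.

(** * Boundary triplets *)

Lemma hdot_ext (R : realType) (V : hilbertType R) (x y : V) :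
  (forall z, hdot x z = hdot y z) -> x = y.
Proof.
move=> xy; apply/eqP; rewrite -subr_eq0; apply/eqP/hdotxx_eq0.
by rewrite hdotBl xy subrr.
Qed.

(* A linear identity between vectors of a Hilbert space is checked on inner
   products, where it becomes a polynomial identity. *)
Ltac vring := apply: hdot_ext => ?;
  rewrite ?(hdotDl, hdotNl, hdotZl, hdot0l); ring.

Section BoundaryTriplet.
Context (R : realType) (h H : hilbertType R) (A : set (h * h)).
Context (G0 G1 : h * h -> H).
Hypotheses (sA : linear_subspace A) (cA : nclosed (@rn2 R h) A).
Hypotheses (symA : symmetric_rel A) (bt : boundary_triplet A G0 G1).

(** Project [f' - 'i f] on the closed range of [A - 'i]: the part in the range comes from an element
    of [A], the orthogonal part [e] is a defect vector at [- 'i], and what remains is a defect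
    vector at ['i]. *)
Lemma von_neumann p : adjoint A p -> exists a x y,
  [/\ A a, adjoint A (x, 'i *: x), adjoint A (y, - 'i *: y) &
      p = a + ((x, 'i *: x) + (y, - 'i *: y))].
Proof.
case: p => f f' Ap.
have i0 : ip ('i : R[i]) != 0 by rewrite ip_i oner_eq0.
have [r [u Au] oe] := projection (ran_shift_subspace 'i sA)
  (ran_shift_closed sA symA cA i0) (f' - 'i *: f).
set e := _ - r in oe.
have Ae : adjoint A (e, - 'i *: e).
  move=> [v v'] Av /=; apply/eqP; rewrite -subr_eq0; apply/eqP.
  have -> : hdot v' e - hdot v (- 'i *: e) = hdot (v' - 'i *: v) e.
    by rewrite hdotBl hdotZl hdotZr rmorphN /= conjCi opprK.
  by apply: (orth_sym oe); exists v; rewrite addrC subrK.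
have sAs := adjoint_subspace A.
(* The adjoint minus ['i] sends [y] to [- 2 'i y]; the factor ['i / 2] makes this equal to [e]. *)
pose y := ('i / 2) *: e.
have Ay : adjoint A (y, - 'i *: y).
  have := subspZ sAs ('i / 2) Ae; congr (adjoint A _); congr pair.
  by rewrite /y /= !scalerA mulrC.
have Aa : adjoint A (u, 'i *: u + r) by exact: symA.
have := subspB sAs (subspB sAs Ap Aa) Ay.
set x := f - u - y.
have e2 : e = - 'i *: y - 'i *: y.
  have ii : 'i * 'i = -1 :> R[i] by rewrite -expr2 sqrCi.
  have -> : - 'i *: y - 'i *: y = (- ('i * 'i)) *: e.
    apply: hdot_ext => z; rewrite /y hdotDl hdotNl !hdotZl.
    by field.
  by rewrite ii opprK scale1r.
clearbody y.
have -> : (f, f') - (u, 'i *: u + r) - (y, - 'i *: y) = (x, 'i *: x) :> h * h.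
  congr pair; rewrite /= /x.
  have -> : f' = e + r + 'i *: f by rewrite /e subrK subrK.
  by rewrite e2; vring.
move=> Ax; exists (u, 'i *: u + r), x, y; split => //.
congr pair => /=; rewrite /x; first by vring.
have -> : f' = e + r + 'i *: f by rewrite /e subrK subrK.
by rewrite e2; vring.
Qed.

Lemma boundary_form p q : adjoint A p -> adjoint A q ->
  hdot p.2 q.1 - hdot p.1 q.2 = hdot (G1 p) (G0 q) - hdot (G0 p) (G1 q).
Proof. by case: bt => _ _ _; exact. Qed.

Lemma boundary_surj x y : exists2 p, adjoint A p & G0 p = x /\ G1 p = y.
Proof.
case: bt => _ _ sur _; have : [set: H * H] (x, y) by [].
by rewrite -sur => -[p Ap [<- <-]]; exists p.
Qed.

Lemma boundary_lin0 (a : R[i]) p q : adjoint A p -> adjoint A q ->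
  G0 (a *: p + q) = a *: G0 p + G0 q.
Proof. by case: bt => l0 _ _ _; exact: l0. Qed.

Lemma boundary_lin1 (a : R[i]) p q : adjoint A p -> adjoint A q ->
  G1 (a *: p + q) = a *: G1 p + G1 q.
Proof. by case: bt => _ l1 _ _; exact: l1. Qed.

(** On [A] the left side of Green's identity vanishes for every [q], and by surjectivity [q] can be
    given boundary values that isolate [G1 a] or [G0 a]. *)
Lemma boundary_vanish a : A a -> G0 a = 0 /\ G1 a = 0.
Proof.
move=> Aa; have Asa := symA Aa.
have z q : adjoint A q -> hdot (G1 a) (G0 q) - hdot (G0 a) (G1 q) = 0.
  by move=> Aq; rewrite -boundary_form// (Aq _ Aa) subrr.
have [q Aq [q0 q1]] := boundary_surj (G1 a) 0.
have [q' Aq' [q0' q1']] := boundary_surj 0 (G0 a).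
split; apply: hdotxx_eq0.
  by have := z _ Aq'; rewrite q0' q1' hdot0r sub0r => /eqP; rewrite oppr_eq0 => /eqP.
by have := z _ Aq; rewrite q0 q1 hdot0r subr0.
Qed.

(** Decompose [p] by [von_neumann]. As its boundary values are zero, Green's identity against the
    defect vectors [x] and [y] gives [2 'i |x|^2 = 0] and [2 'i |y|^2 = 0]. *)
Lemma boundary_kernel p : adjoint A p -> G0 p = 0 -> G1 p = 0 -> A p.
Proof.
move=> Ap p0 p1; have [a [x [y [Aa Ax Ay pE]]]] := von_neumann Ap.
have z q : adjoint A q -> hdot (x + y) q.2 = hdot ('i *: x + - 'i *: y) q.1.
  move=> Aq; have := boundary_form Ap Aq; rewrite p0 p1 !hdot0l subrr pE /=.
  rewrite !hdotDl -(Aq _ Aa) => /eqP; rewrite subr_eq0 => /eqP e.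
  exact/esym/(addrI _ e).
have i2 : (2 * 'i : R[i]) != 0 by rewrite mulf_neq0 ?pnatr_eq0 ?neq0Ci.
have x0 : x = 0.
  apply: hdotxx_eq0; apply: (mulfI i2); rewrite mulr0.
  have := z _ Ax; rewrite /= !hdotDl !hdotZl !hdotZr conjCi => h'.
  rewrite -[RHS](subrr ('i * hdot x x + - 'i * hdot y x)) -{2}h'; ring.
have y0 : y = 0.
  apply: hdotxx_eq0; apply: (mulfI i2); rewrite mulr0.
  have := z _ Ay; rewrite /= !hdotDl !hdotZl !hdotZr rmorphN /= conjCi => h'.
  rewrite -[RHS](subrr ('i * hdot x y + - 'i * hdot y y)) -{1}h'; ring.
have -> // : p = a.
by rewrite pE x0 y0 !scaler0; case: (a) => a1 a2; congr pair; rewrite /= !addr0.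
Qed.

(** [G0] is onto [H] and vanishes on [A], so by [von_neumann] its values on the two defect spaces
    span [H]. *)
Lemma boundary_space_finite n : deficiency_indices A n n ->
  exists s : seq H, forall x, addspan [set 0] s x.
Proof.
move=> [dp dm].
have gen (l : R[i]) : has_dim (rel_ker (rel_shift (adjoint A) l)) n ->
    exists s : seq H, forall x, adjoint A (x, l *: x) -> addspan [set 0] s (G0 (x, l *: x)).
  move=> /has_dim_addspan[s sN]; rewrite ker_shiftE => NE.
  exists [seq G0 (x, l *: x) | x <- s] => x Ax.
  have : addspan [set 0] s x by rewrite -NE.
  have s0 := set0_subspace H.
  have sA' : linear_subspace (addspan [set 0] [seq G0 (x, l *: x) | x <- s]).
    exact: addspan_subspace.
  have G00 : G0 (0, l *: 0) = 0.
    by rewrite scaler0; exact: (boundary_vanish (subsp0 sA)).1.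
  have sub : addspan [set 0] s `<=` [set x | adjoint A (x, l *: x) /\
      addspan [set 0] [seq G0 (x, l *: x) | x <- s] (G0 (x, l *: x))].
    apply: addspan_sub.
    - apply/subspP; split=> [|c u v [Au Su] [Av Sv]] /=.
        rewrite G00 scaler0; split; [exact: (subsp0 (adjoint_subspace A))|exact: (subsp0 sA')].
      have e : (c *: u + v, l *: (c *: u + v)) = c *: (u, l *: u) + (v, l *: v).
        by congr pair => /=; vring.
      rewrite e; split; first exact: (subspZD (adjoint_subspace A)).
      by rewrite boundary_lin0//; exact: (subspZD sA').
    - move=> _ ->; rewrite /= G00 scaler0; split; [exact: (subsp0 (adjoint_subspace A))|exact: (subsp0 sA')].
    move=> v vs; split; first by have := sN v vs; rewrite ker_shiftE.
    by apply: mem_addspan => //; apply: map_f.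
  by move=> /sub[].
have [|s1 S1] := gen 'i; first by apply: dp; rewrite im_gt0 ip_i ltr01.
have [|s2 S2] := gen (- 'i); first by apply: dm; rewrite im_lt0 ipN ip_i oppr_lt0 ltr01.
exists (s1 ++ s2) => z; have [p Ap [<- _]] := boundary_surj z 0.
have [a [x [y [Aa Ax Ay ->]]]] := von_neumann Ap.
have cat (u v : seq H) : addspan [set 0] (u ++ v) = addspan (addspan [set 0] v) u.
  by rewrite /addspan foldr_cat.
have sS : linear_subspace (addspan [set 0] (s1 ++ s2)).
  by apply: addspan_subspace; exact: set0_subspace.
have sAs := adjoint_subspace A.
have GD p' q : adjoint A p' -> adjoint A q -> G0 (p' + q) = G0 p' + G0 q.
  by move=> Ap' Aq; have := boundary_lin0 1 Ap' Aq; rewrite !scale1r.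
have Axy : adjoint A ((x, 'i *: x) + (y, - 'i *: y)) by exact: (subspD sAs).
rewrite GD//; last exact: symA.
rewrite GD// (boundary_vanish Aa).1 add0r; apply: subspD => //.
  rewrite cat; apply: addspanS (S1 _ Ax) => _ ->.
  exact: (subsp0 (addspan_subspace s2 (set0_subspace H))).
by rewrite cat; apply: sub_addspan; exact: S2.
Qed.

End BoundaryTriplet.

(** * Continuity up to the real axis *)

Section PointwiseContinuity.
Context (R : realType).

Definition ccont (f : R[i] -> R[i]) (z : R[i]) := forall k : R, 0 < k ->
  exists2 d : R, 0 < d & forall w, rn (w - z) < d -> rn (f w - f z) < k.

Lemma ccontM f g z : ccont f z -> ccont g z -> ccont (fun w => f w * g w) z.
Proof.
move=> cf cg k k0.
pose q := rn (f z) + rn (g z) + 1.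
have q0 : 0 < q by rewrite ltr_wpDl// addr_ge0 ?rn_ge0.
pose k1 := Num.min 1 (k / q).
have k10 : 0 < k1 by rewrite lt_min ltr01 divr_gt0.
have [d d0 Hf] := cf k1 k10; have [d' d'0 Hg] := cg k1 k10.
exists (Num.min d d'); first by rewrite lt_min d0.
move=> w; rewrite lt_min => /andP[/Hf hf /Hg hg].
have -> : f w * g w - f z * g z = (f w - f z) * (g w - g z) + (f z * (g w - g z) + (f w - f z) * g z).
  by ring.
have t1 := rnD ((f w - f z) * (g w - g z)) (f z * (g w - g z) + (f w - f z) * g z).
have t2 := rnD (f z * (g w - g z)) ((f w - f z) * g z).
rewrite !rnM in t1 t2.
have a0 := rn_ge0 (f w - f z); have b0 := rn_ge0 (g w - g z).
have k11 : k1 <= 1 by rewrite ge_min lexx.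
have k1q : k1 * q <= k by rewrite -ler_pdivlMr// ge_min lexx orbT.
have h1 : rn (f w - f z) * rn (g w - g z) < k1.
  apply: (@le_lt_trans _ _ (rn (f w - f z))) => //.
  rewrite -[leRHS]mulr1 ler_wpM2l//; lra.
have h2 : rn (f z) * rn (g w - g z) <= rn (f z) * k1 by rewrite ler_wpM2l ?rn_ge0// ltW.
have h3 : rn (f w - f z) * rn (g z) <= k1 * rn (g z) by rewrite ler_wpM2r ?rn_ge0// ltW.
rewrite /q in k1q; lra.
Qed.

Lemma ccont_invX (a z : R[i]) m : a != z -> ccont (fun w => ((w - a) ^+ m)^-1) z.
Proof.
move=> az; elim: m => [|m IH].
  by move=> k k0; exists 1 => // w _; rewrite !expr0 subrr rn0.
have c1 : ccont (fun w => (w - a)^-1) z.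
  move=> k /(jet2_continuous (jet2_inv az))[d d0 H]; exists d => // w /H.
  have inv x : (x - a)^-1 = - (a - x)^-1 by rewrite -invrN opprB.
  by rewrite (addrC z) subrK !inv -opprD rnN.
have -> : (fun w => ((w - a) ^+ m.+1)^-1) = (fun w => (w - a)^-1 * ((w - a) ^+ m)^-1).
  by apply/funext => w; rewrite exprS invfM.
exact: ccontM.
Qed.

(** Compactness of [[a, b]] makes the height [d] uniform in [s]. *)
Lemma near_real_uniform (f : R[i] -> R[i]) (a b k : R) : 0 < k ->
  (forall s : R, a <= s <= b -> ccont f s%:C%C /\ ip (f s%:C%C) = 0) ->
  exists2 d : R, 0 < d & forall e s : R, 0 < e -> e < d -> a <= s <= b ->
    ip (f (Complex s e)) <= k.
Proof.
move=> k0 H.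
have := (compact_near_coveringP `[a, b]%classic).1 (@segment_compact R a b).
move=> /(_ R 0^'+ (fun e s => ip (f (Complex s e)) <= k) _) cov.
have {cov}[|d /= d0 Hd] := cov _.
  move=> s; rewrite /= in_itv /= => /H[cs s0].
  have [d d0 Hd] := cs k k0.
  exists ([set x | `|s - x| < d / 2], [set e | 0 < e < d / 2]) => /=.
    split; first by apply: nbhsx_ballx; rewrite divr_gt0.
    exists (d / 2); first by rewrite /= divr_gt0.
    by move=> e /=; rewrite sub0r normrN => ed e0; rewrite e0 (le_lt_trans (ler_norm _) ed).
  move=> [x e] /= [sx /andP[e0 ed]].
  have : rn (Complex x e - s%:C%C) < d.
    apply: le_lt_trans (rn_triangle x%:C%C _ _) _; rewrite rn_ver gtr0_norm//.
    by rewrite -rmorphB rn_real distrC; lra.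
  move=> /Hd h; have := le_lt_trans (rn_ge_ip _) h; rewrite ipD ipN s0 subr0 ltr_norml.
  by move=> /andP[_ /ltW].
exists d => // e s e0 ed sab; apply: (Hd e) => //=.
  by rewrite sub0r normrN gtr0_norm.
Qed.

End PointwiseContinuity.

Section MatrixOperatorsMore.
Context (R : realType) (H : hilbertType R) (d : nat) (e : 'I_d -> H).

Lemma mxopZ (a : 'I_d -> 'I_d -> R[i]) (c : R[i]) x :
  c *: mxop e a x = mxop e (fun i j => c * a i j) x.
Proof.
rewrite /mxop scaler_sumr; apply: eq_bigr => i _; rewrite scalerA mulr_sumr.
by congr (_ *: _); apply: eq_bigr => j _; rewrite mulrCA.
Qed.

Lemma hdot_mxop (a : 'I_d -> 'I_d -> R[i]) x i : orthonormal_family e ->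
  hdot (mxop e a x) (e i) = \sum_j hdot x (e j) * a i j.
Proof.
move=> oe; rewrite hdot_suml (bigD1 i)//= hdotZl oe eqxx mulr1 [X in _ + X]big1 ?addr0// => j ji.
by rewrite hdotZl oe (negbTE ji) mulr0.
Qed.

End MatrixOperatorsMore.

(** * The coupling of an exit space extension *)

Section HilbertClosure.
Context (R : realType) (V : hilbertType R).

Definition eclosure (Y : set V) : set V :=
  [set x | forall e : R, 0 < e -> exists2 y, Y y & rn (y - x) < e].

Lemma eclosure_closed Y : closed (eclosure Y).
Proof.
apply/closedrnP => x H e e0.
have [|y Yy yx] := H (e / 2); first by rewrite divr_gt0.
have [|z Yz zy] := Yy (e / 2); first by rewrite divr_gt0.
by exists z => //; apply: le_lt_trans (rn_triangle y _ _) _; lra.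
Qed.

Lemma eclosure_subspace Y : linear_subspace Y -> linear_subspace (eclosure Y).
Proof.
move=> sY; apply/subspP; split=> [e e0|a x y cx cy e e0].
  by exists 0; [exact: subsp0|rewrite subr0 rn0].
pose k := rn a + 1; have k0 : 0 < k by rewrite ltr_wpDl ?rn_ge0.
have [|x' Yx xx] := cx (e / (2 * k)); first by rewrite divr_gt0// mulr_gt0.
have [|y' Yy yy] := cy (e / 2); first by rewrite divr_gt0.
exists (a *: x' + y'); first exact: subspZD.
have -> : a *: x' + y' - (a *: x + y) = a *: (x' - x) + (y' - y) by vring.
apply: le_lt_trans (rnD _ _) _; rewrite rnZ.
have h : rn (x' - x) * (2 * k) < e by rewrite -ltr_pdivlMr// mulr_gt0.
rewrite /k in h; have := rn_ge0 (x' - x); lra.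
Qed.

Lemma dense_of_orth (W Y : set V) : linear_subspace W -> closed W -> linear_subspace Y ->
  Y `<=` W -> (forall x, W x -> orth Y x -> x = 0) -> W `<=` eclosure Y.
Proof.
move=> sW cW sY YW H w Ww.
have [p cp op] := projection (eclosure_subspace sY) (@eclosure_closed Y) w.
have Wp : W p by apply: ((closedrnP W).1 cW) => e /cp[y /YW Wy yp]; exists y.
suff /eqP : w - p = 0 by rewrite subr_eq0 => /eqP ->.
apply: H; first exact: subspB.
move=> y Yy; apply: op => e e0; exists y => //; by rewrite subrr rn0.
Qed.

(** Split [f' - 'i f = g + g'] along [N]. The solution [w] of [(T - 'i) w = g] lies in [N], and
    symmetry against the solutions of [(T + 'i) w' = v] with [v] in [N] shows that [f - w] is
    orthogonal to [N]. *)
Lemma reduces_of_resolvent (T : set (V * V)) (N : set V) : sarel setT T ->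
  linear_subspace N -> closed N ->
  (forall (l : R[i]) v, ip l != 0 -> N v -> exists2 w, N w & T (w, l *: w + v)) ->
  reduces N T.
Proof.
move=> sa sN cN HN; apply/seteqP; split; last first.
  by move=> _ [p [Tp _] [q [Tq _] <-]]; exact: (subspD (sa_lin sa)).
have i0 : ip ('i : R[i]) != 0 by rewrite ip_i oner_eq0.
have j0 : ip (- 'i : R[i]) != 0 by rewrite ipN ip_i oppr_eq0 oner_eq0.
move=> [f f'] Tf; have [g Ng og] := projection sN cN (f' - 'i *: f).
set g' := _ - g in og.
have f'E : f' = 'i *: f + g + g' by rewrite /g'; vring.
clearbody g'.
have [w Nw Tw] := HN _ _ i0 Ng.
have Td := subspB (sa_lin sa) Tf Tw.
have dE : (f, f') - (w, 'i *: w + g) = (f - w, 'i *: (f - w) + g').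
  by congr pair; rewrite /= f'E; vring.
rewrite dE in Td.
have of' : orth N (f - w).
  move: (f - w) Td => d Td v Nv; have [w' Nw' Tw'] := HN _ _ j0 Nv.
  have /= := sa_sym sa Td Tw'.
  rewrite hdotDl hdotDr !hdotZl hdotZr conjCi (orth_sym og Nw') => e.
  by rewrite hdotC (addrI _ e) conjC0.
exists (w, 'i *: w + g).
  by split => //; split => //=; apply: (subspZD sN).
exists (f - w, 'i *: (f - w) + g').
  by split => //; split => //=; apply: (subspZD (orth_subspace N)).
by rewrite -dE; congr pair; rewrite /= addrC subrK.
Qed.

End HilbertClosure.

(** * Closed ranges of extensions and restrictions *)

Section ClosedRangeTransfer.
Context (R : realType) (V : hilbertType R).

(** The range is a linear image of the relation, so the extension adds only finitely many dimensions
    to a closed subspace. *)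
Lemma ran_addspan_closed (T : set (V * V)) (s : seq (V * V)) (l : R[i]) :
  linear_subspace T -> closed (ran_shift T l) -> closed (ran_shift (addspan T s) l).
Proof.
move=> sT cT; pose f (p : V * V) := p.2 - l *: p.1.
have fE (T' : set (V * V)) : ran_shift T' l = f @` T'.
  apply/seteqP; split=> [y [u Tu]|_ [[u u'] Tu <-]].
    by exists (u, l *: u + y) => //; rewrite /f /= addrAC subrr add0r.
  by exists u; rewrite /f /= addrC subrK.
rewrite fE addspan_image; last by move=> a [x x'] [y y']; rewrite /f /=; vring.
rewrite -fE; apply/closedrnP; apply: addspan_nclosed.
- exact: rnD.
- exact: rnZ.
- exact: ran_shift_subspace.
exact/closedrnP.
Qed.

(* Within [addspan T1 (kernel of T2 - l)], which is closed, the solutions are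
   chosen with the bound available for [T2]. *)
Lemma ran_sub_closed (T1 T2 : set (V * V)) (l : R[i]) (C : R) :
  linear_subspace T1 -> nclosed (@rn2 R V) T1 -> T1 `<=` T2 -> linear_subspace T2 ->
  closed (ran_shift T2 l) -> 0 <= C ->
  (forall y, ran_shift T2 l y -> exists2 u, T2 (u, l *: u + y) & rn u <= C * rn y) ->
  finite_dim [set u | T2 (u, l *: u)] ->
  closed (ran_shift T1 l).
Proof.
move=> sT1 cT1 T12 sT2 cR C0 HC [n /has_dim_addspan[s sk kE]].
pose D : set (V * V) := [set q | T1 (q.1, l *: q.1 + q.2)].
have sD : linear_subspace D.
  apply/subspP; split=> [|a [x x'] [y y'] Tx Ty].
    rewrite /D /= scaler0 addr0; exact: (subsp0 sT1).
  have := subspZD sT1 a Tx Ty; rewrite /D /=; congr T1; congr pair => /=; vring.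
have rn0' (x : V) : 0 <= rn x := rn_ge0 x.
have cD : nclosed (@rn2 R V) D.
  move=> [x y] Hx; apply: cT1 => e e0.
  pose k := 1 + rn l; have k0 : 0 < k by rewrite ltr_wpDr ?rn_ge0.
  have [|[w z] Dw] := Hx (e / k); first by rewrite divr_gt0.
  rewrite ltr_pdivlMr// /rn2 /= => h.
  exists (w, l *: w + z) => //; rewrite /rn2 /=.
  have -> : l *: w + z - (l *: x + y) = l *: (w - x) + (z - y) by vring.
  have := rnD (l *: (w - x)) (z - y); rewrite rnZ.
  have p := mulr_ge0 (rn_ge0 l) (rn_ge0 (z - y)); rewrite /k in h; lra.
pose D' := addspan D [seq (k, 0) | k <- s].
have cD' : nclosed (@rn2 R V) D'.
  apply: addspan_nclosed => //.
    move=> x y; rewrite /rn2 /=; have := rnD x.1 y.1; have := rnD x.2 y.2; lra.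
  by move=> a x; rewrite /rn2 /= !rnZ mulrDr.
have sD' : linear_subspace D' by exact: addspan_subspace.
have D'k k : T2 (k, l *: k) -> D' (k, 0).
  move=> Tk; have : addspan [set 0] s k by rewrite -kE.
  have : addspan [set 0] s `<=` [set k | D' (k, 0)].
    apply: addspan_sub; [|by move=> _ ->; exact: (subsp0 sD')|].
      apply/subspP; split=> [|a x y Dx Dy]; first exact: (subsp0 sD').
      by have := subspZD sD' a Dx Dy; congr D'; congr pair; rewrite /= scaler0 addr0.
    by move=> v vs; apply: mem_addspan => //; apply/mapP; exists v.
  by move=> sub /sub.
have D'R : D' `<=` [set q | ran_shift T1 l q.2].
  apply: addspan_sub; [|by move=> [u y] Du; exists u|].
    have sR := ran_shift_subspace l sT1.
    by apply/subspP; split=> [|a x y Rx Ry]; [exact: (subsp0 sR)|exact: (subspZD sR)].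
  by move=> _ /mapP[k _ ->] /=; apply: subsp0; exact: ran_shift_subspace.
apply/closedrnP => y Hy.
have [w Tw] : ran_shift T2 l y.
  apply: ((closedrnP _).1 cR) => e /Hy[z [u Tu] zy]; exists z => //.
  by exists u; exact: T12.
suff : D' (w, y) by move=> /D'R.
apply: cD' => e e0.
have C1 : 0 < C + 1 by rewrite ltr_wpDl.
have [|z [u Tu] zy] := Hy (e / (C + 1)); first by rewrite divr_gt0.
rewrite ltr_pdivlMr// in zy.
(* Correct [w] by a small solution [d] for the remaining error: [w - d] and [u] then solve the same
   equation in [T2] and differ by an element of the kernel that was added to [D]. *)
have [d Td dC] : exists2 d, T2 (d, l *: d + (y - z)) & rn d <= C * rn (y - z).
  apply: HC; exists (w - u); have := subspB sT2 Tw (T12 _ Tu).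
  congr T2; congr pair => /=; vring.
exists (w - d, z); last first.
  rewrite /rn2 /=; have -> : w - d - w = - d by vring.
  rewrite rnN; rewrite (rnB y) in dC; lra.
have Dk : D' (w - d - u, 0).
  apply: D'k; have := subspB sT2 (subspB sT2 Tw Td) (T12 _ Tu).
  congr T2; congr pair => /=; vring.
have Du : D' (u, z) by apply: sub_addspan.
have := subspD sD' Dk Du; congr D'; congr pair => /=; rewrite ?add0r// subrK//.
Qed.

Lemma regular_bounded (W : set V) (T : set (V * V)) (t : R) : sarel W T ->
  closed (ran_shift T t%:C%C) -> exists2 C : R, 0 <= C &
  forall y, ran_shift T t%:C%C y ->
    exists2 u, T (u, t%:C%C *: u + y) & rn u <= C * rn y.
Proof.
move=> sa cR; have [r [C [r0 C0 [ex bd]]]] := regular_real sa cR.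
have tr : rn (t%:C%C - t%:C%C : R[i]) < r by rewrite subrr rn0.
by exists C => // y Ry; have [u Yu Tu] := ex _ _ tr Ry; exists u => //; exact: (bd t%:C%C).
Qed.

End ClosedRangeTransfer.

Section Coupling.
Context (R : realType) (h H ht : hilbertType R) (A : set (h * h)).
Context (G0 G1 : h * h -> H) (tau : R[i] -> set (H * H)).
Context (J : {linear h -> ht}) (At : set (ht * ht)) (sH : seq H).
Hypotheses (sA : linear_subspace A) (cA : nclosed (@rn2 R h) A).
Hypotheses (symA : symmetric_rel A) (bt : boundary_triplet A G0 G1).
Hypothesis Hfin : forall x, addspan [set 0] sH x.
Hypothesis tau_lin : forall l, 'Im l != 0 -> linear_subspace (tau l).
Hypothesis tau_adj : forall l, 'Im l != 0 -> adjoint (tau l) = tau l^*.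
Hypotheses (iJ : isometric J) (ext : extension_for J A G0 G1 tau At).

Definition exit_space : set ht := orth (range J).
Local Notation W := exit_space.

Lemma exit_space_subspace : linear_subspace W. Proof. exact: orth_subspace. Qed.
Lemma exit_space_closed : closed W. Proof. exact: orth_closed. Qed.

Lemma At_sarel : sarel setT At.
Proof. by case: ext => -[? _ _] _; exact: selfadjoint_sarel. Qed.

Lemma At_lin : linear_subspace At. Proof. exact: sa_lin At_sarel. Qed.

Lemma At_A p : A p -> At (J p.1, J p.2).
Proof. by move=> Ap; case: ext => -[_ s _] _; apply: s; exists p. Qed.

Lemma hdot_J_exit x w : W w -> hdot (J x) w = 0.
Proof. by move=> Ww; apply: (orth_sym Ww); exists x. Qed.
Lemma hdot_exit_J x w : W w -> hdot w (J x) = 0.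
Proof. by move=> Ww; apply: Ww; exists x. Qed.

Lemma rn_isometric x : rn (J x) = rn x.
Proof.
apply/eqP; rewrite -(@eqrXn2 _ 2)// ?rn_ge0//; apply/eqP.
by rewrite !rn_sqrE iJ.
Qed.

Lemma J_eq0 x : J x = 0 -> x = 0.
Proof. by move=> x0; apply: rn_eq0; rewrite -rn_isometric x0 rn0. Qed.

Lemma hdot_split x y w v : W w -> W v -> hdot (J x + w) (J y + v) = hdot x y + hdot w v.
Proof. by move=> Ww Wv; rewrite !hdotDl !hdotDr iJ hdot_J_exit// hdot_exit_J// addr0 add0r. Qed.

Lemma J_lincomb x y (l : R[i]) : J (y - l *: x) = J y - l *: J x.
Proof. by rewrite linearB; congr (_ - _); rewrite linearZ. Qed.

Lemma rangeJ_subspace : linear_subspace (range J).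
Proof.
apply/subspP; split=> [|a _ _ [x _ <-] [y _ <-]]; first by exists 0; rewrite ?linear0.
by exists (a *: x + y); rewrite ?linearP.
Qed.

Lemma rangeJ_closed : closed (range J).
Proof.
apply/closedrnP => x Hx.
have ex s : exists u, 0 < s -> rn (J u - x) < s.
  have [/Hx[_ [u _ <-] ux]|s0] := ltP 0 s; [by exists u|by exists 0].
have [u Hu] := choice ex.
have [|l Hl] := @cauchy0P _ h u.
  move=> e e0; exists (e / 2); first by rewrite divr_gt0.
  move=> s t s0 sd t0 td; rewrite -rn_isometric linearB.
  have := rn_triangle x (J (u s)) (J (u t)); rewrite (rnB x).
  have := Hu s s0; have := Hu t t0; lra.
exists l => //; apply/eqP; rewrite -subr_eq0; apply/eqP/rn_eq0/eqP; rewrite eq_le rn_ge0 andbT.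
apply/ler_addgt0Pr => e e0; rewrite add0r.
have [|d d0 Hd] := Hl (e / 2); first by rewrite divr_gt0.
pose s := Num.min (d / 2) (e / 2).
have s0 : 0 < s by rewrite lt_min !divr_gt0.
have s1 : s <= d / 2 by rewrite ge_min lexx.
have s2 : s <= e / 2 by rewrite ge_min lexx orbT.
have sd : s < d by lra.
have := rn_triangle (J (u s)) (J l) x; rewrite -linearB rn_isometric (rnB l).
have := Hu s s0; have := Hd s s0 sd; lra.
Qed.

Lemma exit_decomp a : exists x w, W w /\ a = J x + w.
Proof.
have [_ [x _ <-] ow] := projection rangeJ_subspace rangeJ_closed a.
by exists x, (a - J x); split => //; rewrite addrC subrK.
Qed.

(** An element of [At] split along [J h + W]. By [coupled_adjoint] its inner component [p] always
    lies in the adjoint of [A], hence has boundary values. *)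
Definition coupled (p : h * h) (w w' : ht) :=
  [/\ adjoint A p, W w, W w' & At (J p.1 + w, J p.2 + w')].

Lemma coupled_adjoint p w w' : W w -> W w' -> At (J p.1 + w, J p.2 + w') -> coupled p w w'.
Proof.
move=> Ww Ww' Ap; split => // q Aq; have /= := sa_sym At_sarel Ap (At_A Aq).
by rewrite !hdotDr !iJ !hdot_J_exit// !addr0.
Qed.

Lemma coupled_ex a a' : At (a, a') -> exists p w w',
  [/\ coupled p w w', a = J p.1 + w & a' = J p.2 + w'].
Proof.
have [x [w [Ww ->]]] := exit_decomp a; have [x' [w' [Ww' ->]]] := exit_decomp a'.
by move=> Aa; exists (x, x'), w, w'; split => //; exact: coupled_adjoint.
Qed.

Lemma coupledZD a p q w w' v v' : coupled p w w' -> coupled q v v' ->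
  coupled (a *: p + q) (a *: w + v) (a *: w' + v').
Proof.
move=> [Ap Ww Ww' Aw] [Aq Wv Wv' Av]; split.
- exact: (subspZD (adjoint_subspace A)).
- exact: (subspZD exit_space_subspace).
- exact: (subspZD exit_space_subspace).
have := subspZD At_lin a Aw Av; congr At; congr pair.
  by rewrite /= linearP; vring.
by rewrite /= linearP; vring.
Qed.

Lemma coupledB p q w w' v v' : coupled p w w' -> coupled q v v' ->
  coupled (p - q) (w - v) (w' - v').
Proof.
move=> cp cq; have := coupledZD (-1) cq cp.
by rewrite !scaleN1r ![- _ + _]addrC.
Qed.

Lemma coupled_A p : A p -> coupled p 0 0.
Proof.
move=> Ap; apply: coupled_adjoint; rewrite ?addr0; [exact: (subsp0 exit_space_subspace)|exact: (subsp0 exit_space_subspace)|].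
exact: At_A.
Qed.

(** Since [At] is symmetric, the boundary forms of the inner and of the exit components cancel; the
    boundary values of [p] thus act as boundary values of the exit component. *)
Lemma coupled_green p q w w' v v' : coupled p w w' -> coupled q v v' ->
  hdot (G1 p) (G0 q) - hdot (G0 p) (G1 q) + (hdot w' v - hdot w v') = 0.
Proof.
move=> [Ap Ww Ww' Aw] [Aq Wv Wv' Av]; rewrite -(boundary_form bt)//.
have /= := sa_sym At_sarel Av Aw; rewrite !hdot_split// => e.
by rewrite addrACA e -opprD subrr.
Qed.

Lemma boundary0_0 : G0 0 = 0. Proof. exact: (boundary_vanish symA bt (subsp0 sA)).1. Qed.
Lemma boundary1_0 : G1 0 = 0. Proof. exact: (boundary_vanish symA bt (subsp0 sA)).2. Qed.

Lemma boundary0_sub p q : adjoint A p -> adjoint A q -> G0 (p - q) = G0 p - G0 q.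
Proof.
move=> Ap Aq; have := boundary_lin0 bt (-1) Aq Ap.
by rewrite !scaleN1r ![- _ + _]addrC.
Qed.
Lemma boundary1_sub p q : adjoint A p -> adjoint A q -> G1 (p - q) = G1 p - G1 q.
Proof.
move=> Ap Aq; have := boundary_lin1 bt (-1) Aq Ap.
by rewrite !scaleN1r ![- _ + _]addrC.
Qed.

(** The resolvent formula linking [At] with [tau], read on solutions: applied to a vector of [J h],
    the resolvent of [At] has an exit component [w] with [w' = l w], and an inner component obeying
    the boundary condition given by [- tau l]. The formula enters the proof only here. *)
Lemma tauP l p : ip l != 0 -> adjoint A p ->
  tau l (G0 p, - G1 p) <-> exists w, coupled p w (l *: w).
Proof.
rewrite -im_neq0 => l0 Ap; have E := ext.2 l l0.
have -> : tau l (G0 p, - G1 p) = extension_of A G0 G1 (rel_opp (tau l)) p.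
  apply/propext; split=> [t|[_ [[a b] t [/= <- <-]]]]; last by rewrite opprK.
  by split => //; exists (G0 p, - G1 p) => //=; rewrite opprK.
have -> : extension_of A G0 G1 (rel_opp (tau l)) p =
    rel_inv (rel_shift (extension_of A G0 G1 (rel_opp (tau l))) l) (p.2 - l *: p.1, p.1).
  apply/propext; split=> [e|[_ [q Eq <-] [/= e1 e2]]].
    by exists (p.1, p.2 - l *: p.1) => //; exists p.
  have -> // : p = q.
  case: p q Eq e1 e2 {Ap} => [a b] [a' b'] _ /= e1 e2; rewrite e2 in e1.
  by rewrite e2 (addIr _ e1).
rewrite -E; split=> [[u [_ [[x x'] Ax <-] [/= e1 e2]] ou]|[w [_ Ww Wlw Aw]]].
  exists (u - J p.1); apply: coupled_adjoint => //; first exact: (subspZ exit_space_subspace).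
  rewrite addrC subrK.
  have -> : J p.2 + l *: (u - J p.1) = J (p.2 - l *: p.1) + l *: u.
    by rewrite J_lincomb; vring.
  by rewrite -e1 -e2 subrK.
exists (J p.1 + w); last by rewrite /= addrAC subrr add0r.
exists (J p.1 + w, J (p.2 - l *: p.1)) => //=.
exists (J p.1 + w, J p.2 + l *: w) => //=; congr pair.
by rewrite J_lincomb; vring.
Qed.

Lemma tau_ex l x y : ip l != 0 -> tau l (x, y) ->
  exists p w, [/\ coupled p w (l *: w), G0 p = x & G1 p = - y].
Proof.
move=> l0 t; have [p Ap [p0 p1]] := boundary_surj bt x (- y).
have [w cp] : exists w, coupled p w (l *: w) by apply/(tauP l0 Ap); rewrite p0 p1 opprK.
by exists p, w.
Qed.

(* The boundary condition [G0 = 0] on the inner component leaves a self-adjoint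
   relation in the exit space, whose Weyl function is [tau]. *)
Definition inner_rel : set (ht * ht) :=
  [set q | exists p, coupled p q.1 q.2 /\ G0 p = 0].
Local Notation T := inner_rel.

(** The multivalued part of [tau], described through [At] without any point [l]; [inner_mulE]
    therefore shows its independence of [l]. *)
Definition inner_mul : set H := [set k | exists p, [/\ coupled p 0 0, G0 p = 0 & G1 p = k]].
Local Notation K := inner_mul.

Lemma inner_lin : linear_subspace T.
Proof.
apply/subspP; split=> [|a [w w'] [v v'] [p [cp p0]] [q [cq q0]]].
  by exists 0; split; [exact: (coupled_A (subsp0 sA))|exact: boundary0_0].
exists (a *: p + q); split; first exact: coupledZD.
by case: cp cq => Ap _ _ _ [Aq _ _ _]; rewrite (boundary_lin0 bt)// p0 q0 scaler0 addr0.
Qed.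

Lemma inner_sym : symmetric_rel T.
Proof.
move=> [w w'] [p [cp p0]] [v v'] [q [cq q0]] /=.
have /= := coupled_green cq cp; rewrite p0 q0 hdot0r hdot0l subrr add0r => /eqP.
by rewrite subr_eq0 => /eqP.
Qed.

(** If [G0 p = 0], the exit component is an eigenvector of the symmetric relation [T] at a non-real
    point, hence zero, and [p] alone gives an element of [At]. *)
Lemma inner_mulE l : ip l != 0 -> K = rel_mul (tau l).
Proof.
move=> l0; apply/seteqP; split=> [_ [p [cp p0 <-]]|k /(tau_ex l0)[p [w [cp p0 p1]]]].
  rewrite /rel_mul /= -p0 -[G1 p]opprK.
  have cN : coupled (- p) 0 (l *: 0).
    have := coupledB (coupled_A (subsp0 sA)) cp; by rewrite sub0r subr0 scaler0.
  have AN : adjoint A (- p) by case: cN.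
  have Ap : adjoint A p by case: cp.
  have A0 : adjoint A 0 by exact: (subsp0 (adjoint_subspace A)).
  have e0 : G0 (- p) = G0 p by rewrite -sub0r boundary0_sub// boundary0_0 p0 subr0.
  have e1 : G1 (- p) = - G1 p by rewrite -sub0r boundary1_sub// boundary1_0 sub0r.
  by rewrite -e0 -e1; apply/(tauP l0 AN); exists 0.
have w0 : w = 0.
  have Tw : T (w, l *: w + 0) by exists p; rewrite addr0.
  have := symmetric_bound inner_sym Tw; rewrite rn0 pmulr_rle0 ?normr_gt0// => w0.
  by apply: rn_eq0; apply/eqP; rewrite eq_le w0 rn_ge0.
rewrite w0 scaler0 in cp.
exists (- p); split.
- by have := coupledB (coupled_A (subsp0 sA)) cp; rewrite sub0r subr0.
- case: cp => Ap _ _ _; rewrite -sub0r boundary0_sub//; last exact: (subsp0 (adjoint_subspace A)).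
  by rewrite boundary0_0 p0 subr0.
case: cp => Ap _ _ _; rewrite -sub0r boundary1_sub//; last exact: (subsp0 (adjoint_subspace A)).
by rewrite boundary1_0 p1 sub0r opprK.
Qed.

Lemma fin_closed (X : set H) : linear_subspace X -> closed X /\
  exists s, X = addspan [set 0] s.
Proof.
move=> sX; have [d [e [oe He]]] := gram_schmidt sH.
have [|s sX' Xs] := @kernel_addspan _ _ d X (fun i x => hdot x (e i)) sX.
  by move=> i a x y _ _; rewrite hdotDl hdotZl.
have XE : X = addspan [set 0] s.
  apply/seteqP; split.
    move=> x /Xs; apply: addspanS => y [_ y0]; rewrite ((He y).1 (Hfin y)).
    by rewrite big1// => i _; rewrite y0 scale0r.
  apply: addspan_sub => // _ ->; exact: (subsp0 sX).
split; last by exists s.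
apply/closedrnP; rewrite XE; apply: addspan_nclosed.
- exact: rnD.
- exact: rnZ.
- exact: set0_subspace.
move=> x hx; apply: rn_eq0; apply/eqP; rewrite eq_le rn_ge0 andbT.
by apply/ler_addgt0Pr => r /hx[_ -> ]; rewrite sub0r rnN add0r => /ltW.
Qed.

Definition tau_dom l : set H := [set x | exists y, tau l (x, y)].

(** At the conjugate point [tau] is the adjoint of [tau l], and the multivalued part of an adjoint
    is the orthogonal complement of the domain. *)
Lemma inner_mul_orth l : ip l != 0 -> K = orth (tau_dom l).
Proof.
move=> l0; have l0' : ip l^* != 0 by rewrite ip_conj oppr_eq0.
rewrite (inner_mulE l0') /rel_mul -tau_adj ?im_neq0//.
apply/seteqP; split=> [k Ak x [y txy]|k ok [x y] txy /=].
  by have /= := Ak _ txy; rewrite hdot0r => e; rewrite hdotC -e conjC0.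
by rewrite hdot0r (orth_sym ok)//; exists y.
Qed.

Lemma tau_domE l : ip l != 0 -> tau_dom l = orth K.
Proof.
move=> l0; have sD : linear_subspace (tau_dom l).
  have tl := tau_lin (etrans (im_neq0 l) l0).
  apply/subspP; split=> [|a x y [x' tx] [y' ty]]; first by exists 0; exact: (subsp0 tl).
  by exists (a *: x' + y'); exact: (subspZD tl a tx ty).
by rewrite (inner_mul_orth l0) orthorth//; exact: (fin_closed sD).1.
Qed.

Lemma inner_mul_orthorth : orth (orth K) = K.
Proof.
have i0 : ip ('i : R[i]) != 0 by rewrite ip_i oner_eq0.
by rewrite (inner_mul_orth i0) orthK.
Qed.

Lemma coupled_dom l x : ip l != 0 -> orth K x ->
  exists p w, coupled p w (l *: w) /\ G0 p = x.
Proof.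
move=> l0; rewrite -(tau_domE l0) => -[y /(tau_ex l0)[p [w [cp p0 _]]]].
by exists p, w.
Qed.

(** To solve [(T - l) x = v], solve it in [At] first. The inner component [q] then satisfies
    [q.2 = l q.1], and [G0 q] is orthogonal to [K], so a homogeneous solution with the same value of
    [G0] exists and is subtracted. *)
Lemma inner_sarel : sarel W T.
Proof.
split; [exact: exit_space_subspace|exact: exit_space_closed|exact: inner_lin| |exact: inner_sym|].
  by move=> w w' [p [[_ Ww Ww' _] _]].
move=> l l0 v Wv; have [a Aa] := sa_ran At_sarel l0 (I : [set: ht] v).
have [q [w [w' [cq aE a'E]]]] := coupled_ex Aa.
have [Aq Ww Ww' _] := cq.
have w'E : J q.2 = l *: J q.1 /\ w' = l *: w + v.
  have e : J (q.2 - l *: q.1) = l *: w + v - w'.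
    rewrite J_lincomb.
    have -> : J q.2 = l *: (J q.1 + w) + v - w' by rewrite -aE a'E addrK.
    by vring.
  have Wd : W (l *: w + v - w') by apply: (subspB exit_space_subspace) => //; exact: (subspZD exit_space_subspace).
  have e0 : J (q.2 - l *: q.1) = 0 by apply: hdotxx_eq0; rewrite {1}e hdot_exit_J.
  split; last by apply/eqP; rewrite eq_sym -subr_eq0 -e e0.
  by move/eqP: e0; rewrite J_lincomb subr_eq0 => /eqP.
have [q2 w2] := w'E.
have oG : orth K (G0 q).
  move=> k [p [cp p0 p1]]; have := coupled_green cq cp.
  rewrite p0 p1 hdot0r !hdot0r subr0 addr0 sub0r => /eqP.
  by rewrite oppr_eq0 => /eqP.
have [p [u [cp p0]]] := coupled_dom l0 oG.
exists (w - u); exists (q - p); have cd := coupledB cq cp.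
split; last by case: cp => Ap _ _ _; rewrite boundary0_sub// p0 subrr.
by rewrite /= w2 in cd *; have -> : l *: (w - u) + v = l *: w + v - l *: u by vring.
Qed.


(** * Consequences of minimality: injectivity and density *)

Section Minimality.

Lemma exit_minimal N : linear_subspace N -> closed N -> N `<=` W ->
  (forall (l : R[i]) v, ip l != 0 -> N v -> exists2 w, N w & At (w, l *: w + v)) ->
  forall v, N v -> v = 0.
Proof.
move=> sN cN NW HN v Nv; case: ext => -[_ _ min] _.
have N0 : N = [set 0] by apply: min => //; exact: (reduces_of_resolvent At_sarel).
by rewrite N0 in Nv.
Qed.

(** The eigenvectors of [At] at [t] inside [W] form a closed subspace on which the resolvents act as
    scalars [(t - l)^-1]; it reduces [At], hence is zero. *)
Lemma exit_kernel (t : R) u : W u -> At (u, t%:C%C *: u) -> u = 0.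
Proof.
move=> Wu Au; apply: (@exit_minimal [set u | W u /\ At (u, t%:C%C *: u)]) => //.
- apply/subspP; split=> [|a x y [Wx Ax] [Wy Ay]].
    by split; [exact: (subsp0 exit_space_subspace)|rewrite scaler0; exact: (subsp0 At_lin)].
  split; first exact: (subspZD exit_space_subspace).
  have := subspZD At_lin a Ax Ay; congr At; congr pair; rewrite /=; vring.
- apply/closedrnP => x Hx; split.
    by apply: ((closedrnP W).1 exit_space_closed) => e /Hx[w [Ww _] wx]; exists w.
  apply: (sa_nclosed At_sarel) => e e0.
  pose k := 1 + rn (t%:C%C : R[i]); have k0 : 0 < k by rewrite ltr_wpDr ?rn_ge0.
  have [|w [_ Aw] wx] := Hx (e / k); first by rewrite divr_gt0.
  exists (w, t%:C%C *: w) => //; rewrite /rn2 /= -scalerBr rnZ.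
  rewrite -[X in X + _]mul1r -mulrDl mulrC -ltr_pdivlMr//.
- by move=> x [].
move=> l v l0 [Wv Av]; have tl : t%:C%C - l != 0.
  by rewrite subr_eq0; apply: contraNneq l0 => <-.
exists ((t%:C%C - l)^-1 *: v).
  split; first exact: (subspZ exit_space_subspace).
  have := subspZ At_lin (t%:C%C - l)^-1 Av; congr At; congr pair.
  by rewrite /= !scalerA mulrC.
have := subspZ At_lin (t%:C%C - l)^-1 Av; congr At; congr pair => /=.
by rewrite !scalerA -[v in RHS]scale1r scalerA mulr1 -scalerDl; congr (_ *: v); field.
Qed.

Context (d : nat) (e : 'I_d -> H) (p_ : 'I_d -> h * h) (g_ : 'I_d -> ht).
Hypothesis eK : forall x, (forall i, hdot x (e i) = 0) -> K x.
Hypothesis eO : forall i, orth K (e i).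
Hypothesis pg : forall i, coupled (p_ i) (g_ i) ('i *: g_ i) /\ G0 (p_ i) = e i.
Local Notation res := (res T).

Lemma weyl_vector_exit i : W (g_ i). Proof. by have [[_ ? _ _] _] := pg i. Qed.

(** Exit components of solutions at different points with the same [G0] differ by a multiple of a
    resolvent of [T], so all of them arise from the [g_ i] at the base point ['i]. *)
Lemma weyl l i : ip l != 0 ->
  exists p, coupled p (g_ i + (l - 'i) *: res l (g_ i))
    (l *: (g_ i + (l - 'i) *: res l (g_ i))) /\ G0 p = e i.
Proof.
move=> l0; have [q [cq q0]] := resP inner_sarel l0 (weyl_vector_exit i).
have [cp p0] := pg i.
exists ((l - 'i) *: q + p_ i); split; last first.
  by case: cq cp => Aq _ _ _ [Ap _ _ _]; rewrite (boundary_lin0 bt)// q0 p0 scaler0 add0r.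
have := coupledZD (l - 'i) cq cp; rewrite /=.
congr coupled; first by rewrite addrC.
by vring.
Qed.

(** What [coupled_green] yields between a solution at [l] and the solution [p_ i] at ['i]; the
    factor [l + 'i] is [l] minus the conjugate of ['i]. *)
Definition weyl_entry (l : R[i]) i j : R[i] :=
  - hdot (e j) (G1 (p_ i)) + (l + 'i) * (hdot (g_ j) (g_ i) + (l - 'i) * hdot (res l (g_ j)) (g_ i)).

Lemma weyl_entryP l i j p : coupled p (g_ j + (l - 'i) *: res l (g_ j))
    (l *: (g_ j + (l - 'i) *: res l (g_ j))) -> G0 p = e j ->
  hdot (- G1 p) (e i) = weyl_entry l i j.
Proof.
move=> cp p0; have [ci pi0] := pg i; have := coupled_green cp ci.
rewrite p0 pi0 hdotZl hdotZr conjCi hdotDl hdotZl hdotNl /weyl_entry => h0.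
apply/eqP; rewrite -subr_eq0 -oppr_eq0; apply/eqP; rewrite -h0; ring.
Qed.

(** The smallest resolvent-invariant subspace containing the [g_ i]; written as an intersection, it
    comes with its induction principle. *)
Definition orbit_span : set ht := [set y | forall X : set ht, linear_subspace X ->
  (forall i, X (g_ i)) -> (forall l x, ip l != 0 -> W x -> X x -> X (res l x)) -> X y].
Local Notation Y := orbit_span.

Lemma orbit_span_subspace : linear_subspace Y.
Proof.
apply/subspP; split=> [X sX _ _|a x y Yx Yy X sX Xg Xr]; first exact: subsp0.
by apply: (subspZD sX); [exact: Yx|exact: Yy].
Qed.

Lemma orbit_spanW : Y `<=` W.
Proof.
move=> y; apply; [exact: exit_space_subspace|exact: weyl_vector_exit|].
by move=> l x l0 Wx _; exact: (res_in inner_sarel).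
Qed.

Lemma orbit_span_g i : Y (g_ i). Proof. by move=> X. Qed.

Lemma orbit_span_res l y : ip l != 0 -> Y y -> Y (res l y).
Proof.
move=> l0 Yy X sX Xg Xr.
exact: (Xr l y l0 (orbit_spanW Yy) (Yy X sX Xg Xr)).
Qed.

(** The vectors of [W] orthogonal to [Y] are invariant under the resolvents of [T]. The work is to
    see that on them these are resolvents of [At] as well, after which minimality applies. *)
Lemma orbit_span_dense : W `<=` eclosure Y.
Proof.
apply: dense_of_orth; [exact: exit_space_subspace|exact: exit_space_closed|exact: orbit_span_subspace|exact: orbit_spanW|].
move=> x Wx ox; apply: (@exit_minimal (orth (range J `|` Y))).
- exact: orth_subspace.
- exact: orth_closed.
- by apply: orthS => z Jz; left.
- move=> l v l0 ov.
  have Wv : W v by move=> z Jz; apply: ov; left.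
  have Yv : orth Y v by move=> z Yz; apply: ov; right.
  have l0' : ip l^* != 0 by rewrite ip_conj oppr_eq0.
  have Wr : W (res l v) by exact: (res_in inner_sarel).
  have Yr : orth Y (res l v).
    move=> y Yy; rewrite (res_adj inner_sarel l0 Wv (orbit_spanW Yy)).
    by apply: Yv; exact: orbit_span_res.
  exists (res l v); first by move=> z [Jz|Yz]; [exact: Wr|exact: Yr].
  have [q [/= cq q0]] := resP inner_sarel l0 Wv.
  have [Aq _ _ Aqq] := cq.
  (* Green's identity against the [g_ i] reduces to [(G1 q, e i) = 0], as [v] and its resolvent are
     orthogonal to [Y]. *)
  have : K (G1 q).
    apply: eK => i; have [ci ei] := pg i; have := coupled_green cq ci.
    rewrite q0 ei hdot0l subr0 hdotZr hdotDl hdotZl.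
    by rewrite (Yr _ (orbit_span_g i)) (Yv _ (orbit_span_g i)) !mulr0 addr0 subr0 addr0.
  move=> [p [cp p0 p1]]; have [Ap _ _ App] := cp.
  (* [q - p] has zero boundary values, and [p] by itself belongs to [At]; subtracting both removes
     the whole inner component. *)
  have /At_A : A (q - p).
    apply: (boundary_kernel sA cA symA bt).
    - exact: (subspB (adjoint_subspace A)).
    - by rewrite boundary0_sub// q0 p0 subrr.
    - by rewrite boundary1_sub// p1 subrr.
  rewrite /= => Aqp; have := subspB At_lin Aqq (subspD At_lin Aqp App).
  congr At; congr pair => /=; rewrite addr0 linearB subrK addrAC subrr add0r//.
by move=> z [Jz|Yz]; [exact: Wx|exact: ox].
Qed.

End Minimality.


(** * Kernels and closed ranges of [At], [T] and their common part [S] *)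

Section Transfer.

Definition inner_part (a : ht) : h := xget 0 [set x | W (a - J x)].
Local Notation pj := inner_part.

Lemma inner_partE x w : W w -> pj (J x + w) = x.
Proof.
move=> Ww; rewrite /pj; case: xgetP => [y -> Wy|/(_ x)]; last first.
  by rewrite /= addrAC subrr add0r.
set z := xget _ _ in Wy *; apply/esym/eqP; rewrite -subr_eq0; apply/eqP/J_eq0/hdotxx_eq0.
have Wz : W (J (x - z)).
  have := subspB exit_space_subspace Wy Ww; congr W; rewrite linearB /=; vring.
exact: (hdot_J_exit _ Wz).
Qed.

Lemma inner_partZD a x y : pj (a *: x + y) = a *: pj x + pj y.
Proof.
have [u [w [Ww ->]]] := exit_decomp x; have [v [z [Wz ->]]] := exit_decomp y.
have -> : a *: (J u + w) + (J v + z) = J (a *: u + v) + (a *: w + z).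
  by rewrite linearP; vring.
by rewrite !inner_partE//; exact: (subspZD exit_space_subspace).
Qed.

Definition inner_pair (q : ht * ht) : h * h := (pj q.1, pj q.2).

Lemma inner_pair_coupled q : At q ->
  coupled (inner_pair q) (q.1 - J (pj q.1)) (q.2 - J (pj q.2)).
Proof.
case: q => a a' /coupled_ex[p [w [w' [cp -> ->]]]]; have [_ Ww Ww' _] := cp.
rewrite /inner_pair /= !inner_partE//.
have -> : J p.1 + w - J p.1 = w by vring.
have -> : J p.2 + w' - J p.2 = w' by vring.
by rewrite -surjective_pairing.
Qed.

Definition exit_rel : set (ht * ht) := [set q | [/\ W q.1, W q.2 & At q]].
Local Notation S := exit_rel.

Lemma exit_rel_lin : linear_subspace S.
Proof.
apply/subspP; split=> [|a x y [Wx Wx' Ax] [Wy Wy' Ay]].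
  by split; [exact: (subsp0 exit_space_subspace)|exact: (subsp0 exit_space_subspace)|exact: (subsp0 At_lin)].
by split; [exact: (subspZD exit_space_subspace)|exact: (subspZD exit_space_subspace)|exact: (subspZD At_lin)].
Qed.

Lemma exit_rel_nclosed : nclosed (@rn2 R ht) S.
Proof.
move=> [x y] Hx; have cl := (closedrnP W).1 exit_space_closed; split.
- apply: cl => e /Hx[[w w'] [/= Ww _ _]]; rewrite /rn2 /= => ww.
  by exists w => //; have := rn_ge0 (w' - y); lra.
- apply: cl => e /Hx[[w w'] [/= _ Ww _]]; rewrite /rn2 /= => ww.
  by exists w' => //; have := rn_ge0 (w - x); lra.
by apply: (sa_nclosed At_sarel) => e /Hx[w [_ _ Aw] wx]; exists w.
Qed.

(** [At], [X1], [X2] decrease, each step imposing finitely many conditions. [X2] is [A + S] inside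
    [At], and dropping inner components by [f] maps [X1] onto [T] and [X2] onto [S]. *)
Let X1 : set (ht * ht) := [set q | At q /\ G0 (inner_pair q) = 0].
Let X2 : set (ht * ht) := [set q | X1 q /\ G1 (inner_pair q) = 0].

Let G0_lin a x y : At x -> At y ->
  G0 (inner_pair (a *: x + y)) = a *: G0 (inner_pair x) + G0 (inner_pair y).
Proof.
move=> /inner_pair_coupled[Ax _ _ _] /inner_pair_coupled[Ay _ _ _].
rewrite -(boundary_lin0 bt)//; congr G0.
by congr pair; rewrite /= inner_partZD.
Qed.

Let G1_lin a x y : At x -> At y ->
  G1 (inner_pair (a *: x + y)) = a *: G1 (inner_pair x) + G1 (inner_pair y).
Proof.
move=> /inner_pair_coupled[Ax _ _ _] /inner_pair_coupled[Ay _ _ _].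
rewrite -(boundary_lin1 bt)//; congr G1.
by congr pair; rewrite /= inner_partZD.
Qed.

Let G0_00 : G0 (inner_pair 0) = 0.
Proof.
have := G0_lin (-1) (subsp0 At_lin) (subsp0 At_lin).
by rewrite scaler0 addr0 scaleN1r addNr.
Qed.
Let G1_00 : G1 (inner_pair 0) = 0.
Proof.
have := G1_lin (-1) (subsp0 At_lin) (subsp0 At_lin).
by rewrite scaler0 addr0 scaleN1r addNr.
Qed.

Lemma boundary_addspan (Z : set (ht * ht)) (G : h * h -> H) : linear_subspace Z ->
  (forall (a : R[i]) x y, Z x -> Z y ->
     G (inner_pair (a *: x + y)) = a *: G (inner_pair x) + G (inner_pair y)) ->
  exists s, Z = addspan [set q | Z q /\ G (inner_pair q) = 0] s.
Proof.
move=> sZ Gl; have [d [e [oe He]]] := gram_schmidt sH.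
have [|s sZs Zs] := @kernel_addspan _ _ d Z (fun i q => hdot (G (inner_pair q)) (e i)) sZ.
  by move=> i a x y Zx Zy; rewrite Gl// hdotDl hdotZl.
exists s; apply/seteqP; split.
  move=> q /Zs; apply: addspanS => {}q [Zq q0]; split => //.
  rewrite ((He (G (inner_pair q))).1 (Hfin _)) big1// => i _.
  by rewrite q0 scale0r.
by apply: addspan_sub => // q [].
Qed.

Let X1_lin : linear_subspace X1.
Proof.
apply/subspP; split=> [|a x y [Ax x0] [Ay y0]].
  by split; [exact: (subsp0 At_lin)|exact: G0_00].
by split; [exact: (subspZD At_lin)|rewrite G0_lin// x0 y0 scaler0 addr0].
Qed.

Let X2_lin : linear_subspace X2.
Proof.
apply/subspP; split=> [|a x y [[Ax x0] x1] [[Ay y0] y1]].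
  by split; [exact: (subsp0 X1_lin)|exact: G1_00].
split; first by apply: (subspZD X1_lin).
by rewrite G1_lin// x1 y1 scaler0 addr0.
Qed.

Let X2P q : X2 q <-> exists p w w',
  [/\ A p, S (w, w') & q = (J p.1 + w, J p.2 + w')].
Proof.
split=> [[[Aq q0] q1]|[p [w [w' [Ap [/= Ww Ww' Aw] ->]]]]].
  have [Ap Ww Ww' _] := inner_pair_coupled Aq.
  have A2 := boundary_kernel sA cA symA bt Ap q0 q1.
  exists (inner_pair q), (q.1 - J (pj q.1)), (q.2 - J (pj q.2)); split => //.
    split => //=; have := subspB At_lin Aq (At_A A2).
    by congr At.
  by rewrite /inner_pair /=; case: (q) => a b; congr pair; rewrite addrC subrK.
have pp : inner_pair (J p.1 + w, J p.2 + w') = p.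
  by rewrite /inner_pair /= !inner_partE// -surjective_pairing.
have [v0 v1] := boundary_vanish symA bt Ap.
split; last by rewrite pp.
by split; rewrite ?pp//; exact: (subspD At_lin (At_A Ap) Aw).
Qed.

Let f (q : ht * ht) : ht * ht := (q.1 - J (pj q.1), q.2 - J (pj q.2)).

Let f_lin (a : R[i]) x y : f (a *: x + y) = a *: f x + f y.
Proof. by congr pair; rewrite /= inner_partZD linearP; vring. Qed.

Let f_X1 : f @` X1 = T.
Proof.
apply/seteqP; split=> [_ [q [Aq q0] <-]|[w w'] [p [[/= Ap Ww Ww' Aw] p0]]].
  by exists (inner_pair q); split => //; exact: inner_pair_coupled.
exists (J p.1 + w, J p.2 + w').
  by split => //; rewrite /inner_pair /= !inner_partE// -surjective_pairing.
by rewrite /f /= !inner_partE//; congr pair; rewrite addrAC subrr add0r.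
Qed.

Let f_X2 : f @` X2 = S.
Proof.
apply/seteqP; split=> [_ [q /X2P[p [w [w' [Ap Sw ->]]]] <-]|[w w'] Sw].
  have [/= Ww Ww' _] := Sw.
  by rewrite /f /= !inner_partE// [_ + w]addrC [_ + w']addrC !addrK.
have [/= Ww Ww' Aw] := Sw.
exists (w, w').
  apply/X2P; exists 0, w, w'; split => //; first exact: (subsp0 sA).
  by congr pair; rewrite /= linear0 add0r.
have p0 u : W u -> pj u = 0.
  by move=> Wu; rewrite -[u]add0r -(linear0 J) inner_partE.
by rewrite /f /= !p0// linear0 !subr0.
Qed.

Lemma inner_rel_addspan : exists s, T = addspan S s.
Proof.
have [s sE] := @boundary_addspan X1 G1 X1_lin (fun a x y x1 y1 => G1_lin a x1.1 y1.1).
by exists (map f s); rewrite -f_X1 -f_X2 -(addspan_image _ _ f_lin) -sE.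
Qed.

Lemma exit_sub_inner : S `<=` T.
Proof.
move=> [w w'] [/= Ww Ww' Aw]; exists 0; split; last exact: boundary0_0.
by apply: coupled_adjoint => //=; rewrite linear0 !add0r.
Qed.

Lemma exit_sub_At : S `<=` At.
Proof. by move=> q []. Qed.

Lemma At_addspan : exists s, At = addspan X2 s.
Proof.
have [s1 E1] := @boundary_addspan At G0 At_lin (fun a x y x1 y1 => G0_lin a x1 y1).
have [s2 E2] := @boundary_addspan X1 G1 X1_lin (fun a x y x1 y1 => G1_lin a x1.1 y1.1).
exists (s1 ++ s2); rewrite /addspan foldr_cat -!/(addspan _ _).
by rewrite {1}E1 -[X in addspan X s1]/X1 {1}E2.
Qed.

(** Up to finitely many dimensions, eigenvectors have zero boundary values and come from [A + S];
    since [S - t] is injective, these are eigenvectors of [A]. *)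
Lemma exit_ker_finite (t : R) : finite_dim [set u | A (u, t%:C%C *: u)] ->
  finite_dim [set a | At (a, t%:C%C *: a)].
Proof.
move=> fA.
pose Z : set (ht * ht) := [set q | At q /\ q.2 = t%:C%C *: q.1].
have sZ : linear_subspace Z.
  apply/subspP; split=> [|a x y [Ax x2] [Ay y2]].
    by split; [exact: (subsp0 At_lin)|rewrite /= scaler0].
  by split; [exact: (subspZD At_lin)|rewrite /= x2 y2; vring].
pose Z1 : set (ht * ht) := [set q | Z q /\ G0 (inner_pair q) = 0].
have [s1 E1] := @boundary_addspan Z G0 sZ (fun a x y x1 y1 => G0_lin a x1.1 y1.1).
have sZ1 : linear_subspace Z1.
  apply/subspP; split=> [|a x y [Zx x0] [Zy y0]].
    by split; [exact: (subsp0 sZ)|exact: G0_00].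
  by split; [exact: (subspZD sZ)|rewrite (G0_lin _ Zx.1 Zy.1) x0 y0 scaler0 addr0].
have [s2 E2] := @boundary_addspan Z1 G1 sZ1 (fun a x y x1 y1 => G1_lin a x1.1.1 y1.1.1).
pose Z2 : set (ht * ht) := [set q | Z1 q /\ G1 (inner_pair q) = 0].
have ZE : Z = addspan Z2 (s1 ++ s2).
  by rewrite /addspan foldr_cat -!/(addspan _ _) {1}E1 -[X in addspan X s1]/Z1 {1}E2.
have -> : [set a | At (a, t%:C%C *: a)] = fst @` Z.
  apply/seteqP; split=> [a Aa|_ [[a a'] [Aa /= aE] <-]]; first by exists (a, t%:C%C *: a).
  by rewrite /= -aE.
rewrite ZE addspan_image//.
have -> : fst @` Z2 = J @` [set u | A (u, t%:C%C *: u)].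
  apply/seteqP; split=> [_ [q [[[Aq q2] q0] q1] <-]|_ [u Au <-]].
    have [p [w [w' [Ap [/= Ww Ww' Aw] qE]]]] := (X2P q).1 (conj (conj Aq q0) q1).
    rewrite qE /= in q2 *.
    have e : J (p.2 - t%:C%C *: p.1) = t%:C%C *: w - w'.
      rewrite J_lincomb; have -> : J p.2 = t%:C%C *: (J p.1 + w) - w' by rewrite -q2 addrK.
      by vring.
    have Wd : W (t%:C%C *: w - w') by apply: (subspB exit_space_subspace) => //; exact: (subspZ exit_space_subspace).
    have e0 : J (p.2 - t%:C%C *: p.1) = 0 by apply: hdotxx_eq0; rewrite {1}e hdot_exit_J.
    have w'E : w' = t%:C%C *: w by apply/eqP; rewrite eq_sym -subr_eq0 -e e0.
    have pE : p.2 = t%:C%C *: p.1 by apply/eqP; rewrite -subr_eq0 (J_eq0 e0).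
    rewrite w'E in Aw; rewrite (exit_kernel Ww Aw) addr0; exists p.1 => //=.
    by rewrite -pE -surjective_pairing.
  exists (J u, t%:C%C *: J u) => //.
  have q2 : X2 (J u, t%:C%C *: J u).
    apply/X2P; exists (u, t%:C%C *: u), 0, 0; split => //; first exact: (subsp0 exit_rel_lin).
    by rewrite /= !addr0; congr pair; rewrite linearZ.
  by split; [split; [split|]|]; case: q2 => -[].
have JZD (a : R[i]) x y : J (a *: x + y) = a *: J x + J y by rewrite linearP.
apply: finite_dim_addspan; last exact: (finite_dim_image JZD).
apply: finite_dim_subspace; exact: (finite_dim_image JZD).
Qed.

(** The condition [G1 = 0] cuts [T] down to [S], and [S - t] is injective, so the dimension is at
    most the number of conditions. *)
Lemma inner_ker_finite (t : R) : finite_dim [set w | T (w, t%:C%C *: w)].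
Proof.
pose Z : set (ht * ht) := [set q | X1 q /\ (f q).2 = t%:C%C *: (f q).1].
have sZ : linear_subspace Z.
  have f0 : f 0 = 0 by have := f_lin (-1) 0 0; rewrite scaler0 addr0 scaleN1r addNr.
  apply/subspP; split=> [|a x y [Ax x2] [Ay y2]].
    by split; [exact: (subsp0 X1_lin)|rewrite f0 /= scaler0].
  split; first exact: (subspZD X1_lin).
  rewrite f_lin -[LHS]/(a *: (f x).2 + (f y).2) x2 y2.
  by rewrite -[(_ + _).1]/(a *: (f x).1 + (f y).1); vring.
have [s E] := @boundary_addspan Z G1 sZ (fun a x y x1 y1 => G1_lin a x1.1.1 y1.1.1).
set Z2 := (X in addspan X s) in E.
pose f1 q := (f q).1.
have f1l (a : R[i]) x y : f1 (a *: x + y) = a *: f1 x + f1 y by rewrite /f1 f_lin.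
have -> : [set w | T (w, t%:C%C *: w)] = f1 @` Z.
  rewrite -f_X1; apply/seteqP; split=> [w [q X1q fq]|_ [q [X1q fq] <-]].
    by exists q; [split => //; rewrite fq|rewrite /f1 fq].
  by exists q => //; rewrite /f1 -fq -surjective_pairing.
rewrite E addspan_image//.
have -> : f1 @` Z2 = [set 0].
  apply/seteqP; split=> [_ [q [[X1q fq] q1] <-]|_ ->].
    have [/= Ww Ww' Aw] : S (f q) by rewrite -f_X2; exists q.
    apply: (exit_kernel (t := t)) => //; move: Aw; rewrite [f q]surjective_pairing fq//.
  exists 0; last by have := f1l (-1) 0 0; rewrite scaler0 addr0 scaleN1r addNr.
  split; [exact: (subsp0 sZ)|exact: G1_00].
by apply: finite_dim_addspan; [exact: set0_subspace|exact: finite_dim0].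
Qed.

(** The route is through [S]: closedness descends from [At] to its restriction [S], where the finite
    kernel of [At - t] is used, and ascends from [S] to the finite-dimensional extension [T]. *)
Lemma inner_closed_of_At (t : R) : finite_dim [set a | At (a, t%:C%C *: a)] ->
  closed (ran_shift At t%:C%C) -> closed (ran_shift T t%:C%C).
Proof.
move=> fA cR; have [C C0 HC] := regular_bounded At_sarel cR.
have [s ->] := inner_rel_addspan; apply: ran_addspan_closed; first exact: exit_rel_lin.
exact: (ran_sub_closed exit_rel_lin exit_rel_nclosed exit_sub_At At_lin cR C0 HC fA).
Qed.

Lemma At_closed_of_inner (t : R) : closed (ran_shift A t%:C%C) ->
  closed (ran_shift T t%:C%C) -> closed (ran_shift At t%:C%C).
Proof.
move=> cRA cR; have [C C0 HC] := regular_bounded inner_sarel cR.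
have cS := ran_sub_closed exit_rel_lin exit_rel_nclosed exit_sub_inner inner_lin cR C0 HC
  (inner_ker_finite t).
have [s ->] := At_addspan; apply: ran_addspan_closed; first exact: X2_lin.
(* The range of [X2 - t] is the orthogonal sum of those of [A - t] and [S - t], so it is closed when
   both of them are. *)
have XR y : ran_shift X2 t%:C%C y <-> exists x w, [/\ ran_shift A t%:C%C x,
    ran_shift S t%:C%C w, W w & y = J x + w].
  split=> [[u /X2P[p [w [w' [Ap Sw [uE yE]]]]]]|[x [w [[u Au] [v Sv] Ww ->]]]].
    have [/= Ww Ww' _] := Sw.
    exists (p.2 - t%:C%C *: p.1), (w' - t%:C%C *: w); split.
    - by exists p.1; rewrite addrC subrK -surjective_pairing.
    - by exists w; rewrite addrC subrK.
    - by apply: (subspB exit_space_subspace) => //; exact: (subspZ exit_space_subspace).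
    rewrite J_lincomb; have -> : y = J p.2 + w' - t%:C%C *: u by rewrite -yE addrAC subrr add0r.
    by rewrite uE; vring.
  exists (J u + v); apply/X2P; exists (u, t%:C%C *: u + x), v, (t%:C%C *: v + w).
  split => //; congr pair; rewrite /= linearP; vring.
apply/closedrnP => y Hy; apply/XR; have [x [w [Ww yE]]] := exit_decomp y.
have near e : 0 < e -> exists a b, [/\ ran_shift A t%:C%C a, ran_shift S t%:C%C b,
    rn (a - x) < e & rn (b - w) < e].
  move=> e0; have [_ /XR[a [b [Ra Rb Wb ->]]] ab] := Hy e e0.
  have : rn (J (a - x) + (b - w)) ^+ 2 = rn (a - x) ^+ 2 + rn (b - w) ^+ 2.
    rewrite (@rn_pyth _ _ (J (a - x))); first by rewrite rn_isometric.
    by apply: hdot_J_exit; exact: (subspB exit_space_subspace).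
  have -> : J (a - x) + (b - w) = J a + b - y by rewrite yE linearB /=; vring.
  move=> pyth; have lt2 : rn (J a + b - y) ^+ 2 < e ^+ 2.
    by rewrite ltr_pXn2r ?nnegrE ?rn_ge0 ?(ltW e0).
  have s1 := sqr_ge0 (rn (a - x)); have s2 := sqr_ge0 (rn (b - w)).
  exists a, b; split => //.
    by rewrite -(@ltr_pXn2r _ 2)// ?nnegrE ?rn_ge0 ?(ltW e0)//; lra.
  by rewrite -(@ltr_pXn2r _ 2)// ?nnegrE ?rn_ge0 ?(ltW e0)//; lra.
exists x, w; split => //.
  by apply: ((closedrnP _).1 cRA) => e /near[a [b [Ra _ ax _]]]; exists a.
by apply: ((closedrnP _).1 cS) => e /near[a [b [_ Rb _ bw]]]; exists b.
Qed.

End Transfer.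


(** * The matrix of the Weyl function and the two directions *)

Section Main.

Lemma orthK_basis : exists d (e : 'I_d -> H), orthonormal_family e /\
  (forall x, orth K x <-> x = \sum_i hdot x (e i) *: e i).
Proof.
have [_ [s sE]] := fin_closed (orth_subspace K).
by rewrite sE; exact: gram_schmidt.
Qed.

Context (d : nat) (e : 'I_d -> H).
Hypothesis oe : orthonormal_family e.
Hypothesis He : forall x, orth K x <-> x = \sum_i hdot x (e i) *: e i.

Lemma basis_orth i : orth K (e i).
Proof.
apply/He; rewrite (bigD1 i)//= oe eqxx scale1r big1 ?addr0// => j ij.
by rewrite oe eq_sym (negbTE ij) scale0r.
Qed.

Lemma basis_mul x : (forall i, hdot x (e i) = 0) -> K x.
Proof.
move=> x0; rewrite -inner_mul_orthorth => y /He ->; rewrite hdot_sumr big1// => i _.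
by rewrite hdotZr x0 mulr0.
Qed.

Lemma basis_coupled : exists (p_ : 'I_d -> h * h) (g_ : 'I_d -> ht),
  forall i, coupled (p_ i) (g_ i) ('i *: g_ i) /\ G0 (p_ i) = e i.
Proof.
have i0 : ip ('i : R[i]) != 0 by rewrite ip_i oner_eq0.
have ex i : exists pw : (h * h) * ht, coupled pw.1 pw.2 ('i *: pw.2) /\ G0 pw.1 = e i.
  by have [p [w pw]] := coupled_dom i0 (basis_orth i); exists (p, w).
by have [f Hf] := choice ex; exists (fun i => (f i).1), (fun i => (f i).2).
Qed.

Context (p_ : 'I_d -> h * h) (g_ : 'I_d -> ht).
Hypothesis pg : forall i, coupled (p_ i) (g_ i) ('i *: g_ i) /\ G0 (p_ i) = e i.
Local Notation res := (res T).

Definition weyl_op (l : R[i]) : H -> H := mxop e (weyl_entry e p_ g_ l).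

(** Solutions at [l] with [G0 = e j] combine to an element of [tau l] over [x]. Along the basis its
    coordinates are those of [weyl_op l x], so the two differ by an element of the multivalued part
    [K]. *)
Lemma weyl_op_tau l x : ip l != 0 -> orth K x -> tau l (x, weyl_op l x).
Proof.
move=> l0 Kx; have tl := tau_lin (etrans (im_neq0 l) l0).
have ex j : exists y, tau l (e j, y) /\ forall i, hdot y (e i) = weyl_entry e p_ g_ l i j.
  have [p [cp p0]] := weyl pg j l0; have [Ap _ _ _] := cp.
  exists (- G1 p); split; last by move=> i; exact: (weyl_entryP pg _ cp p0).
  by rewrite -p0; apply/(tauP l0 Ap); eexists; exact: cp.
have [y Hy] := choice ex.
pose z := \sum_j hdot x (e j) *: y j.
have txz : tau l (x, z).
  rewrite {1}((He x).1 Kx) /z; elim/big_rec2: _ => [|j u v _ tuv].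
    exact: (subsp0 tl).
  by exact: (subspZD tl (hdot x (e j)) (Hy j).1 tuv).
have Kd : K (z - weyl_op l x).
  apply: basis_mul => i; rewrite hdotBl hdot_mxop// hdot_suml -sumrB big1// => j _.
  by rewrite hdotZl (Hy j).2 subrr.
rewrite (inner_mulE l0) in Kd; have := subspB tl txz Kd.
by congr (tau l); congr pair; rewrite /= ?subr0// opprB addrC subrK.
Qed.

Lemma weyl_operator_part : operator_part tau K weyl_op.
Proof.
move=> l; rewrite im_neq0 => l0; have tl := tau_lin (etrans (im_neq0 l) l0).
split; first by rewrite (inner_mulE l0).
  by apply: mxop_bounded; [exact: orth_subspace|exact: basis_orth].
apply/seteqP; split=> [[x y] txy|_ [x Kx [k Kk <-]]].
  have Kx : orth K x by rewrite -(tau_domE l0); exists y.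
  exists x => //; exists (y - weyl_op l x); last by rewrite addrC subrK.
  rewrite (inner_mulE l0); have := subspB tl txy (weyl_op_tau l0 Kx).
  by congr (tau l); congr pair; rewrite /= subrr.
rewrite (inner_mulE l0) in Kk; have := subspD tl (weyl_op_tau l0 Kx) Kk.
by congr (tau l); congr pair; rewrite /= addr0.
Qed.

Lemma weyl_meromorphic : (forall t : R, closed (ran_shift T t%:C%C)) ->
  meromorphic (orth K) weyl_op.
Proof.
move=> cT z.
have ex j : exists rkg : R * ht * (R[i] -> ht), 0 < rkg.1.1 /\
  forall l, rn (l - z) < rkg.1.1 -> (forall x, jet1 (fun l => hdot (rkg.2 l) x) l) /\
      (l != z -> res l (g_ j) = (z - l)^-1 *: rkg.1.2 + rkg.2 l).
  have [r [k [g [r0 H']]]] := resolvent_local inner_sarel cT z (weyl_vector_exit pg j).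
  by exists (r, k, g).
have [rkg Hr] := choice ex.
pose r := \big[Num.min/1]_j (rkg j).1.1.
have r0 : 0 < r.
  by apply: (big_ind (fun x : R => 0 < x)) => // [x y x0 y0|j _]; [rewrite lt_min x0|have [] := Hr j].
have rle j : r <= (rkg j).1.1 by exact: bigmin_le_cond.
(* The Weyl entry times [l - z], with [(z - l)^-1 k + g] inserted for the resolvent; the sign of the
   [k] term is [(l - z) / (z - l)]. Poles being at most simple, the exponent 1 serves at every
   [z]. *)
pose b (l : R[i]) i j := (l - z) * (- hdot (e j) (G1 (p_ i))) + (l + 'i) *
  ((l - z) * hdot (g_ j) (g_ i) + (l - 'i) *
   (- hdot (rkg j).1.2 (g_ i) + (l - z) * hdot ((rkg j).2 l) (g_ i))).
exists 1%N, (fun l => mxop e (b l)); split.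
  apply/near_RiP; exists r => // w wr; split.
    by apply: mxop_bounded; [exact: orth_subspace|exact: basis_orth].
  apply: mxop_derivable; [exact: orth_subspace|exact: basis_orth|move=> i j].
  have lin c : jet1 (fun l : R[i] => l + c) w by apply: jet1D; [exact: jet1_id|exact: jet1_cst].
  have cst := @jet1_cst R _ w.
  have jg := ((Hr j).2 w (lt_le_trans wr (rle j))).1 (g_ i).
  rewrite /b; apply: jet1D; first exact: jet1M.
  apply: jet1M => //; apply: jet1D; first exact: jet1M.
  by apply: jet1M => //; apply: jet1D => //; exact: jet1M.
apply/dnear_RiP; exists r => // w wr wz x _.
rewrite expr1 mxopZ; congr (mxop e _ x); apply/funext => i; apply/funext => j.
have := ((Hr j).2 w (lt_le_trans wr (rle j))).2 wz.
rewrite /weyl_entry /b => ->; rewrite hdotDl hdotZl.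
have wz0 : z - w != 0 by rewrite subr_eq0 eq_sym.
by field.
Qed.

(** By Green's identity [Im (f w)] is [Im w |u|^2] for the exit component
    [u = g + (w - 'i) res w g], where [g = g_ j]. Solving for [res w g] transfers the smallness of
    the former to the resolvent. *)
Lemma small_of_real (f : R[i] -> R[i]) j (a b : R) :
  (forall w p, 0 < ip w -> coupled p (g_ j + (w - 'i) *: res w (g_ j))
     (w *: (g_ j + (w - 'i) *: res w (g_ j))) -> G0 p = e j ->
     f w = hdot (- G1 p) (e j)) ->
  (forall s : R, a <= s <= b -> ccont f s%:C%C /\ ip (f s%:C%C) = 0) ->
  small_on T a b (g_ j).
Proof.
(* At heights below [1 / 2] one has [|w - 'i| >= 1 / 2], whence [|res w g|^2 <= 8 (|u|^2 + |g|^2)].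
   After multiplication by the height, the constants 16 in [k1] and [q] leave at most [k / 2] for
   each summand. *)
move=> Hf fr k k0; pose k1 := k / 16.
have k10 : 0 < k1 by rewrite divr_gt0.
have [d1 d10 Hd] := near_real_uniform k10 fr.
pose q := 16 * (rn (g_ j) ^+ 2 + 1).
have q0 : 0 < q by rewrite mulr_gt0// ltr_wpDl ?sqr_ge0.
exists (Num.min d1 (Num.min (1 / 2) (k / q))).
  by rewrite !lt_min d10 !divr_gt0.
move=> c s c0; rewrite !lt_min => /and3P[cd c2 cq] sab.
set w := Complex s c; have w0 : ip w != 0 by rewrite /= gt_eqF.
have [p [cp p0]] := weyl pg j w0.
set u := g_ j + _ in cp.
have ipf : ip (f w) = c * rn u ^+ 2.
  rewrite (Hf _ _ _ cp p0)//; have := coupled_green cp cp.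
  rewrite p0 hdotZl hdotZr hdotxx (hdotC (e j)) hdotNl.
  move=> /(congr1 (@complex.Im R)).
  rewrite !(ipD, ipN, ipM, rpM, rp_conj, ip_conj) /= !mulr0 !add0r; lra.
have hw := Hd c s c0 cd sab; rewrite -/w ipf in hw.
have rE : res w (g_ j) = (w - 'i)^-1 *: (u - g_ j).
  rewrite /u addrAC subrr add0r scalerA mulVf ?scale1r// subr_eq0.
  by apply/eqP => wi; have := congr1 (@complex.Im R) wi; rewrite ip_i /=; lra.
have wi : 1 / 2 <= rn (w - 'i).
  have := rn_ge_ip (w - 'i); rewrite ipD ipN ip_i /= ler0_norm; lra.
have rr : rn (res w (g_ j)) <= 2 * (rn u + rn (g_ j)).
  have wi0 : 0 < rn (w - 'i) by lra.
  rewrite rE rnZ rnV ler_pdivrMl//.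
  have t := rnD u (- g_ j); rewrite rnN in t.
  have := ler_wpM2r (addr_ge0 (rn_ge0 u) (rn_ge0 (g_ j))) wi; lra.
have rr2 : rn (res w (g_ j)) ^+ 2 <= 8 * (rn u ^+ 2 + rn (g_ j) ^+ 2).
  have : rn (res w (g_ j)) ^+ 2 <= (2 * (rn u + rn (g_ j))) ^+ 2.
    by rewrite ler_pXn2r ?nnegrE ?rn_ge0 ?mulr_ge0 ?addr_ge0 ?rn_ge0.
  have := sqr_ge0 (rn u - rn (g_ j)); rewrite sqrrB exprMn sqrrD; lra.
have := ler_wpM2l (ltW c0) rr2.
rewrite ltr_pdivlMr// in cq; rewrite /q in cq; rewrite /k1 in hw.
lra.
Qed.

(** Smallness survives linear combinations and, since resolvents of [T] commute, also resolvents;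
    the induction principle of [orbit_span] does the rest. *)
Lemma small_orbit (a b : R) : (forall j, small_on T a b (g_ j)) ->
  forall y, orbit_span g_ y -> small_on T a b y.
Proof.
move=> Hg y /(_ [set y | W y /\ small_on T a b y]).
have n0 (s c : R) : 0 < c -> ip (Complex s c) != 0 by move=> c0; rewrite /= gt_eqF.
have sa := inner_sarel.
(* A propositional detour that turns the three closure conditions of the specialised hypothesis into
   separate goals. *)
suff X : forall P Q P' : Prop, P -> Q -> P' ->
    (P -> Q -> P' -> W y /\ small_on T a b y) -> small_on T a b y.
  apply: X.
  - apply/subspP; split=> [|c x z [Wx sx] [Wz sz]].
      split; first exact: (subsp0 exit_space_subspace).
      move=> k k0; exists 1 => // c s c0 _ _.
      rewrite -(scale0r (0 : ht)) (resZ sa) ?n0//; last exact: (subsp0 exit_space_subspace).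
      by rewrite scale0r rn0 expr0n mulr0 ltW.
    split; first exact: (subspZD exit_space_subspace).
    move=> k k0; pose q := 4 * (rn c ^+ 2 + 1).
    have q0 : 0 < q by rewrite mulr_gt0// ltr_wpDl ?sqr_ge0.
    have [d1 d10 H1] := sx _ (divr_gt0 k0 q0).
    have k4 : 0 < k / 4 by rewrite divr_gt0.
    have [d2 d20 H2] := sz _ k4.
    exists (Num.min d1 d2); first by rewrite lt_min d10.
    move=> eps s eps0; rewrite lt_min => /andP[e1 e2] sab.
    rewrite (res_lin sa) ?n0//.
    have := H1 _ _ eps0 e1 sab; have := H2 _ _ eps0 e2 sab.
    set X := res _ x; set Z := res _ z => hz hx; rewrite ler_pdivlMr// /q in hx.
    have t : rn (c *: X + Z) ^+ 2 <= 2 * (rn c ^+ 2 * rn X ^+ 2) + 2 * rn Z ^+ 2.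
      have : rn (c *: X + Z) ^+ 2 <= (rn c * rn X + rn Z) ^+ 2.
        rewrite ler_pXn2r ?nnegrE ?rn_ge0 ?addr_ge0 ?mulr_ge0 ?rn_ge0//.
        by rewrite -rnZ rnD.
      have := sqr_ge0 (rn c * rn X - rn Z); rewrite sqrrB sqrrD exprMn; lra.
    have := ler_wpM2l (ltW eps0) t; have := mulr_ge0 (ltW eps0) (sqr_ge0 (rn X)); lra.
  - by move=> i; split; [exact: (weyl_vector_exit pg)|exact: Hg].
  move=> l x l0 Wx [_ sx]; split; first exact: (res_in sa).
  move=> k k0; have l1 : 0 < `|ip l| by rewrite normr_gt0.
  have [|d1 d10 H1] := sx (k * `|ip l| ^+ 2); first by rewrite mulr_gt0 ?exprn_gt0.
  exists d1 => // eps s eps0 ed sab; have := H1 _ _ eps0 ed sab.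
  rewrite (res_comm sa (n0 s _ eps0) l0 Wx); have := res_bound sa l0 (res_in sa (n0 s _ eps0) Wx).
  set X := res (Complex s eps) x; set Z := res l X => hb hk.
  rewrite -(ler_pM2r (exprn_gt0 2 l1)); apply: (le_trans _ hk).
  rewrite -mulrA ler_pM2l// -exprMn ler_pXn2r ?nnegrE ?rn_ge0 ?mulr_ge0 ?rn_ge0//.
  by rewrite mulrC.
by move=> P Q P' p q p' /(_ p q p')[].
Qed.

Lemma meromorphic_closed (F : R[i] -> H -> H) (tau0 : R[i] -> H -> H) :
  operator_part tau K tau0 -> meromorphic (orth K) F ->
  (forall l, 'Im l != 0 -> forall x, orth K x -> F l x = tau0 l x) ->
  forall t : R, closed (ran_shift T t%:C%C).
Proof.
move=> op mer FE t.
have [m [G [/near_RiP[r1 r10 H1] /dnear_RiP[r2 r20 H2]]]] := mer t%:C%C.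
pose r := Num.min r1 r2 / 2.
have r0 : 0 < r by rewrite divr_gt0// lt_min r10.
have rr1 : r < r1 by have : Num.min r1 r2 <= r1 by [rewrite ge_min lexx]; rewrite /r; lra.
have rr2 : r < r2 by have : Num.min r1 r2 <= r2 by [rewrite ge_min lexx orbT]; rewrite /r; lra.
pose f j w := hdot (F w (e j)) (e j).
have fE j w p : ip w != 0 -> coupled p (g_ j + (w - 'i) *: res w (g_ j))
     (w *: (g_ j + (w - 'i) *: res w (g_ j))) -> G0 p = e j ->
     f j w = hdot (- G1 p) (e j).
  move=> w0 cp p0; have [Ap _ _ _] := cp.
  have : tau w (e j, - G1 p) by rewrite -p0; apply/(tauP w0 Ap); eexists; exact: cp.
  have wi : 'Im w != 0 by rewrite im_neq0.
  have [_ _ ->] := op w wi; move=> [x _ [k Kk [-> <-]]].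
  rewrite /f FE//; last exact: basis_orth.
  by rewrite hdotDl (orth_sym (basis_orth j) Kk) addr0.
(* Nevanlinna sign: Green's identity gives [ip (f j w) = ip w * |u|^2] in both half-planes. *)
have fip j w : ip w != 0 -> 0 <= ip w * ip (f j w).
  move=> w0; have [p [cp p0]] := weyl pg j w0; rewrite (fE _ _ _ w0 cp p0).
  have := coupled_green cp cp; set u := g_ j + _.
  rewrite p0 hdotZl hdotZr hdotxx (hdotC (e j)) hdotNl.
  move=> /(congr1 (@complex.Im R)).
  rewrite !(ipD, ipN, ipM, rpM, rp_conj, ip_conj) /= !mulr0 !add0r => E.
  have -> : ip w * - ip (hdot (G1 p) (e j)) = (ip w) ^+ 2 * rn u ^+ 2.
    by rewrite expr2 -mulrA; congr (_ * _); lra.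
  by rewrite mulr_ge0 ?sqr_ge0.
(* Near [t] but away from it, [f j] is a diagonal entry of [G] divided by [(w - t)^m], hence
   continuous at real [s]. Its imaginary part is non-negative above the axis and non-positive below,
   so it vanishes at [s]. *)
have fc j s : `|s - t| <= r -> s != t -> ccont (f j) s%:C%C /\ ip (f j s%:C%C) = 0.
  move=> st snt.
  have stC : (t%:C%C : R[i]) != s%:C%C.
    by apply: contraNneq snt => e'; apply/eqP; have := congr1 (@complex.Re R) e'.
  have str : rn (s%:C%C - t%:C%C : R[i]) <= r by rewrite -rmorphB rn_real.
  have cG : ccont (fun w => hdot (G w (e j)) (e j)) s%:C%C.
    (* Differentiability in the operator norm, with error constant 1, gives a Lipschitz estimate at
       [s]. *)
    have [|_ [D [_ _ [M HM]] /(_ 1 ltr01)/near_RiP[d1 d10 HD]]] := H1 s%:C%C.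
      exact: le_lt_trans str rr1.
    move=> k k0; pose B := (rn (D (e j)) + rn (e j)) * rn (e j) + 1.
    have B0 : 0 < B by rewrite ltr_wpDl// mulr_ge0 ?addr_ge0 ?rn_ge0.
    exists (Num.min d1 (k / B)); first by rewrite lt_min d10 divr_gt0.
    move=> w; rewrite lt_min => /andP[/HD/(_ _ (basis_orth j)) hD wB].
    rewrite mul1r !normrnE -rmorphM lecR in hD.
    rewrite -hdotBl; apply: le_lt_trans (cauchy_schwarz _ _) _.
    set v := G w (e j) - _ in hD *.
    have hv : rn v <= rn (w - s%:C%C) * (rn (D (e j)) + rn (e j)).
      have := rnD (v - (w - s%:C%C) *: D (e j)) ((w - s%:C%C) *: D (e j)).
      rewrite subrK rnZ; lra.
    rewrite ltr_pdivlMr// /B in wB.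
    have := ler_wpM2r (rn_ge0 (e j)) hv; have := rn_ge0 (w - s%:C%C); lra.
  have cf : ccont (f j) s%:C%C.
    have cp := ccontM cG (ccont_invX m stC).
    have eqf w : rn (w - t%:C%C) < r2 -> w != t%:C%C ->
        f j w = hdot (G w (e j)) (e j) * ((w - t%:C%C) ^+ m)^-1.
      move=> wr wt; rewrite -(H2 w wr wt)//; last exact: basis_orth.
      by rewrite hdotZl mulrC mulKf// expf_neq0// subr_eq0.
    move=> k /cp[d1 d10 Hd].
    pose d2 := Num.min (r2 - r) `|s - t|.
    have d20 : 0 < d2 by rewrite lt_min subr_gt0 rr2 normr_gt0 subr_eq0.
    exists (Num.min d1 d2); first by rewrite lt_min d10.
    move=> w; rewrite lt_min => /andP[/Hd hw]; rewrite lt_min => /andP[w1 w2].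
    have wr2 : rn (w - t%:C%C) < r2.
      apply: le_lt_trans (rn_triangle s%:C%C _ _) _; lra.
    have wt : w != t%:C%C.
      by apply/eqP => wt; move: w2; rewrite wt -rmorphB rn_real distrC ltxx.
    rewrite (eqf w wr2 wt) (eqf s%:C%C (le_lt_trans str rr2)) 1?eq_sym//.
  split => //; apply/eqP; rewrite eq_le; apply/andP; split.
    apply/ler_addgt0Pr => k k0; rewrite add0r; have [d1 d10 Hd] := cf k k0.
    have wd : rn (Complex s (- (d1 / 2)) - s%:C%C) < d1.
      by rewrite rn_ver normrN gtr0_norm ?divr_gt0//; lra.
    have := le_lt_trans (rn_ge_ip _) (Hd _ wd); rewrite ipD ipN ltr_norml => /andP[hk _].
    have w0 : ip (Complex s (- (d1 / 2))) != 0 by rewrite /= oppr_eq0 gt_eqF// divr_gt0.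
    have := fip j _ w0; rewrite /= mulNr oppr_ge0 pmulr_rle0 ?divr_gt0//; lra.
  apply/ler_addgt0Pr => k k0; have [d1 d10 Hd] := cf k k0.
  have wd : rn (Complex s (d1 / 2) - s%:C%C) < d1.
    by rewrite rn_ver gtr0_norm ?divr_gt0//; lra.
  have := le_lt_trans (rn_ge_ip _) (Hd _ wd); rewrite ipD ipN ltr_norml => /andP[_ hk].
  have w0 : ip (Complex s (d1 / 2)) != 0 by rewrite /= gt_eqF// divr_gt0.
  have := fip j _ w0; rewrite /= pmulr_rge0 ?divr_gt0//; lra.
have sm (a b : R) : (forall s, a <= s <= b -> `|s - t| <= r /\ s != t) ->
    forall y, orbit_span g_ y -> small_on T a b y.
  move=> ab; apply: small_orbit => j; apply: (@small_of_real (f j)).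
    by move=> w p w0; apply: fE; rewrite gt_eqF.
  by move=> s /ab[]; exact: fc.
(* The height [r / 4] and the constant [3 / r] are those of [range_bound_of_small]. *)
have r40 : 0 < r / 4 by rewrite divr_gt0.
apply: (closed_range_of_bound inner_sarel r40 (C := 3 / r)).
  by rewrite divr_ge0 ?ler0n// ltW.
move=> y c; apply: (range_bound_of_small inner_sarel r0 (orbit_spanW pg)).
  exact: (orbit_span_dense basis_mul pg).
move=> z dd Yz dd0 ddr; split; apply: sm => // s sab; split; rewrite ?ler_norml; lra.
Qed.

End Main.

End Coupling.

Theorem theorem3p18 (R : realType) (h H ht : hilbertType R)
  (A : set (h * h)%type) (n : nat) (G0 G1 : (h * h)%type -> H)
  (tau : R[i] -> set (H * H)%type)
  (J : {linear h -> ht}%R) (At : set (ht * ht)%type) :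
  linear_subspace A -> closed A -> symmetric_rel A -> discrete_spectrum A ->
  deficiency_indices A n n ->
  boundary_triplet A G0 G1 ->
  Rtilde tau ->
  isometric J -> extension_for J A G0 G1 tau At ->
  discrete_spectrum At <-> Rtilde_mer tau.
Proof.
move=> sA clA symA discA defA bt rt iJ ext.
have cA := closed_nclosed2 clA.
have [sH Hfin] := boundary_space_finite sA cA symA bt defA.
have tau_lin l : 'Im l != 0 -> linear_subspace (tau l).
  by case: rt => t1 _ _ _ /t1[].
have tau_adj l : 'Im l != 0 -> adjoint (tau l) = tau l^*.
  by case: rt => _ _ _; exact.
have [d [e [oe He]]] := orthK_basis A G0 G1 J At Hfin.
have [p_ [g_ pg]] := basis_coupled sA symA bt Hfin tau_lin tau_adj iJ ext oe He.
split=> [dAt|[_ [K' [tau0 [op [F mer FE]]]]] t].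
  split => //; exists (inner_mul A G0 G1 J At).
  have op := weyl_operator_part sA symA bt Hfin tau_lin tau_adj iJ ext oe He pg.
  exists (weyl_op A G0 G1 J At e p_ g_); split => //.
  exists (weyl_op A G0 G1 J At e p_ g_) => //.
  apply: (weyl_meromorphic sA symA bt Hfin tau_lin tau_adj iJ ext oe He pg) => t.
  have [fk cr] := dAt t; rewrite ker_shiftE in fk; rewrite ran_shiftE in cr.
  exact: (inner_closed_of_At sA cA symA bt Hfin iJ ext fk cr).
have [fk cr] := discA t; rewrite ker_shiftE in fk; rewrite ran_shiftE in cr.
split; first by rewrite ker_shiftE; exact: (exit_ker_finite sA cA symA bt Hfin iJ ext fk).
rewrite ran_shiftE.
(* [Rtilde_mer] only provides some [K']; evaluation at ['i] identifies it with the multivalued part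
   found from [At]. *)
have KE : K' = inner_mul A G0 G1 J At.
  have i0 : 'Im ('i : R[i]) != 0 by rewrite im_neq0 ip_i oner_eq0.
  have [<- _ _] := op _ i0; rewrite (inner_mulE sA symA bt iJ ext (l := 'i))//.
  by rewrite -im_neq0.
rewrite {K'}KE in op mer FE.
apply: (At_closed_of_inner sA cA symA bt Hfin tau_lin tau_adj iJ ext cr).
exact: (meromorphic_closed sA cA symA bt Hfin tau_lin tau_adj iJ ext oe He pg op mer FE).
Qed.
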